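(* There exist absolute constants $C,a>0$ and $n_0\ge 2$ such that the following holds. Let $c\ge1$, let $n\ge n_0$, and let $p,q\in[0,1]$ satisfy $0<p+q\le1$ and $\frac{p}{p+q}\ge 32(c+1)\frac{\log n}{n}$. Let $(G_t)_{t\ge0}$ be the edge-Markovian graph $\mathcal{G}(n,p,q)$ with an arbitrary fixed initial graph $G_0$, and let $\mathcal{P}=(P_{\mathrm{LM}}(G_t))_{t\ge1}$ be the (random) sequence of lazy Metropolis walk transition matrices. Then for every integer $k\ge1$, with probability at least $1-n^{-a}$ over the random graph sequence, all of the following hold: $$t_{\mathrm{hit}}^{(k)}(\mathcal{P})\le C\left(\frac{\max\{1,q/p\}}{p+q}+\log n+\frac nk\right),$$ $$t_{\mathrm{cov}}^{(k)}(\mathcal{P})\le C\left(\frac{\max\{1,q/p\}}{p+q}+\log n+\frac{n\log n}{k}\right),$$ $$t_{\mathrm{coal}}(\mathcal{P})\le C\left(\frac{\max\{1,q/p\}}{p+q}+n\right).$$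
   Context: Edge-Markovian graph $\mathcal{G}(n,p,q)$: a random sequence of simple graphs $(G_t)_{t\ge 0}$ on a fixed vertex set $V$ with $|V|=n$. $G_0$ is an arbitrary fixed graph, and $G_{t+1}$ is obtained from $G_t$ by adding each non-edge $e\in\binom V2\setminus E(G_t)$ with probability $p$ and removing each edge $e\in E(G_t)$ with probability $q$, all independently. Lazy Metropolis walk: for a graph $G$ on $V$ with neighbourhoods $N(G,u)$ and degrees $\deg(G,u)=|N(G,u)|$, $P_{\mathrm{LM}}(G)(u,v)=\frac{1}{2\max\{\deg(G,u),\deg(G,v)\}}$ if $\{u,v\}\in E(G)$; $P_{\mathrm{LM}}(G)(u,u)=1-\sum_{w\in N(G,u)}\frac{1}{2\max\{\deg(G,u),\deg(G,w)\}}$; and $0$ otherwise. For a fixed sequence $\mathcal{P}=(P_t)_{t\ge1}$ of transition matrices on $V$ (here: for a fixed realization of the graph sequence), a random walk according to $\mathcal{P}$ is a Markov chain with $\Pr[X_t=v\mid X_{t-1}=u]=P_t(u,v)$. For $k$ independent such walks $X_t=(X_t(1),\dots,X_t(k))$: $\tau_{\mathrm{hit}}^{(k)}(\mathcal{P},w)$ is the first time $t\ge 0$ by which some walk has visited $w$; $\tau_{\mathrm{cov}}^{(k)}(\mathcal{P})$ is the first time by which every vertex has been visited by at least one walk; $t_{\mathrm{hit}}^{(k)}(\mathcal{P})=\max_{x\in V^k,w\in V}\mathbf{E}[\tau_{\mathrm{hit}}^{(k)}(\mathcal{P},w)\mid X_0=x]$ and $t_{\mathrm{cov}}^{(k)}(\mathcal{P})=\max_{x\in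 V^k}\mathbf{E}[\tau_{\mathrm{cov}}^{(k)}(\mathcal{P})\mid X_0=x]$. Coalescing random walks: $n$ walkers start at $x\in V^n$ and move independently according to $\mathcal{P}$, except that walkers located at the same vertex at the same time are merged and move together from then on; $\tau_{\mathrm{coal}}(\mathcal{P})$ is the first time $t\ge 0$ at which all walkers are at one vertex, and $t_{\mathrm{coal}}(\mathcal{P})=\max_{x\in V^n}\mathbf{E}[\tau_{\mathrm{coal}}(\mathcal{P})]$. The expectations are over the walks only, with the graph sequence fixed. *)

(* Defs.v *)
From HB Require Import structures.
From mathcomp Require Import all_boot all_order all_algebra.
From mathcomp Require Import all_classical all_reals all_analysis.
From mathcomp Require Import lra.

Set Implicit Arguments.
Unset Strict Implicit.
Unset Printing Implicit Defensive.

Import Order.TTheory GRing.Theory Num.Theory.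
Local Open Scope classical_set_scope.
Local Open Scope ring_scope.

(* The parameter [x0] only serves to make the type pointed (by the constant
   trajectory), as MathComp-Analysis requires of its measurable types. *)
Definition trajectory (S : finType) (x0 : S) : Type := nat -> S.

HB.instance Definition _ (S : finType) (x0 : S) :=
  gen_eqMixin (trajectory x0).
HB.instance Definition _ (S : finType) (x0 : S) :=
  gen_choiceMixin (trajectory x0).
HB.instance Definition _ (S : finType) (x0 : S) :=
  isPointed.Build (trajectory x0) (fun=> x0).

Definition coordinate_events (S : finType) (x0 : S)
    : set (set (trajectory x0)) :=
  [set A | exists t s, A = [set X | X t = s]].

Arguments coordinate_events {S} x0 _.

(* The product sigma-algebra on trajectories. *)
Notation traj_space x0 := (g_sigma_algebraType (coordinate_events x0)).

(* [K t] is the transition kernel of the step from time [t.-1] to time [t],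
   [t >= 1]; [K 0] is never used. *)
Definition is_chain_law (R : realType) (S : finType)
    (K : nat -> S -> S -> R) (x0 : S) (mu : probability (traj_space x0) R)
    : Prop :=
  forall (t : nat) (y : nat -> S),
    mu [set X | forall s, (s <= t)%N -> X s = y s] =
    ((y 0%N == x0)%:R * \prod_(1 <= s < t.+1) K s (y s.-1) (y s))%:E.

(* The law of the chain started at [x0]. It satisfies [is_chain_law] whenever
   the kernels are stochastic: see [chain_lawP] below. *)
Definition chain_law (R : realType) (S : finType)
    (K : nat -> S -> S -> R) (x0 : S) : probability (traj_space x0) R :=
  get [set mu | is_chain_law K mu].

Definition stochastic (R : realType) (S : finType) (K : S -> S -> R) : Prop :=
  (forall x y, 0 <= K x y) /\ (forall x, \sum_y K x y = 1).

(* First time at which [E] holds, [+oo] if there is none. *)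
Definition first_time (R : realType) (E : nat -> Prop) : \bar R :=
  ereal_inf [set t%:R%:E | t in E].

Section Walks.
Context {R : realType} {V : finType}.
Implicit Types (P : V -> V -> R) (Ps : nat -> V -> V -> R).

Definition indep_step (k : nat) P (x y : {ffun 'I_k -> V}) : R :=
  \prod_(i < k) P (x i) (y i).

Definition hit_time (k : nat) (w : V) (X : nat -> {ffun 'I_k -> V}) : \bar R :=
  first_time R [set t | exists i s, (s <= t)%N /\ X s i = w].

Definition cov_time (k : nat) (X : nat -> {ffun 'I_k -> V}) : \bar R :=
  first_time R [set t | forall v, exists i s, (s <= t)%N /\ X s i = v].

Definition t_hit (k : nat) Ps : \bar R :=
  \big[maxe/-oo%E]_(x : {ffun 'I_k -> V}) \big[maxe/-oo%E]_(w : V)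
    (\int[chain_law (fun t => @indep_step k (Ps t)) x]_X hit_time w X)%E.

Definition t_cov (k : nat) Ps : \bar R :=
  \big[maxe/-oo%E]_(x : {ffun 'I_k -> V})
    (\int[chain_law (fun t => @indep_step k (Ps t)) x]_X cov_time X)%E.

(* One step of [n] coalescing walkers at positions [x]. Walkers sharing a
   vertex move together, and each occupied vertex contributes one independent
   transition: that of the walker of least index among those sitting there. *)
Definition coal_step (n : nat) P (x y : {ffun 'I_n -> V}) : R :=
  if [forall i, forall j, (x i == x j) ==> (y i == y j)] then
    \prod_(i < n | [forall j, (x j == x i) ==> (i <= j)%N]) P (x i) (y i)
  else 0.

Definition coal_time (n : nat) (X : nat -> {ffun 'I_n -> V}) : \bar R :=
  first_time R [set t | forall i j, X t i = X t j].

Definition t_coal Ps : \bar R :=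
  \big[maxe/-oo%E]_(x : {ffun 'I_#|V| -> V})
    (\int[chain_law (fun t => @coal_step #|V| (Ps t)) x]_X coal_time X)%E.

End Walks.

(* A simple graph on [V] is a set of unordered pairs of distinct vertices. *)
Definition vpair (V : finType) : Type := {e : {set V} | #|e| == 2}.
HB.instance Definition _ (V : finType) := Finite.on (vpair V).

Definition sgraph (V : finType) : Type := {set vpair V}.
HB.instance Definition _ (V : finType) := Finite.on (sgraph V).

Section Graphs.
Context {R : realType} {V : finType}.
Implicit Types G H : sgraph V.

Definition adj G (u v : V) : bool := [exists e in G, val e == [set u; v]%SET].

Definition nbhd G (u : V) : {set V} := [set v | adj G u v]%SET.

Definition deg G (u : V) : nat := #|nbhd G u|.

Definition PLM G (u v : V) : R :=
  if adj G u v then (2 * maxn (deg G u) (deg G v))%:R^-1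
  else if u == v then
    1 - \sum_(w in nbhd G u) (2 * maxn (deg G u) (deg G w))%:R^-1
  else 0.

Definition em_step (p q : R) G H : R :=
  \prod_(e : vpair V)
    (if e \in G then (if e \in H then 1 - q else q)
     else (if e \in H then p else 1 - p)).

Definition edge_markovian (p q : R) (G0 : sgraph V) :
    probability (traj_space G0) R :=
  chain_law (fun=> em_step p q) G0.

End Graphs.

(* Existence of the law: the chain is realised on [0, 1[ with the Lebesgue
   measure, each interval being cut in proportion to the next transition. *)
Section ChainLawExists.
Context {R : realType} {S : finType}.

Let psum (k : S -> R) (j : nat) : R := \sum_(w <- take j (enum S)) k w.
Let cdf (k : S -> R) (v : S) : R := psum k (index v (enum S)).

Let psumS k v : psum k (index v (enum S)).+1 = cdf k v + k v.
Proof.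
rewrite /psum (take_nth v) ?index_mem ?mem_enum// -cats1 big_cat big_seq1.
by rewrite nth_index ?mem_enum.
Qed.

Let psum_mono (k : S -> R) i j : (forall v, 0 <= k v) -> (i <= j)%N ->
  psum k i <= psum k j.
Proof.
move=> k0 ij; rewrite /psum -(subnKC ij) takeD big_cat lerDl.
exact: sumr_ge0.
Qed.

Let psum_le1 (k : S -> R) j : (forall v, 0 <= k v) -> \sum_v k v = 1 -> psum k j <= 1.
Proof.
move=> k0 <-; rewrite [leRHS](_ : _ = psum k (size (enum S))); last first.
  by rewrite /psum take_size big_enum.
case: (leqP j (size (enum S))) => [|/ltnW] h; first exact: psum_mono.
by rewrite /psum take_size take_oversize.
Qed.

Let cell (k : S -> R) (a l u : R) (v : S) : bool :=
  a + l * cdf k v <= u < a + l * (cdf k v + k v).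

Let cell_uniq (k : S -> R) (a l u : R) v v' : (forall v, 0 <= k v) -> 0 <= l ->
  cell k a l u v -> cell k a l u v' -> v = v'.
Proof.
move=> k0 l0.
wlog le : v v' / (index v (enum S) <= index v' (enum S))%N.
  move=> h; case/orP: (leq_total (index v (enum S)) (index v' (enum S))).
    exact: h.
  by move=> h1 h2 h3; apply/esym; exact: h.
move: le; rewrite leq_eqVlt => /predU1P[e _ _|lt].
  by rewrite -(nth_index v (mem_enum S v)) e nth_index// mem_enum.
move=> /andP[_ h1] /andP[h2 _].
have := psum_mono k0 lt; rewrite psumS -/(cdf k v') => h3.
have := ler_wpM2l l0 h3 => h4; exfalso; lra.
Qed.

Let cell_ex k a l u : \sum_v k v = 1 -> a <= u < a + l ->
  exists v, cell k a l u v.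
Proof.
move=> k1 /andP[au ual].
have ex : exists j, u < a + l * psum k j.
  exists (size (enum S)); rewrite /psum take_size big_enum/= k1.
  by rewrite mulr1.
case: (ex_minnP ex) => -[|j] uj jmin.
  by move: uj; rewrite /psum take0 big_nil mulr0 addr0 ltNge au.
have jS : (j < size (enum S))%N.
  rewrite ltnNge; apply/negP => h.
  suff : (j < j)%N by rewrite ltnn.
  apply: jmin.
  by move: uj; rewrite /psum !take_oversize// leqW.
have [v0 _] : exists v : S, true.
  by case: (enum S) jS => // v; exists v.
exists (nth v0 (enum S) j); rewrite /cell -psumS /cdf.
rewrite index_uniq ?enum_uniq// uj andbT leNgt; apply/negP => /jmin.
by rewrite ltnn.
Qed.

Context (K : nat -> S -> S -> R) (x0 : S) (Kst : forall t, stochastic (K t)).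

Let K0 t x v : 0 <= K t x v. Proof. exact: (Kst t).1. Qed.
Let K1 t x : \sum_v K t x v = 1. Proof. exact: (Kst t).2. Qed.

Local Fixpoint len (y : nat -> S) (t : nat) : R :=
  if t is t'.+1 then len y t' * K t (y t') (y t) else 1.

Local Fixpoint lo (y : nat -> S) (t : nat) : R :=
  if t is t'.+1 then lo y t' + len y t' * cdf (K t (y t')) (y t) else 0.

Local Fixpoint path_state (u : R) (t : nat) : S * R * R :=
  if t is t'.+1 then
    let: (s, a, l) := path_state u t' in
    let v := odflt s [pick v | cell (K t s) a l u v] in
    (v, a + l * cdf (K t s) v, l * K t s v)
  else (x0, 0, 1).

Let pth u t : S := (path_state u t).1.1.

Let len_ge0 y t : 0 <= len y t.
Proof. by elim: t => //= t IH; rewrite mulr_ge0. Qed.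

Let path_stateE u y t : (forall s, (s <= t)%N -> pth u s = y s) ->
  path_state u t = (y t, lo y t, len y t).
Proof.
elim: t => [|t IH] h; first by rewrite -(h 0%N).
have := h t.+1 (leqnn _); rewrite /pth /= IH => [/= ->//|s st].
by apply: h; exact: leqW.
Qed.

Let cdf_ge0 k v : (forall v, 0 <= k v) -> 0 <= cdf k v.
Proof. by move=> k0; exact: sumr_ge0. Qed.

Let in_itv_S u y t : lo y t.+1 <= u < lo y t.+1 + len y t.+1 ->
  lo y t <= u < lo y t + len y t.
Proof.
move=> /= /andP[h1 h2].
have l0 := len_ge0 y t.
have c0 := cdf_ge0 (y t.+1) (K0 t.+1 (y t)).
have : cdf (K t.+1 (y t)) (y t.+1) + K t.+1 (y t) (y t.+1) <= 1.
  by rewrite -psumS; apply: psum_le1.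
move=> /(ler_wpM2l l0) h3; have := mulr_ge0 l0 c0 => h4.
by apply/andP; split; lra.
Qed.

Let path_cylinder u y t : 0 <= u < 1 ->
  (forall s, (s <= t)%N -> pth u s = y s) <->
  (y 0%N = x0 /\ lo y t <= u < lo y t + len y t).
Proof.
move=> u01; elim: t => [|t IH].
  split=> [/(_ 0%N (leqnn _)) <-|[y0 _] [|//] _]; first by rewrite /= add0r.
  by rewrite y0.
split=> [h|[y0 h]].
  have h' s : (s <= t)%N -> pth u s = y s by move=> /leqW; exact: h.
  have [y0 ut] := IH.1 h'; split => //.
  have := h t.+1 (leqnn _); rewrite /pth/= (path_stateE h').
  case: pickP => [v cv /= <-|no].
    by move: cv; rewrite /cell mulrDr addrA.
  by have [v] := cell_ex (K1 t.+1 (y t)) ut; rewrite no.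
have h' := IH.2 (conj y0 (in_itv_S h)).
move=> s; rewrite leq_eqVlt => /predU1P[->|]; last by rewrite ltnS; exact: h'.
rewrite /pth/= (path_stateE h').
have cy : cell (K t.+1 (y t)) (lo y t) (len y t) u (y t.+1).
  by rewrite /cell mulrDr addrA.
case: pickP => [v cv /=|]; last by move=> /(_ (y t.+1)); rewrite cy.
exact: cell_uniq cv cy.
Qed.

Let rpath (u : measurableTypeR R) : traj_space x0 :=
  if 0 <= u < 1 then pth u else fun=> x0.

Let I01 : set (measurableTypeR R) := `[0, 1[.

Let mI01 : measurable I01. Proof. exact: measurable_itv. Qed.

Let cyl t y : set (measurableTypeR R) :=
  [set u | (0 <= u < 1) /\ forall s, (s <= t)%N -> rpath u s = y s].

Let cylE t y : cyl t y =
  if y 0%N == x0 then `[lo y t, lo y t + len y t[%classic else set0.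
Proof.
apply/seteqP; split => u /=.
  rewrite /cyl/= /rpath => -[u01]; rewrite u01 => /(path_cylinder _ _ u01)[-> h].
  by rewrite eqxx/= in_itv.
case: eqP => //= y0; rewrite in_itv/= => h; rewrite /cyl/= /rpath.
have u01 : 0 <= u < 1.
  by elim: t h => [|t IH]; [rewrite /= add0r|move/in_itv_S].
by rewrite u01; split => //; apply/path_cylinder.
Qed.

Let measurable_cyl t y : measurable (cyl t y).
Proof. by rewrite cylE; case: ifP. Qed.

Let measurable_rpath : measurable_fun setT rpath.
Proof.
apply: (@measurability _ _ _ _ setT rpath (coordinate_events x0)) => //.
move=> _ [_ [t [s ->]] <-]; rewrite setTI.
pose f (z : {ffun 'I_t.+1 -> S}) : nat -> S := fun i => z (inord i).
rewrite (_ : _ @^-1` _ = (~` I01 `&` [set _ | x0 = s]) `|`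
   \big[setU/set0]_(z : {ffun 'I_t.+1 -> S} | f z t == s) cyl t (f z)).
  apply: measurableU; last by apply: bigsetU_measurable => z _.
  apply: measurableI; first exact: measurableC.
  have [e|ne] := pselect (x0 = s).
    by rewrite (_ : [set _ | _] = setT); last by apply/seteqP; split.
  by rewrite (_ : [set _ | _] = set0); last by apply/seteqP; split.
apply/seteqP; split => u /=.
  rewrite /I01/= /rpath; case: ifPn => u01 h; last first.
    by left; split => //; rewrite in_itv/=; exact/negP.
  right; rewrite -bigcup_seq_cond.
  exists [ffun i : 'I_t.+1 => pth u i] => /=.
    by rewrite mem_index_enum /f ffunE inordK// h eqxx.
  split => // i it; by rewrite /rpath u01 /f ffunE inordK.
rewrite -bigcup_seq_cond => -[[]|[z /andP[_ /eqP fz] [u01 h]]].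
  by rewrite /I01/= in_itv/= /rpath => /negP/negbTE ->.
by rewrite h.
Qed.

HB.instance Definition _ := isMeasurableFun.Build _ _ _ _ rpath measurable_rpath.

Let lebesgue01 := mrestr (@lebesgue_measure R) mI01.

HB.instance Definition _ := Measure.on lebesgue01.

Let lebesgue01T : lebesgue01 setT = 1%E.
Proof.
rewrite /lebesgue01 /mrestr setTI /I01 lebesgue_measure_itv/= lte_fin ltr01.
by rewrite sube0.
Qed.

HB.instance Definition _ := @Measure_isProbability.Build _ _ R
  lebesgue01 lebesgue01T.

Let lenE y t : len y t = \prod_(1 <= s < t.+1) K s (y s.-1) (y s).
Proof.
elim: t => [|t IH]; first by rewrite big_geq.
by rewrite big_nat_recr//= -IH.
Qed.

Lemma chain_law_exists :
  exists mu : probability (traj_space x0) R, is_chain_law K mu.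
Proof.
exists (distribution lebesgue01 rpath) => t y.
rewrite /distribution/= /pushforward/= /lebesgue01 /mrestr.
rewrite (_ : _ `&` _ = cyl t y); last first.
  by apply/seteqP; split => u; rewrite /cyl/I01/= in_itv/= => -[].
rewrite cylE -lenE; case: eqP => _; last by rewrite measure0 mul0r.
rewrite lebesgue_measure_itv/= mul1r lte_fin ltrDl.
have := len_ge0 y t; rewrite le_eqVlt => /predU1P[<-|l0]; first by rewrite ltxx.
by rewrite l0 -EFinD addrAC subrr add0r.
Qed.

Lemma chain_lawP : is_chain_law K (chain_law K x0).
Proof.
by have [mu muP] := chain_law_exists; exact: (getPex (ex_intro _ mu muP)).
Qed.

End ChainLawExists.
Section Stochasticity.
Context {R : realType} {V : finType}.

Lemma indep_step_stochastic (k : nat) (P : V -> V -> R) :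
  stochastic P -> stochastic (@indep_step R V k P).
Proof.
move=> [P0 P1]; split => [x y|x]; first exact: prodr_ge0.
rewrite /indep_step -(bigA_distr_bigA (fun i v => P (x i) v))/=.
by rewrite big1.
Qed.

Lemma coal_step_stochastic (n : nat) (P : V -> V -> R) :
  stochastic P -> stochastic (@coal_step R V n P).
Proof.
move=> [P0 P1]; split => [x y|x].
  by rewrite /coal_step; case: ifP => // _; exact: prodr_ge0.
pose ld (i : 'I_n) := [forall j, (x j == x i) ==> (i <= j)%N].
pose rep (i : 'I_n) := [arg min_(j < i | x j == x i) (j : nat)]%N.
have repx i : x (rep i) = x i by rewrite /rep; case: arg_minnP => // j /eqP.
have repld i : ld (rep i).
  apply/forallP => j; apply/implyP; rewrite repx /rep => xj.
  by case: arg_minnP => // l _; apply.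
have ldrep i : ld i -> rep i = i.
  move=> /forallP/(_ (rep i)); rewrite repx eqxx/= => le1; apply/val_inj/eqP.
  rewrite eqn_leq le1 andbT /rep; case: arg_minnP => // l _; exact.
have repeq i j : x i = x j -> rep i = rep j.
  move=> xij; apply/val_inj/eqP; rewrite eqn_leq.
  have /forallP/(_ (rep j)) := repld i; rewrite !repx xij eqxx/= => ->.
  by have /forallP/(_ (rep i)) := repld j; rewrite !repx xij eqxx/= => ->.
pose Q (i : 'I_n) (v : V) := ld i || (v == x i).
pose F (i : 'I_n) (v : V) := if ld i then P (x i) v else 1.
have : \prod_i \sum_(v | Q i v) F i v = 1.
  apply: big1 => i _; rewrite /Q /F; case: (ld i) => /=; first exact: P1.
  by rewrite big_pred1_eq.
rewrite bigA_distr_big_dep => <-; rewrite /coal_step -big_mkcond/=.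
pose h (g : {ffun 'I_n -> V}) := [ffun i => g (rep i)].
pose h' (y : {ffun 'I_n -> V}) := [ffun i => if ld i then y i else x i].
rewrite (reindex_onto h h') => [|y /forallP cy]; last first.
  apply/ffunP => i; rewrite !ffunE repld.
  by have /forallP/(_ i) := cy (rep i); rewrite repx eqxx => /eqP.
apply: eq_big => [g|g _].
  apply/andP/familyP => [[_ /eqP <-] i|gQ].
    by rewrite /Q ffunE unfold_in; case: (ld i) => //=.
  split; last first.
    apply/eqP/ffunP => i; rewrite !ffunE; have := gQ i; rewrite unfold_in /Q.
    by case: (boolP (ld i)) => [/ldrep ->|_ /eqP ->].
  apply/forallP => i; apply/forallP => j; apply/implyP => /eqP xij.
  by rewrite !ffunE (repeq _ _ xij).
rewrite big_mkcond; apply: eq_bigr => i _; rewrite /F -/(ld i).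
by case: (boolP (ld i)) => // /ldrep li; rewrite ffunE li.
Qed.

Lemma PLM_stochastic (G : sgraph V) : stochastic (@PLM R V G).
Proof.
have adjxx u : adj G u u = false.
  apply/negbTE/existsPn => e; rewrite negb_and; apply/orP; right.
  apply/eqP => eu; have := valP e; rewrite eu.
  by rewrite finset.setUid cards1.
split => [u v|u]; rewrite /PLM.
  case: ifP => _; first by rewrite invr_ge0.
  case: eqP => // _; rewrite subr_ge0.
  have [d0|d0] := posnP (deg G u).
    by rewrite (cards0_eq d0) big_set0.
  apply: (@le_trans _ _ (\sum_(w in nbhd G u) (deg G u)%:R^-1)).
    apply: ler_sum => w _; rewrite lef_pV2 ?posrE ?ltr0n ?ler_nat.
    - by rewrite (leq_trans (leq_maxl _ (deg G w)))// leq_pmull.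
    - by rewrite muln_gt0/= leq_max d0.
    - exact: d0.
  by rewrite sumr_const -/(deg G u) -[leLHS]mulr_natr mulVf// pnatr_eq0 -lt0n.
rewrite (bigD1 u)//= adjxx eqxx.
rewrite [X in _ + X](_ : _ =
  \sum_(w in nbhd G u) (2 * maxn (deg G u) (deg G w))%:R^-1) ?subrK//.
rewrite big_mkcond [RHS]big_mkcond; apply: eq_bigr => v _ /=.
rewrite inE eq_sym; case: eqP => [->|_] /=; first by rewrite adjxx.
by case: ifP.
Qed.

Lemma em_step_stochastic (p q : R) :
  0 <= p <= 1 -> 0 <= q <= 1 -> stochastic (@em_step R V p q).
Proof.
move=> /andP[p0 p1] /andP[q0 q1]; split => [G H|G].
  by apply: prodr_ge0 => e _; do 2 case: ifP => _; rewrite ?subr_ge0.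
transitivity (\prod_(e : vpair V)
  ((if e \in G then 1 - q else p) + (if e \in G then q else 1 - p))).
  rewrite bigA_distr; apply: eq_big => // H _; apply: eq_bigr => e _.
  by do 2 case: ifP.
by apply: big1 => e _; case: ifP => _; lra.
Qed.

End Stochasticity.

(* Main.v *)
Require Import Defs.
From HB Require Import structures.
From mathcomp Require Import all_boot all_order all_algebra.
From mathcomp Require Import all_classical all_reals all_analysis.
From mathcomp Require Import measurable_realfun ring lra.

Set Implicit Arguments.
Unset Strict Implicit.
Unset Printing Implicit Defensive.

Import Order.TTheory GRing.Theory Num.Theory.
Local Open Scope classical_set_scope.
Local Open Scope ring_scope.

(* Write [pi = p / (p + q)] and [n = #|V|]. After [T0 = O(max(1, q/p) / (p + q))] steps the edges
   are independent, each present with probability between [pi / 2] and [3 pi / 2], whatever [G0].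
   Chernoff bounds over all vertex neighbourhoods and all edge cuts, with Cheeger's inequality,
   then make [PLM (G t)] contract variances by a constant factor, except with probability [n^-10].

   Only this contraction is used about the walks. A function vanishing at one vertex has at least
   [1/n] of its squared norm as variance, so avoiding a target, possibly a moving one, costs a
   factor [1 - gap / n] of squared norm per step. After [O(log n)] steps of mixing this
   gives the hitting time of [k] walks, and the cover time by a union bound.

   Coalescing walkers are moved by independent random maps [xi], so a vertex is occupied after
   several steps iff its iterated preimage meets the set of starting points. The size of the
   preimage is a martingale whose step variance is of the order of its size, as in a critical
   branching process; it survives [n] steps with probability [O(1 / n)], whence [O(1)] walkers
   remain on average, and each of them meets a fixed one in time [O(n)].

   After a window of [n^2] steps, all survival probabilities are at most [n^2] times the product
   of the contraction factors met so far. The expectation of this product over the graphs decays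
   geometrically by the Markov property, and Markov's inequality for its sum over time controls
   the rest of the expected times. *)

(** A bad graph is therefore not excluded but given contraction rate 0, which is legitimate because
    every lazy Metropolis kernel is symmetric. The price is a product of random factors, whose mean
    is bounded uniformly in the starting graph.

    Inside the window the bounds must be sharp. After mixing, one walker survives with probability
    at most [1 + 1/n] times a geometric term; a larger constant would be lost, since for [k] walkers
    the bound is raised to the power [k]. Capping [k] at [n] keeps [(1 + 1/n)^k] below [e].

    The target has to be allowed to move because, in coalescence, each walker is the target of
    another one.

    Since [c >= 1], the density is at least [64 log n / n]; this makes a cut around [S] too small
    with probability at most [n^(-12 |S|)], which is summable over all vertex sets. *)

Definition depends_upto (S : finType) (T : Type) (t : nat) (F : (nat -> S) -> T) : Prop :=
  forall X Y, (forall s, (s <= t)%N -> X s = Y s) -> F X = F Y.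

(* Backward evolution [K_{t0+1} (... (K_{t0+t} f))] from time [t0]. *)
Fixpoint run (R : realType) (S : finType) (K : nat -> S -> S -> R)
    (t0 t : nat) (f : S -> R) (x : S) : R :=
  if t is t'.+1 then \sum_y K t0.+1 x y * run K t0.+1 t' f y else f x.

(** * Functionals of finitely many steps of a chain *)

Section FiniteHorizon.
Context {S : finType} {x0 : S}.

Lemma measurable_cylinder t (y : nat -> S) :
  measurable ([set X | forall s, (s <= t)%N -> X s = y s] : set (traj_space x0)).
Proof.
rewrite (_ : [set X | _] = \bigcap_(s in [set s | (s <= t)%N]) [set X | X s = y s]); last first.
  by apply/seteqP; split => X h s; exact: h.
apply: bigcap_measurable; first by exists 0%N.
by move=> s _; apply: sub_gen_smallest; exists s, (y s).
Qed.

Definition extend t (z : {ffun 'I_t.+1 -> S}) : nat -> S := fun s => z (inord s).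

Lemma extend_restrict t (X : nat -> S) s : (s <= t)%N ->
  extend [ffun i : 'I_t.+1 => X i] s = X s.
Proof. by move=> st; rewrite /extend ffunE inordK. Qed.

Lemma depends_upto_measurable t (A : set (traj_space x0)) :
  depends_upto t (A : (nat -> S) -> Prop) -> measurable A.
Proof.
move=> dA; rewrite (_ : A = \bigcup_(z in [set z : {ffun 'I_t.+1 -> S} | A (extend z)])
    [set X | forall s, (s <= t)%N -> X s = extend z s]).
  by apply: fin_bigcup_measurable => [|z _]; [exact: finite_finset | exact: measurable_cylinder].
apply/seteqP; split => [X AX|X [z Az Xz]].
  exists [ffun i : 'I_t.+1 => X i] => [|s st]; last by rewrite extend_restrict.
  by rewrite /= (dA _ X) // => s st; rewrite extend_restrict.
by rewrite (dA _ _ Xz).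
Qed.

Lemma depends_upto_measurable_fun d (T : measurableType d) t (F : traj_space x0 -> T) :
  depends_upto t (F : (nat -> S) -> T) -> measurable_fun setT F.
Proof.
move=> dF _ Y mY; apply: (@depends_upto_measurable t) => X X' XX'.
by rewrite /setI /preimage /= (dF X X').
Qed.

End FiniteHorizon.

Section ChainExpectation.
Context {R : realType} {S : finType} {x0 : S} {K : nat -> S -> S -> R}.
Hypothesis Kst : forall t, stochastic (K t).
Let mu := chain_law K x0.

Let weight t (y : nat -> S) : R :=
  (y 0%N == x0)%:R * \prod_(1 <= s < t.+1) K s (y s.-1) (y s).

Lemma chain_cylinder t y :
  mu [set X | forall s, (s <= t)%N -> X s = y s] = (weight t y)%:E.
Proof. exact: (chain_lawP x0 Kst). Qed.

Lemma integral_fin_indic (I : finType) (c : I -> R) (A : I -> set (traj_space x0)) :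
  (forall i, 0 <= c i) -> (forall i, measurable (A i)) ->
  (\int[mu]_X (\sum_i c i * \1_(A i) X)%:E = \sum_i (c i)%:E * mu (A i))%E.
Proof.
move=> c0 mA.
under eq_integral do rewrite -sumEFin.
rewrite ge0_integral_sum//; last 2 first.
- move=> i; apply/measurable_EFinP; apply: measurable_funM => //.
- by move=> i x _; rewrite lee_fin mulr_ge0.
apply: eq_bigr => i _.
under eq_integral do rewrite EFinM.
rewrite ge0_integralZl// ?lee_fin//; last first.
  apply/measurable_EFinP; exact: measurable_indic.
by rewrite integral_indic// setIT.
Qed.

(** The law is known only through its cylinder probabilities. A function of finitely many
    coordinates is a combination of cylinder indicators, one per prefix, so its integral is a finite
    sum. *)
Lemma integral_depends t (F : (nat -> S) -> R) : depends_upto t F -> (forall X, 0 <= F X) ->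
  (\int[mu]_X (F X)%:E = (\sum_(z : {ffun 'I_t.+1 -> S}) F (extend z) * weight t (extend z))%:E)%E.
Proof.
move=> dF F0.
pose A (z : {ffun 'I_t.+1 -> S}) : set (traj_space x0) :=
  [set X | forall s, (s <= t)%N -> X s = extend z s].
transitivity (\int[mu]_X (\sum_z F (extend z) * \1_(A z) X)%:E)%E.
  apply: eq_integral => X _; congr _%:E.
  have AX : A [ffun i : 'I_t.+1 => X i] X by move=> s st; rewrite extend_restrict.
  rewrite (bigD1 [ffun i : 'I_t.+1 => X i])//= indicE mem_set// mulr1.
  rewrite big1 ?addr0; last first.
    move=> z zX; rewrite indicE memNset ?mulr0// => Az; move/eqP: zX; apply.
    by apply/ffunP => i; rewrite ffunE Az ?/extend ?inord_val// -ltnS.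
  by apply: dF => s st; rewrite extend_restrict.
rewrite integral_fin_indic//; last by move=> z; exact: measurable_cylinder.
by rewrite -sumEFin; apply: eq_bigr => z _; rewrite chain_cylinder EFinM.
Qed.

Lemma weight_step t (y : nat -> S) v :
  weight t.+1 (fun s => if (s <= t)%N then y s else v) = weight t y * K t.+1 (y t) v.
Proof.
rewrite /weight big_nat_recr//= ltnn leqnn mulrA; congr (_ * _ * _).
by apply: eq_big_nat => s /andP[_]; rewrite ltnS => st; rewrite st (leq_trans (leq_pred s)).
Qed.

Lemma markov_property t (H : (nat -> S) -> R) (f : S -> R) :
  depends_upto t H -> (forall X, 0 <= H X) -> (forall x, 0 <= f x) ->
  (\int[mu]_X (H X * f (X t.+1))%:E = \int[mu]_X (H X * \sum_y K t.+1 (X t) y * f y)%:E)%E.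
Proof.
move=> dH H0 f0.
have K0 s x y : 0 <= K s x y by exact: (Kst s).1.
rewrite [RHS](@integral_depends t); last 2 first.
- by move=> X Y XY; rewrite (dH _ _ XY) (XY t).
- by move=> X; rewrite mulr_ge0// sumr_ge0// => y _; rewrite mulr_ge0.
pose A (zv : {ffun 'I_t.+1 -> S} * S) : set (traj_space x0) :=
  [set X | forall s, (s <= t.+1)%N -> X s = if (s <= t)%N then extend zv.1 s else zv.2].
transitivity (\int[mu]_X (\sum_zv (H (extend zv.1) * f zv.2) * \1_(A zv) X)%:E)%E.
  apply: eq_integral => X _; congr _%:E.
  have AX : A ([ffun i : 'I_t.+1 => X i], X t.+1) X.
    move=> s; rewrite leq_eqVlt => /predU1P[->|]; first by rewrite ltnn.
    by rewrite ltnS => st; rewrite st extend_restrict.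
  rewrite (bigD1 ([ffun i : 'I_t.+1 => X i], X t.+1))//= indicE mem_set// mulr1.
  rewrite big1 ?addr0; last first.
    move=> [z v] zX; rewrite indicE memNset ?mulr0// => Az; move/eqP: zX; apply.
    congr pair; last by rewrite Az// ltnn.
    apply/ffunP => i; have it : (i <= t)%N by rewrite -ltnS.
    by rewrite ffunE Az ?it ?(leqW it)//= /extend inord_val.
  congr (_ * _); by apply: dH => s st; rewrite extend_restrict.
rewrite integral_fin_indic//; last 2 first.
- by move=> zv; rewrite mulr_ge0.
- move=> zv; exact: (measurable_cylinder t.+1 (fun s => if (s <= t)%N then extend zv.1 s else zv.2)).
rewrite -(pair_bigA _ (fun z v => ((H (extend z) * f v)%:E * mu (A (z, v)))%E))/= -sumEFin.
apply: eq_bigr => z _.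
rewrite mulrAC mulr_sumr -sumEFin; apply: eq_bigr => v _.
rewrite -[X in mu X]/[set X | forall s, (s <= t.+1)%N -> X s = (fun s => if (s <= t)%N then extend z s else v) s].
by rewrite chain_cylinder weight_step -EFinM; congr _%:E; ring.
Qed.

(** A Feynman-Kac formula: multiplicative weights along the path are absorbed into the kernel. With
    indicators as weights it turns avoidance probabilities into [run] of a killed kernel; with
    contraction factors it gives the mean of their product over the graphs. *)
Lemma expectation_run (g : nat -> S -> R) (f : S -> R) t :
  (forall s x, 0 <= g s x) -> (forall x, 0 <= f x) ->
  (\int[mu]_X ((\prod_(1 <= s < t.+1) g s (X s)) * f (X t))%:E =
   (run (fun s x y => K s x y * g s y) 0 t f x0)%:E)%E.
Proof.
move=> g0 f0.
have K0 s x y : 0 <= K s x y by exact: (Kst s).1.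
pose Kg := fun s x y => K s x y * g s y; rewrite -/Kg.
have run0 a b h : (forall x, 0 <= h x) -> forall x, 0 <= run Kg a b h x.
  move=> h0; elim: b a => //= b IH a x; apply: sumr_ge0 => y _.
  by rewrite mulr_ge0// /Kg mulr_ge0.
(* The last [j] steps are peeled off one by one with the Markov property, the weighted future being
   replaced by its [run]. *)
suff gen j : (j <= t)%N ->
    (\int[mu]_X ((\prod_(1 <= s < t.+1) g s (X s)) * f (X t))%:E =
     \int[mu]_X ((\prod_(1 <= s < (t - j).+1) g s (X s)) * run Kg (t - j) j f (X (t - j)%N))%:E)%E.
  rewrite (gen t)// subnn (@integral_depends 0); last 2 first.
  - by move=> X Y XY; rewrite big_geq// big_geq// XY.
  - by move=> X; rewrite big_geq// mul1r run0.
  congr _%:E; rewrite (bigD1 [ffun=> x0])//= [X in _ + X]big1 ?addr0.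
    by rewrite /weight !big_geq// /extend ffunE eqxx !mul1r mulr1.
  move=> z zx; rewrite /weight; case: eqP; last by rewrite mul0r mulr0.
  move=> zx0; case/negP: zx; apply/eqP/ffunP => i; rewrite ffunE -zx0 /extend.
  by rewrite ord1; congr (z _); apply/val_inj; rewrite /= inordK.
elim: j => [|j IH] jt; first by rewrite subn0.
rewrite IH; last exact: ltnW.
rewrite -{1 2 3}(subnSK jt).
under eq_integral => X _ do rewrite big_nat_recr//= -mulrA.
set i := (t - j.+1)%N.
rewrite (@markov_property i (fun X => \prod_(1 <= s < i.+1) g s (X s))
          (fun y => g i.+1 y * run Kg i.+1 j f y)).
- apply: eq_integral => X _; congr (_ * _)%:E.
  by rewrite /=; apply: eq_bigr => y _; rewrite /Kg !mulrA.
- by move=> X Y XY; apply: eq_big_nat => s /andP[_ si]; rewrite XY.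
- by move=> X; exact: prodr_ge0.
- by move=> x; rewrite mulr_ge0// run0.
Qed.

Lemma expectation_run_unweighted (f : S -> R) t : (forall x, 0 <= f x) ->
  (\int[mu]_X (f (X t))%:E = (run K 0 t f x0)%:E)%E.
Proof.
move=> f0; have := @expectation_run (fun _ _ => 1) f t (fun _ _ => ler01) f0.
under eq_integral do rewrite big1// mul1r.
move=> ->; congr _%:E; elim: t 0%N (x0) => //= t IH a x.
by apply: eq_bigr => y _; rewrite IH mulr1.
Qed.

(** A union bound over scenarios [i]. With killing indicators as weights, the index is trivial for
    hitting and ranges over the possible unvisited vertex for covering. *)
Lemma law_le_weighted_run (I : finType) (A : set (traj_space x0)) t (g : I -> nat -> S -> R) :
  depends_upto t (A : (nat -> S) -> Prop) -> (forall i s x, 0 <= g i s x) ->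
  (forall X, A X -> 1 <= \sum_i \prod_(1 <= s < t.+1) g i s (X s)) ->
  (mu A <= (\sum_i run (fun s x y => K s x y * g i s y) 0 t (fun=> 1) x0)%:E)%E.
Proof.
move=> dA g0 gA.
have mA := depends_upto_measurable dA.
have dg i : depends_upto t (fun X : nat -> S => (\prod_(1 <= s < t.+1) g i s (X s))).
  by move=> X Y XY; apply: eq_big_nat => s /andP[_]; rewrite ltnS => /XY ->.
have mg i : measurable_fun setT (fun X : traj_space x0 => (\prod_(1 <= s < t.+1) g i s (X s))%:E).
  by apply/measurable_EFinP; exact: (depends_upto_measurable_fun (dg i)).
rewrite -(setIT A) -integral_indic// -sumEFin.
apply: (@le_trans _ _ (\int[mu]_X (\sum_i (\prod_(1 <= s < t.+1) g i s (X s))%:E)))%E.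
  apply: ge0_le_integral => //.
  - by apply/measurable_EFinP; exact: measurable_indic.
  - by apply: emeasurable_sum.
  - move=> X _; rewrite sumEFin lee_fin indicE; have [/set_mem/gA//|_] := boolP (X \in A).
    by apply: sumr_ge0 => i _; exact: prodr_ge0.
rewrite ge0_integral_sum//; last by move=> i X _; rewrite lee_fin prodr_ge0.
apply: lee_sum => i _; rewrite -expectation_run//.
by under [in leRHS]eq_integral do rewrite mulr1.
Qed.

Lemma law_le_run (A : set (traj_space x0)) t (f : S -> R) :
  depends_upto t (A : (nat -> S) -> Prop) -> (forall x, 0 <= f x) ->
  (forall X, A X -> 1 <= f (X t)) -> (mu A <= (run K 0 t f x0)%:E)%E.
Proof.
move=> dA f0 fA.
have mA := depends_upto_measurable dA.
rewrite -(setIT A) -integral_indic// -expectation_run_unweighted//.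
apply: ge0_le_integral => //.
- by apply/measurable_EFinP; exact: measurable_indic.
- apply/measurable_EFinP; apply: (depends_upto_measurable_fun (t := t)) => X Y XY.
  by rewrite XY.
- move=> X _; rewrite lee_fin indicE; have [/set_mem/fA//|_] := boolP (X \in A).
  exact: f0.
Qed.

End ChainExpectation.

(** * Expected first times as series of tail probabilities *)

Section FirstTime.
Context {R : realType}.

(** The times [t] with no occurrence up to [t] are exactly those before the first one, so their
    number is the first time, infinite if there is none. *)
Lemma first_time_series (E : nat -> Prop) :
  (first_time R E =
   \sum_(0 <= t <oo) (`[< forall s, (s <= t)%N -> ~ E s >]%:R : R)%:E)%E.
Proof.
pose b t : \bar R := (`[< forall s, (s <= t)%N -> ~ E s >]%:R : R)%:E.
rewrite -[RHS]/(\sum_(0 <= t <oo) b t)%E.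
have b0 k : (0%N <= k)%N -> (0 <= b k)%E by move=> _; rewrite /b lee_fin.
have [ex|nex] := pselect (exists t, `[< E t >]).
  case: (ex_minnP ex) => t0 /asboolP Et0 t0min.
  rewrite (nneseries_split 0 t0)// [X in (_ + X)%E]eseries0 => [|k]; last first.
    rewrite add0n => t0k _; rewrite /b; case: asboolP => // /(_ _ t0k); exact: contra_notP.
  rewrite adde0 add0n (eq_big_nat _ _ (F2 := fun=> 1%E)) => [|k /andP[_ kt0]]; last first.
    rewrite /b; case: asboolP => // /existsNP[s /not_implyP[sk /contrapT Es]].
    by have := t0min s; rewrite leqNgt (leq_ltn_trans sk kt0) => /(_ (asboolT Es)).
  rewrite -[X in (\sum_(0 <= _ < t0) X)%R]/(1%:E) sumEFin sumr_const_nat subn0.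
  apply/eqP; rewrite eq_le; apply/andP; split.
    by apply: ge_ereal_inf; exists t0%:R%:E => //; exists t0.
  apply/ereal_infP => y [t Et ty]; rewrite -ty lee_fin ler_nat; apply: t0min; exact/asboolP.
rewrite /first_time (_ : [set _ | _ in _] = set0); last first.
  by apply/seteqP; split => // y [t Et ty]; apply: nex; exists t; exact/asboolP.
rewrite ereal_inf0; apply/esym/eqyP => A A0.
have [N AN] : exists N : nat, A <= N%:R.
  by exists (Num.bound A); apply/ltW/archi_boundP/ltW.
apply: (@le_trans _ _ (\sum_(0 <= k < N) b k)%E); last first.
  by apply: (@nneseries_lim_ge _ b xpredT) => n _ _; exact: b0.
rewrite (eq_big_nat _ _ (F2 := fun=> 1%:E)) => [|k _].
  by rewrite sumEFin sumr_const_nat subn0 lee_fin.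
rewrite /b; case: asboolP => // /existsNP[s /not_implyP[_ /contrapT Es]].
by exfalso; apply: nex; exists s; exact/asboolP.
Qed.

Lemma integral_first_time d (T : measurableType d) (mu : {measure set T -> \bar R})
    (E : T -> nat -> Prop) :
  (forall t, measurable [set X | forall s, (s <= t)%N -> ~ E X s]) ->
  (\int[mu]_X first_time R (E X) =
   \sum_(0 <= t <oo) mu [set X | forall s, (s <= t)%N -> ~ E X s])%E.
Proof.
move=> mA; under eq_integral do rewrite first_time_series.
rewrite integral_nneseries//; last first.
  move=> t; apply/measurable_EFinP.
  rewrite (_ : (fun _ => _) = \1_[set X | forall s, (s <= t)%N -> ~ E X s]).
    exact: measurable_indic.
  by apply/funext => X; rewrite indicE.
apply: eq_eseriesr => t _.
rewrite -[in RHS](setIT [set X | _]) -integral_indic//.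
Qed.

Lemma le_integral_first_time d (T : measurableType d) (mu : {measure set T -> \bar R})
    (E : T -> nat -> Prop) (u : nat -> R) (C : R) :
  (forall t, measurable [set X | forall s, (s <= t)%N -> ~ E X s]) ->
  (forall t, mu [set X | forall s, (s <= t)%N -> ~ E X s] <= (u t)%:E)%E ->
  (forall N, \sum_(0 <= t < N) u t <= C) ->
  (\int[mu]_X first_time R (E X) <= C%:E)%E.
Proof.
move=> mA Au uC; rewrite integral_first_time//.
apply: lime_le; first by apply: is_cvg_nneseries => n _ _; exact: measure_ge0.
apply: nearW => N; apply: le_trans (_ : ((\sum_(0 <= t < N) u t)%:E <= _)%E); last by rewrite lee_fin.
by rewrite -sumEFin; apply: lee_sum.
Qed.

Lemma measurable_bigmaxe d (T : measurableType d) (I : finType) (F : I -> T -> \bar R) :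
  (forall i, measurable_fun setT (F i)) ->
  measurable_fun setT (fun X => \big[maxe/-oo%E]_i F i X).
Proof.
move=> mF; elim: (index_enum I) => [|i r IH].
  by under eq_fun do rewrite big_nil; exact: measurable_cst.
by under eq_fun do rewrite big_cons; exact: measurable_maxe.
Qed.

(** Serves for measurability in the graph sequence: the probability of an event of the first [t]
    steps is a function of finitely many graphs. *)
Lemma chain_law_depends (S : finType) (x0 : S) (K K' : nat -> S -> S -> R) t
    (A : set (traj_space x0)) :
  (forall s, stochastic (K s)) -> (forall s, stochastic (K' s)) ->
  (forall s, (s <= t)%N -> K s = K' s) -> depends_upto t (A : (nat -> S) -> Prop) ->
  chain_law K x0 A = chain_law K' x0 A.
Proof.
move=> Kst K'st KK' dA.
have mA := depends_upto_measurable dA.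
have dA1 : depends_upto t (\1_A : (nat -> S) -> R).
  by move=> X Y XY; rewrite !indicE /in_mem/= /in_set (dA _ _ XY).
rewrite -(setIT A) -!integral_indic//.
rewrite !(@integral_depends _ _ _ _ _ t)//.
congr _%:E; apply: eq_bigr => z _; congr (_ * (_ * _)).
by apply: eq_big_nat => s /andP[_]; rewrite ltnS => /KK' ->.
Qed.

Lemma measurable_integral_first_time (S T : finType) (x0 : S) (w0 : T)
    (K : (nat -> T) -> nat -> S -> S -> R) (E : (nat -> S) -> nat -> Prop) :
  (forall w t, stochastic (K w t)) ->
  (forall t, depends_upto t (fun w => K w t)) ->
  (forall t, depends_upto t (fun X => E X t)) ->
  measurable_fun setT (fun w : traj_space w0 =>
    (\int[chain_law (K w) x0]_X first_time R (E X))%E).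
Proof.
move=> Kst dK dE.
pose A t := [set X : traj_space x0 | forall s, (s <= t)%N -> ~ E X s].
have dA t : depends_upto t (A t : (nat -> S) -> Prop).
  move=> X Y XY; rewrite /A /=; apply/propext; split => h s st.
    by rewrite -(dE s X Y)// => [|j js]; [exact: h | apply: XY; exact: leq_trans st].
  by rewrite (dE s X Y)// => [|j js]; [exact: h | apply: XY; exact: leq_trans st].
have mA t : measurable (A t) by exact: depends_upto_measurable (dA t).
under eq_fun do rewrite integral_first_time//.
apply: (ge0_emeasurable_sum (P := xpredT)) => // t _.
apply: (depends_upto_measurable_fun (t := t)) => w w' ww'.
apply: (@chain_law_depends _ _ _ _ t) => // s st; apply: dK => j js.
by apply: ww'; exact: leq_trans st.
Qed.

End FirstTime.

(** * Avoidance of a moving target under variance contraction *)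

Section SumInequalities.
Context {R : realType} {I : finType}.

Lemma jensen_sqr (p g : I -> R) : (forall i, 0 <= p i) -> \sum_i p i = 1 ->
  (\sum_i p i * g i) ^+ 2 <= \sum_i p i * g i ^+ 2.
Proof.
move=> p0 p1; set m := \sum_i p i * g i.
have : 0 <= \sum_i p i * (g i - m) ^+ 2.
  by apply: sumr_ge0 => i _; rewrite mulr_ge0// sqr_ge0.
have -> : \sum_i p i * (g i - m) ^+ 2 = \sum_i p i * g i ^+ 2 - m ^+ 2; last by rewrite subr_ge0.
transitivity (\sum_i p i * g i ^+ 2 - (m + m) * (\sum_i p i * g i) + m ^+ 2 * \sum_i p i).
  by rewrite !mulr_sumr -sumrB -big_split; apply: eq_bigr => i _ /=; ring.
by rewrite p1 -/m; ring.
Qed.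

(** Cauchy-Schwarz, from the double sum of [(f i - f j) ^+ 2] over [A]. *)
Lemma sqr_sum_le (A : pred I) (f : I -> R) :
  (\sum_(i | A i) f i) ^+ 2 <= #|A|%:R * \sum_(i | A i) f i ^+ 2.
Proof.
set s := \sum_(i | A i) f i; set q := \sum_(i | A i) _.
have : 0 <= \sum_(i | A i) \sum_(j | A j) (f i - f j) ^+ 2.
  by apply: sumr_ge0 => i _; apply: sumr_ge0 => j _; exact: sqr_ge0.
have -> : \sum_(i | A i) \sum_(j | A j) (f i - f j) ^+ 2 = 2 * (#|A|%:R * q - s ^+ 2).
  transitivity (\sum_(i | A i) (#|A|%:R * f i ^+ 2 - (s + s) * f i + q)).
    apply: eq_bigr => i _.
    transitivity (\sum_(j | A j) (f i ^+ 2) - (f i + f i) * s + q); last first.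
      by rewrite sumr_const -mulr_natl; ring.
    by rewrite mulr_sumr -sumrB -big_split; apply: eq_bigr => j _ /=; ring.
  rewrite big_split sumrB -!mulr_sumr -/s -/q sumr_const -mulr_natl /=; ring.
by rewrite pmulr_rge0// subr_ge0.
Qed.

End SumInequalities.

Lemma sum_pair (R : realType) (I J : finType) (F : I * J -> R) :
  \sum_u F u = \sum_i \sum_j F (i, j).
Proof. by rewrite pair_bigA; apply: eq_bigr => -[]. Qed.

Section Run.
Context {R : realType} {S : finType}.
Implicit Types K : nat -> S -> S -> R.

Lemma run_ge0 K t0 t f : (forall s x y, 0 <= K s x y) -> (forall x, 0 <= f x) ->
  forall x, 0 <= run K t0 t f x.
Proof.
move=> K0 f0; elim: t t0 => //= t IH t0 x.
by apply: sumr_ge0 => y _; rewrite mulr_ge0.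
Qed.

Lemma run_add K t0 t t' f x :
  run K t0 (t + t') f x = run K t0 t (run K (t0 + t) t' f) x.
Proof.
elim: t t0 x => [|t IH] t0 x /=; first by rewrite addn0.
by apply: eq_bigr => y _; rewrite IH addSnnS.
Qed.

Lemma run_le K K' t0 t f f' : (forall s x y, 0 <= K s x y <= K' s x y) ->
  (forall x, 0 <= f x <= f' x) -> forall x, run K t0 t f x <= run K' t0 t f' x.
Proof.
move=> KK' ff'; elim: t t0 => [|t IH] t0 x /=; first by case/andP: (ff' x).
apply: ler_sum => y _; have /andP[K0 KK] := KK' t0.+1 x y.
by apply: ler_pM => //; apply: run_ge0 => [s a b|a]; [case/andP: (KK' s a b) | case/andP: (ff' a)].
Qed.

Lemma run_le_cst K t0 t f (c : R) : (forall s x y, 0 <= K s x y) ->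
  (forall s x, \sum_y K s x y <= 1) -> 0 <= c ->
  (forall x, f x <= c) -> forall x, run K t0 t f x <= c.
Proof.
move=> K0 K1 c0 fc; elim: t t0 => //= t IH t0 x.
apply: (@le_trans _ _ (\sum_y K t0.+1 x y * c)).
  by apply: ler_sum => y _; rewrite ler_wpM2l.
by rewrite -mulr_suml ler_piMl.
Qed.

Lemma eq_run K t0 t f g : f =1 g -> run K t0 t f =1 run K t0 t g.
Proof.
by move=> fg; elim: t t0 => //= t IH t0 x; apply: eq_bigr => y _; rewrite IH.
Qed.

Lemma run_recr K t0 t f x :
  run K t0 t.+1 f x = run K t0 t (fun y => \sum_z K (t0 + t).+1 y z * f z) x.
Proof. by rewrite -addn1 run_add. Qed.

Lemma run_sum (I : Type) (r : seq I) K t0 t (f : I -> S -> R) x :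
  run K t0 t (fun y => \sum_(i <- r) f i y) x = \sum_(i <- r) run K t0 t (f i) x.
Proof.
elim: t t0 x => //= t IH t0 x; rewrite exchange_big /=.
by apply: eq_bigr => y _; rewrite IH mulr_sumr.
Qed.

Lemma run_plus K t0 t f g x :
  run K t0 t (fun y => f y + g y) x = run K t0 t f x + run K t0 t g x.
Proof.
elim: t t0 x => //= t IH t0 x; rewrite -big_split /=.
by apply: eq_bigr => y _; rewrite IH mulrDr.
Qed.

Lemma run_scale K t0 t (c : R) f x :
  run K t0 t (fun y => c * f y) x = c * run K t0 t f x.
Proof.
elim: t t0 x => //= t IH t0 x; rewrite mulr_sumr.
by apply: eq_bigr => y _; rewrite IH mulrCA.
Qed.

End Run.

(* [P] multiplies the variance by at most [1 - l]; stated without centring [f]. *)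
Definition contracting (R : realType) (V : finType) (l : R) (P : V -> V -> R) : Prop :=
  forall f : V -> R, \sum_x (\sum_y P x y * f y) ^+ 2 <=
    (1 - l) * (\sum_x f x ^+ 2) + l * ((\sum_x f x) ^+ 2 / #|V|%:R).

Definition sym_kernel (R : realType) (V : finType) (P : V -> V -> R) : Prop :=
  forall x y, P x y = P y x.

(* Two walkers, moving by [P] and [Q], killed when they meet: [run] of this kernel on the constant
   [1] is the probability that they do not meet. *)
Definition avoid_kernel (R : realType) (V : finType) (P Q : nat -> V -> V -> R)
    (s : nat) (u v : V * V) : R :=
  P s u.1 v.1 * Q s u.2 v.2 * (v.1 != v.2)%:R.

Definition pair_kernel (R : realType) (V : finType) (P Q : nat -> V -> V -> R)
    (s : nat) (u v : V * V) : R :=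
  P s u.1 v.1 * Q s u.2 v.2.

Section Avoidance.
Context {R : realType} {V : finType}.
Variables (P Q : nat -> V -> V -> R) (l : nat -> R).
Hypothesis V0 : (0 < #|V|)%N.
Hypothesis Pst : forall t, stochastic (P t).
Hypothesis Psym : forall t, sym_kernel (P t).
Hypothesis Qst : forall t, stochastic (Q t).
Hypothesis l01 : forall t, 0 <= l t <= 1.
Hypothesis Pl : forall t, contracting (l t) (P t).

Let n : R := #|V|%:R.
Let n0 : 0 < n. Proof. by rewrite ltr0n. Qed.

Let P0 t x y : 0 <= P t x y. Proof. exact: (Pst t).1. Qed.
Let Q0 t x y : 0 <= Q t x y. Proof. exact: (Qst t).1. Qed.

(** Squared norms lose the factor [1 - l / n], which is at most [(1 - l / (2 * n)) ^+ 2]; the rate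
    is the one for the norm itself. The step out of time [s] uses the kernel of index [s.+1], whence
    the shift. *)
Definition rate (t0 t : nat) : R := \prod_(t0 <= s < t0 + t) (1 - l s.+1 / (2 * n)).

Lemma rate_factor_ge0 s : 0 <= 1 - l s / (2 * n).
Proof.
have /andP[l0 l1] := l01 s; rewrite subr_ge0 ler_pdivrMr ?mulr_gt0// mul1r.
have : 1 <= n by rewrite ler1n.
lra.
Qed.

Lemma rate_ge0 t0 t : 0 <= rate t0 t.
Proof. by apply: prodr_ge0 => s _; exact: rate_factor_ge0. Qed.

Lemma avoid_kernel_ge0 s u v : 0 <= avoid_kernel P Q s u v.
Proof. by rewrite /avoid_kernel !mulr_ge0. Qed.

Lemma avoid_le_pair s u v : 0 <= avoid_kernel P Q s u v <= pair_kernel P Q s u v.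
Proof.
rewrite avoid_kernel_ge0/= /avoid_kernel /pair_kernel ler_piMr ?mulr_ge0//.
by case: (_ != _).
Qed.

Lemma pair_kernel_stochastic s : stochastic (pair_kernel P Q s).
Proof.
split => [u v|u]; first by rewrite /pair_kernel mulr_ge0.
rewrite sum_pair /pair_kernel/=.
under eq_bigr do rewrite -mulr_sumr (Qst s).2 mulr1.
exact: (Pst s).2.
Qed.

(** The target's move is summed outside: once its new position [b] is fixed, the walker's kernel
    acts on a function that vanishes at [b]. *)
Lemma run_avoidS t0 t f x y : run (avoid_kernel P Q) t0 t.+1 f (x, y) =
  \sum_b Q t0.+1 y b * \sum_a P t0.+1 x a * ((a != b)%:R * run (avoid_kernel P Q) t0.+1 t f (a, b)).
Proof.
rewrite /= sum_pair exchange_big/=; apply: eq_bigr => b _; rewrite mulr_sumr; apply: eq_bigr => a _.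
by rewrite /avoid_kernel/=; ring.
Qed.

(** By Jensen, averaging over the target's move does no worse than the worst new position, so the
    target may follow any stochastic kernel. *)
Lemma average_sqnorm_le s (F : V -> V -> R) y (M : R) :
  (forall b, \sum_x (\sum_a P s x a * F a b) ^+ 2 <= M) ->
  \sum_x (\sum_b Q s y b * \sum_a P s x a * F a b) ^+ 2 <= M.
Proof.
move=> FM.
apply: (@le_trans _ _ (\sum_x \sum_b Q s y b * (\sum_a P s x a * F a b) ^+ 2)).
  by apply: ler_sum => x _; apply: jensen_sqr => //; exact: (Qst s).2.
rewrite exchange_big/=.
apply: (@le_trans _ _ (\sum_b Q s y b * M)).
  by apply: ler_sum => b _; rewrite -mulr_sumr ler_wpM2l.
by rewrite -mulr_suml (Qst s).2 mul1r.
Qed.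

Lemma avoid_sqnorm t0 t y :
  \sum_x run (avoid_kernel P Q) t0 t (fun=> 1) (x, y) ^+ 2 <= n * rate t0 t ^+ 2.
Proof.
elim: t t0 y => [|t IH] t0 y.
  rewrite /rate addn0 big_geq//= expr1n mulr1.
  by rewrite sumr_const.
under eq_bigr do rewrite run_avoidS.
apply: average_sqnorm_le => b.
pose h a := (a != b)%:R * run (avoid_kernel P Q) t0.+1 t (fun=> 1) (a, b).
rewrite -[leLHS]/(\sum_x (\sum_a P t0.+1 x a * h a) ^+ 2).
pose H := \sum_x run (avoid_kernel P Q) t0.+1 t (fun=> 1) (x, b) ^+ 2.
have h2H : \sum_a h a ^+ 2 <= H.
  apply: ler_sum => a _; rewrite /h exprMn; case: eqP => _ /=.
    by rewrite expr0n mul0r sqr_ge0.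
  by rewrite expr1n mul1r.
(* Since [h] vanishes at [b], Cauchy-Schwarz runs over [n - 1] points; the contraction then yields
   the factor [1 - L / n]. *)
have sq : (\sum_a h a) ^+ 2 <= (n - 1) * \sum_a h a ^+ 2.
  have hb : h b = 0 by rewrite /h eqxx mul0r.
  rewrite (bigD1 b)//= [in leRHS](bigD1 b)//= hb expr0n/= !add0r.
  apply: le_trans (sqr_sum_le _ _) _.
  rewrite ler_wpM2r ?sumr_ge0// => [a _|]; first exact: sqr_ge0.
  have -> : n - 1 = #|V|.-1%:R by rewrite -subn1 natrB.
  by rewrite ler_nat -(cardC1 b).
apply: le_trans (Pl _ _) _.
have /andP[l0 l1] := l01 t0.+1; set L := l t0.+1 in l0 l1 *.
have h20 : 0 <= \sum_a h a ^+ 2 by apply: sumr_ge0 => a _; exact: sqr_ge0.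
apply: (@le_trans _ _ ((1 - L / n) * \sum_a h a ^+ 2)).
  have : L * ((\sum_a h a) ^+ 2 / n) <= L * ((n - 1) * (\sum_a h a ^+ 2) / n).
    by rewrite ler_wpM2l// ler_wpM2r// invr_ge0 ltW.
  have -> : L * ((n - 1) * (\sum_a h a ^+ 2) / n) = (L - L / n) * \sum_a h a ^+ 2.
    by field; rewrite gt_eqF.
  lra.
have -> : rate t0 t.+1 = (1 - L / (2 * n)) * rate t0.+1 t.
  by rewrite /rate big_ltn ?addSnnS// -addSnnS leq_addr.
rewrite exprMn mulrCA.
have f0 := rate_factor_ge0 t0.+1; rewrite -/L in f0.
have fle : 1 - L / n <= (1 - L / (2 * n)) ^+ 2.
  have -> : L / n = 2 * (L / (2 * n)) by field; rewrite gt_eqF.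
  have := sqr_ge0 (L / (2 * n)); lra.
apply: (@le_trans _ _ ((1 - L / (2 * n)) ^+ 2 * \sum_a h a ^+ 2)).
  by rewrite ler_wpM2r.
by rewrite ler_wpM2l ?sqr_ge0// (le_trans h2H)//; exact: IH.
Qed.

(** A single value is at most the norm, hence [sqrt n] times the rate; the weaker factor [n] avoids
    square roots. *)
Lemma avoid_le_rate t0 t u : run (avoid_kernel P Q) t0 t (fun=> 1) u <= n * rate t0 t.
Proof.
case: u => x y; have := avoid_sqnorm t0 t y; rewrite (bigD1 x)//= => h.
have n1 : 1 <= n by rewrite ler1n.
rewrite -(@ler_pXn2r _ 2)// ?nnegrE ?mulr_ge0 ?(ltW n0)// ?rate_ge0//; last first.
  by apply: run_ge0 => // *; exact: avoid_kernel_ge0.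
apply: le_trans (_ : n * rate t0 t ^+ 2 <= _).
  apply: le_trans h; rewrite lerDl; apply: sumr_ge0 => a _; exact: sqr_ge0.
by rewrite exprMn expr2 ler_wpM2r ?sqr_ge0// ler_peMl// ltW.
Qed.

Lemma run_pairS t0 t f x y : run (pair_kernel P Q) t0 t.+1 f (x, y) =
  \sum_b Q t0.+1 y b * \sum_a P t0.+1 x a * run (pair_kernel P Q) t0.+1 t f (a, b).
Proof.
rewrite /= sum_pair exchange_big/=; apply: eq_bigr => b _; rewrite mulr_sumr; apply: eq_bigr => a _.
by rewrite /pair_kernel/=; ring.
Qed.

Lemma sum_step s g : \sum_x \sum_a P s x a * g a = \sum_a g a.
Proof.
rewrite exchange_big/=; apply: eq_bigr => a _; rewrite -mulr_suml.
by under eq_bigr do rewrite Psym; rewrite (Pst s).2 mul1r.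
Qed.

Let mean (g : V -> R) : R := (\sum_x g x) / n.

Lemma run_pair_mean t0 t f y :
  mean (fun x => run (pair_kernel P Q) t0 t.+1 f (x, y)) =
  \sum_b Q t0.+1 y b * mean (fun a => run (pair_kernel P Q) t0.+1 t f (a, b)).
Proof.
rewrite /mean; under eq_bigr do rewrite run_pairS.
rewrite exchange_big/= mulr_suml; apply: eq_bigr => b _.
by rewrite -mulr_sumr sum_step mulrA.
Qed.

(** Split into mean and fluctuation in the walker's coordinate. By symmetry of [P] the mean is
    merely averaged by [Q], while the fluctuation is centred, so that the contraction acts on it in
    full. *)
Lemma run_pair_mixing t0 t f (M lam : R) : 0 <= M -> 0 <= lam <= 1 ->
  (forall s, (t0 < s <= t0 + t)%N -> l s = lam) ->
  (forall b, \sum_a f (a, b) ^+ 2 <= n * M ^+ 2) ->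
  forall y, mean (fun x => run (pair_kernel P Q) t0 t f (x, y)) <= M /\
    \sum_x (run (pair_kernel P Q) t0 t f (x, y) - mean (fun x => run (pair_kernel P Q) t0 t f (x, y))) ^+ 2
      <= (1 - lam) ^+ t * (n * M ^+ 2).
Proof.
move=> M0 /andP[lam0 lam1] llam fM; elim: t t0 llam => [|t IH] t0 llam y.
  have sq := sqr_sum_le predT (fun a => f (a, y)).
  split=> /=.
    rewrite ler_pdivrMr//.
    have [s0|s0] := leP (\sum_x f (x, y)) 0.
      by apply: le_trans s0 _; rewrite mulr_ge0// ltW.
    rewrite -(@ler_pXn2r _ 2)// ?nnegrE ?mulr_ge0// ?(ltW n0)// ?(ltW s0)//.
    apply: le_trans sq _; rewrite (_ : #|_| = #|V|)// -/n mulrC.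
    have -> : (M * n) ^+ 2 = (n * M ^+ 2) * n by ring.
    by rewrite ler_wpM2r// ltW.
  rewrite expr0 mul1r; apply: le_trans (fM y).
  rewrite -subr_ge0 -sumrB.
  set m := mean _.
  rewrite (eq_bigr (fun a => (m + m) * f (a, y) - m ^+ 2)) => [|a _]; last by ring.
  rewrite sumrB -mulr_sumr sumr_const -mulr_natl -/n.
  have -> : \sum_i f (i, y) = m * n by rewrite /m /mean divfK// gt_eqF.
  have -> : (m + m) * (m * n) - n * m ^+ 2 = n * m ^+ 2 by ring.
  by rewrite mulr_ge0 ?sqr_ge0// ltW.
have {}IH := IH t0.+1 _.
have llam' s : (t0.+1 < s <= t0.+1 + t)%N -> l s = lam.
  by move=> /andP[h1 h2]; apply: llam; rewrite (ltnW h1) -addSnnS.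
have {}IH := IH llam'.
split.
  rewrite run_pair_mean; apply: (@le_trans _ _ (\sum_b Q t0.+1 y b * M)).
    by apply: ler_sum => b _; rewrite ler_wpM2l//; exact: (IH b).1.
  by rewrite -mulr_suml (Qst _).2 mul1r.
pose m b := mean (fun a => run (pair_kernel P Q) t0.+1 t f (a, b)).
have E x : run (pair_kernel P Q) t0 t.+1 f (x, y) - mean (fun x => run (pair_kernel P Q) t0 t.+1 f (x, y)) =
    \sum_b Q t0.+1 y b * \sum_a P t0.+1 x a * (run (pair_kernel P Q) t0.+1 t f (a, b) - m b).
  rewrite run_pair_mean run_pairS -sumrB; apply: eq_bigr => b _.
  rewrite -mulrBr; congr (_ * _); under [in RHS]eq_bigr do rewrite mulrBr.
  by rewrite sumrB -mulr_suml (Pst _).2 mul1r.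
under eq_bigr do rewrite E.
apply: (@average_sqnorm_le t0.+1 (fun a b => run (pair_kernel P Q) t0.+1 t f (a, b) - m b)) => b.
apply: le_trans (Pl _ _) _.
rewrite [X in _ + _ * (X ^+ 2 / _)](_ : _ = 0); last first.
  by rewrite sumrB sumr_const -mulr_natl /m /mean mulrC divfK ?subrr// gt_eqF.
rewrite expr0n/= mul0r mulr0 addr0 exprS -mulrA.
have -> : l t0.+1 = lam by apply: llam; rewrite leqnn/= addnS ltnS leq_addr.
by rewrite ler_wpM2l ?subr_ge0//; exact: (IH b).2.
Qed.

(** Replaces the factor [n] of [avoid_le_rate] by [1 + n^-1]. The exponent 3 is what turns a norm
    bound into a pointwise deviation of at most [n^-1] times the mean bound: one [n] for the squared
    norm and two for the square of [n^-1]. *)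
Lemma avoid_after_mixing t0 L t (lam : R) u : 0 <= lam <= 1 ->
  (forall s, (t0 < s <= t0 + L)%N -> l s = lam) ->
  (1 - lam) ^+ L * n ^+ 3 <= 1 ->
  run (avoid_kernel P Q) t0 (L + t) (fun=> 1) u <= (1 + n^-1) * rate (t0 + L) t.
Proof.
case: u => x y lam01 llam lamL; rewrite run_add.
set f := run _ (t0 + L) t _; set M := rate _ _.
have M0 : 0 <= M by exact: rate_ge0.
have f0 u : 0 <= f u by apply: run_ge0 => // *; exact: avoid_kernel_ge0.
(* Meetings during the mixing phase are ignored, which only increases the probability. *)
apply: (@le_trans _ _ (run (pair_kernel P Q) t0 L f (x, y))).
  by apply: run_le => [*|v]; [exact: avoid_le_pair | rewrite f0 lexx].
have [h1 h2] := run_pair_mixing M0 lam01 llam (fun b => avoid_sqnorm (t0 + L) t b) y.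
rewrite -/f in h1 h2; set m := mean _ in h1 h2; set g := run _ _ _ _ _.
rewrite mulrDl mul1r; rewrite -lerBlDl.
apply: (@le_trans _ _ (g - m)); first by rewrite lerD2l lerN2.
have nM0 : 0 <= n^-1 * M by rewrite mulr_ge0// invr_ge0 ltW.
have [gm|gm] := leP (g - m) 0; first exact: le_trans gm _.
rewrite -(@ler_pXn2r _ 2)// ?nnegrE// ?(ltW gm)//.
move: h2; rewrite (bigD1 x)//= -/g -/m => h2.
apply: (@le_trans _ _ ((1 - lam) ^+ L * (n * M ^+ 2))).
  by apply: le_trans h2; rewrite lerDl sumr_ge0// => a _; exact: sqr_ge0.
have -> : (1 - lam) ^+ L * (n * M ^+ 2) = ((1 - lam) ^+ L * n ^+ 3) * (n^-1 * M) ^+ 2.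
  by field; rewrite gt_eqF.
by rewrite ler_piMl// sqr_ge0.
Qed.

End Avoidance.
Arguments rate {R} V l t0 t.

Section SymmetricStochastic.
Context {R : realType} {V : finType}.

(** Jensen and the invariance of the uniform measure. This is the bound used when nothing is known
    about the graph. *)
Lemma contracting0 (P : V -> V -> R) :
  stochastic P -> sym_kernel P -> contracting 0 P.
Proof.
move=> [P0 P1] Psym f; rewrite subr0 mul1r mul0r addr0.
apply: (@le_trans _ _ (\sum_x \sum_y P x y * f y ^+ 2)).
  by apply: ler_sum => x _; exact: jensen_sqr.
rewrite exchange_big/=; apply: ler_sum => y _; rewrite -mulr_suml.
by under eq_bigr do rewrite Psym; rewrite P1 mul1r.
Qed.

(* A motionless second walker turns meeting into hitting a vertex. *)
Definition stay (s : nat) (x y : V) : R := (x == y)%:R.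

Lemma stay_stochastic s : stochastic (stay s).
Proof.
split => [x y|x]; first exact: ler0n.
rewrite /stay (bigD1 x)//= eqxx big1 ?addr0// => y yx.
by rewrite eq_sym (negbTE yx).
Qed.

(** Killing at [w] multiplies the kernel of independent walkers by a product over walkers, so the
    whole evolution factorises. *)
Lemma run_unvisited (k : nat) (P : nat -> V -> V -> R) w t0 t (x : {ffun 'I_k -> V}) :
  run (fun s x y => @indep_step R V k (P s) x y * \prod_i (y i != w)%:R) t0 t (fun=> 1) x =
  \prod_i run (avoid_kernel P stay) t0 t (fun=> 1) (x i, w).
Proof.
elim: t t0 x => [|t IH] t0 x; first by rewrite /= big1.
under [RHS]eq_bigr => i _.
  rewrite run_avoidS (bigD1 w)//= {1}/stay eqxx mul1r [X in _ + X]big1 ?addr0 => [|b bw]; last first.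
    by rewrite /stay eq_sym (negbTE bw) mul0r.
  over.
rewrite bigA_distr_bigA/=; apply: eq_bigr => y _.
by rewrite IH /indep_step -!big_split/=; apply: eq_bigr => i _; rewrite -mulrA.
Qed.

End SymmetricStochastic.

(** * Coalescing walks as a flow of random maps *)

Section Flow.
Context {R : realType} {V : finType}.
Implicit Types (P : V -> V -> R).

(** The probability of [xi] when the image of each vertex [u] is drawn independently from [P u]. *)
Definition flow_weight P (xi : {ffun V -> V}) : R := \prod_u P u (xi u).

Definition push (m : nat) (xi : {ffun V -> V}) (x : {ffun 'I_m -> V}) : {ffun 'I_m -> V} :=
  [ffun i => xi (x i)].

Lemma flow_weight_ge0 P xi : stochastic P -> 0 <= flow_weight P xi.
Proof. by move=> [P0 _]; exact: prodr_ge0. Qed.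

Lemma flow_weight_prod P (phi : V -> V -> R) :
  \sum_xi flow_weight P xi * \prod_u phi u (xi u) = \prod_u \sum_a P u a * phi u a.
Proof. by rewrite bigA_distr_bigA/=; apply: eq_bigr => xi _; rewrite -big_split. Qed.

Lemma flow_weight_marginal P u (phi : V -> R) : stochastic P ->
  \sum_xi flow_weight P xi * phi (xi u) = \sum_a P u a * phi a.
Proof.
move=> [P0 P1].
have := flow_weight_prod P (fun v a => if v == u then phi a else 1).
rewrite (bigD1 u)//= eqxx [X in _ = _ * X]big1 ?mulr1 => [<-|v vu]; last first.
  by rewrite (negbTE vu); under eq_bigr do rewrite mulr1.
apply: eq_bigr => xi _; rewrite (bigD1 u)//= eqxx big1 ?mulr1// => v vu.
by rewrite (negbTE vu).
Qed.

Lemma flow_weight_marginal2 P u v (psi : V -> V -> R) : stochastic P -> u != v ->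
  \sum_xi flow_weight P xi * psi (xi u) (xi v) = \sum_a \sum_b P u a * P v b * psi a b.
Proof.
move=> [P0 P1] uv.
transitivity (\sum_a \sum_b psi a b *
    \sum_xi flow_weight P xi * ((xi u == a)%:R * (xi v == b)%:R)).
  under [RHS]eq_bigr => a _ do under eq_bigr => b _ do rewrite mulr_sumr.
  rewrite [RHS](_ : _ = \sum_xi \sum_a \sum_b psi a b * (flow_weight P xi * ((xi u == a)%:R * (xi v == b)%:R))).
    apply: eq_bigr => xi _; rewrite (bigD1 (xi u))//= [X in _ + X]big1 ?addr0 => [|a ax]; last first.
      by rewrite big1// => b _; rewrite eq_sym (negbTE ax) mul0r !mulr0.
    rewrite (bigD1 (xi v))//= [X in _ + X]big1 ?addr0 => [|a ax]; last first.
      by rewrite [xi v == _]eq_sym (negbTE ax) !mulr0.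
    by rewrite !eqxx !mulr1 mulrC.
  by rewrite [RHS]exchange_big/=; apply: eq_bigr => a _; rewrite exchange_big.
apply: eq_bigr => a _; apply: eq_bigr => b _; rewrite mulrC; congr (_ * _).
have := flow_weight_prod P (fun z c => if z == u then (c == a)%:R else if z == v then (c == b)%:R else 1).
have delta z c : \sum_d P z d * (d == c)%:R = P z c.
  rewrite (bigD1 c)//= eqxx mulr1 big1 ?addr0// => d dc.
  by rewrite (negbTE dc) mulr0.
rewrite (bigD1 u)//= eqxx delta (bigD1 v)/=; last by rewrite eq_sym.
rewrite [v == u]eq_sym (negbTE uv) eqxx delta [X in _ = _ * (_ * X)]big1 ?mulr1 => [<-|z /andP[zu zv]]; last first.
  by rewrite (negbTE zu) (negbTE zv); under eq_bigr do rewrite mulr1.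
apply: eq_bigr => xi _; congr (_ * _); rewrite (bigD1 u)//= eqxx; congr (_ * _).
rewrite (bigD1 v)/=; last by rewrite eq_sym.
rewrite [v == u]eq_sym (negbTE uv) eqxx big1 ?mulr1// => z /andP[zu zv].
by rewrite (negbTE zu) (negbTE zv).
Qed.

Lemma flow_weight_sum1 P : stochastic P -> \sum_xi flow_weight P xi = 1.
Proof.
move=> Pst; have := flow_weight_prod P (fun _ _ => 1).
rewrite (eq_bigr (flow_weight P)) => [->|xi _]; last by rewrite big1 ?mulr1.
by rewrite big1// => u _; under eq_bigr do rewrite mulr1; exact: Pst.2.
Qed.

(** A common random map moves walkers of one vertex together and those of different vertices
    independently, which is the coalescing rule. This gives access to the dual description by
    preimages. *)
Lemma coal_step_flow (m : nat) P (x y : {ffun 'I_m -> V}) : stochastic P ->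
  coal_step P x y = \sum_(xi | push xi x == y) flow_weight P xi.
Proof.
move=> [P0 P1].
pose A u : pred V := fun a => [forall i, (x i == u) ==> (y i == a)].
have -> : \sum_(xi | push xi x == y) flow_weight P xi = \prod_u \sum_(a | A u a) P u a.
  rewrite bigA_distr_big_dep; apply: eq_bigl => xi; apply/eqP/familyP => [xy u|h].
    rewrite unfold_in; apply/forallP => i; apply/implyP => /eqP <-.
    by rewrite -xy /push ffunE.
  apply/ffunP => i; rewrite /push ffunE; have := h (x i); rewrite unfold_in.
  by move=> /forallP/(_ i); rewrite eqxx => /eqP.
rewrite /coal_step; case: ifPn => [/forallP cons|]; last first.
  move=> /forallPn[i /forallPn[j]]; rewrite negb_imply => /andP[/eqP xij yij].
  rewrite (bigD1 (x i))//= big1 ?mul0r// => a /forallP Aa; exfalso.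
  have /eqP yi := implyP (Aa i) (eqxx _).
  have := implyP (Aa j); rewrite xij eqxx => /(_ isT)/eqP yj.
  by rewrite yi yj eqxx in yij.
pose ld (i : 'I_m) := [forall j, (x j == x i) ==> (i <= j)%N].
pose B := [set i | ld i]%SET.
have ldinj : {in B &, injective x}.
  move=> i j; rewrite !inE => /forallP li /forallP lj xij; apply/val_inj/eqP.
  by rewrite eqn_leq; have := li j; have := lj i; rewrite xij eqxx /= => -> ->.
(* A vertex without walkers is unconstrained and contributes 1; an occupied one is represented by
   its walker of least index. *)
rewrite (bigID (mem (x @: B)%SET))/= [X in _ * X]big1 ?mulr1; last first.
  move=> u uB; rewrite -[RHS](P1 u); apply: eq_bigl => a; apply/forallP => i.
  apply/implyP => /eqP xiu; case/imsetP: uB.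
  case: (arg_minnP (fun j : 'I_m => j : nat) (P := fun j => x j == u) (i0 := i)); first exact/eqP.
  move=> j /eqP xj jmin; exists j => //; rewrite inE; apply/forallP => l; apply/implyP.
  by rewrite xj => /jmin.
rewrite big_imset//=; apply: eq_big => [i|i _]; first by rewrite inE.
rewrite (eq_bigl (pred1 (y i))) ?big_pred1_eq// => a /=; apply/forallP/eqP => [h|->].
  by apply/esym/eqP; exact: (implyP (h i)).
by move=> j; have /forallP/(_ i) := cons j; rewrite [_ == y i]eq_sym [y i == _]eq_sym.
Qed.

Lemma coal_step_apply (m : nat) P (f : {ffun 'I_m -> V} -> R) x : stochastic P ->
  \sum_y coal_step P x y * f y = \sum_xi flow_weight P xi * f (push xi x).
Proof.
move=> Pst; under eq_bigr do rewrite coal_step_flow// mulr_suml big_mkcond.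
rewrite exchange_big/=; apply: eq_bigr => xi _.
rewrite (bigD1 (push xi x))//= eqxx big1 ?addr0// => y yx.
by rewrite eq_sym (negbTE yx).
Qed.

End Flow.

(** * Laplace transform of a Bernoulli variable, with a gain from its variance *)

Section LogarithmBounds.
Context {R : realType}.

(** With [s = sqrt x] and [ln s <= s - 1], the margin left is [(s - 1)^2 (1 - (s + 1)^2 / 6)],
    nonnegative because [s^2 <= 2] and [s <= 3/2]. *)
Lemma ln_le_quadratic (x : R) : 0 < x <= 2 -> ln x <= x - 1 - (x - 1) ^+ 2 / 6.
Proof.
move=> /andP[x0 x2]; set s := Num.sqrt x.
have s0 : 0 < s by rewrite sqrtr_gt0.
have xs : x = s ^+ 2 by rewrite sqr_sqrtr// ltW.
have -> : ln x = ln s *+ 2 by rewrite xs lnXn.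
have : ln s <= s - 1.
  have := @le_ln1Dx R (s - 1); rewrite (_ : 1 + (s - 1) = s); last by ring.
  by apply; lra.
rewrite xs in x2 *.
have s32 : s <= 3 / 2 by nra.
have : 0 <= (s - 1) ^+ 2 * (1 - (s + 1) ^+ 2 / 6) by rewrite mulr_ge0 ?sqr_ge0//; nra.
move=> h1 h2; rewrite mulr2n; nra.
Qed.

(** A quantified Jensen inequality for the logarithm. With [y = 1 - theta p], the quadratic bound is
    applied at [(1 - theta) / y] and [1 / y] with weights [p] and [1 - p]: the linear terms cancel
    and the quadratic ones add up to the variance. *)
Lemma bernoulli_laplace (theta p : R) : 0 < theta <= 2^-1 -> 0 <= p <= 1 ->
  expR (p * ln (1 - theta) + theta ^+ 2 / 6 * (p * (1 - p))) <= 1 - theta * p.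
Proof.
move=> /andP[t0 t1] /andP[p0 p1]; set y := 1 - theta * p.
have tp : theta * p <= 2^-1 by rewrite -[leRHS]mulr1 ler_pM// ltW.
have tp0 : 0 <= theta * p by rewrite mulr_ge0// ltW.
have y0 : 0 < y by rewrite /y; lra.
rewrite -[leRHS](lnK (x := y)) ?posrE// ler_expR.
have yt : 1 - theta <= y by rewrite /y lerD2l lerN2 ler_piMr// ltW.
have h1 : ln ((1 - theta) / y) <= (1 - theta) / y - 1 - ((1 - theta) / y - 1) ^+ 2 / 6.
  apply: ln_le_quadratic; rewrite divr_gt0 ?ler_pdivrMr//=; lra.
have h2 : ln (1 / y) <= 1 / y - 1 - (1 / y - 1) ^+ 2 / 6.
  by apply: ln_le_quadratic; rewrite divr_gt0// ler_pdivrMr//= /y; lra.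
rewrite !ln_div ?posrE// ?ln1 in h1 h2; last lra.
have := ler_wpM2l p0 h1; have := ler_wpM2l (_ : 0 <= 1 - p) h2; rewrite subr_ge0 => /(_ p1).
have e1 : (1 - theta) / y - 1 = - (theta * (1 - p)) / y by rewrite /y; field; rewrite gt_eqF.
have e2 : 1 / y - 1 = theta * p / y by rewrite /y; field; rewrite gt_eqF.
rewrite e1 e2 => g2 g1.
have : theta ^+ 2 / 6 * (p * (1 - p)) <= theta ^+ 2 / 6 * (p * (1 - p)) / y ^+ 2.
  have y21 : y ^+ 2 <= 1 by rewrite expr_le1 ?(ltW y0)//; rewrite /y; lra.
  rewrite ler_pdivlMr ?exprn_gt0// ler_piMr//.
  by apply: mulr_ge0; [rewrite divr_ge0 ?sqr_ge0 | rewrite mulr_ge0 ?subr_ge0].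
have : p * (- (theta * (1 - p)) / y - (- (theta * (1 - p)) / y) ^+ 2 / 6) +
  (1 - p) * (theta * p / y - (theta * p / y) ^+ 2 / 6) = - (theta ^+ 2 / 6 * (p * (1 - p)) / y ^+ 2).
  by field; rewrite gt_eqF.
lra.
Qed.

End LogarithmBounds.

(** * Survival of preimages and number of remaining walkers *)

Section Coalescence.
Context {R : realType} {V : finType}.
Hypothesis V0 : (0 < #|V|)%N.
Let n : R := #|V|%:R.
Let n0 : 0 < n. Proof. by rewrite ltr0n. Qed.

Definition preim_flow (xi : {ffun V -> V}) (B : {set V}) : {set V} :=
  [set u | xi u \in B]%SET.

Let hitp (P : V -> V -> R) (B : {set V}) u : R := \sum_(a in B) P u a.

(* The preimage of [B] under the random map collects each [u] independently, with
   probability [P(u, B)]. *)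
Lemma flow_laplace (P : V -> V -> R) (B : {set V}) (theta : R) : stochastic P ->
  \sum_xi flow_weight P xi * (1 - theta) ^+ #|preim_flow xi B| =
  \prod_u (1 - theta * \sum_(a in B) P u a).
Proof.
move=> [P0 P1].
have := flow_weight_prod P (fun _ a => if a \in B then 1 - theta else 1).
rewrite [X in _ = X -> _](eq_bigr (fun u => 1 - theta * \sum_(a in B) P u a)) => [<-|u _].
  apply: eq_bigr => xi _; congr (_ * _); rewrite -prodr_const big_mkcond.
  by apply: eq_bigr => u _; rewrite inE.
rewrite [RHS](_ : _ = \sum_a P u a - \sum_a (if a \in B then theta * P u a else 0)).
  by rewrite -sumrB; apply: eq_bigr => a _; case: (a \in B); ring.
by rewrite P1 mulr_sumr -big_mkcond.
Qed.

(** The columns of a symmetric stochastic kernel sum to 1, so the size of the preimage is a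
    martingale. *)
Lemma flow_mean_card (P : V -> V -> R) (B : {set V}) : stochastic P -> sym_kernel P ->
  \sum_xi flow_weight P xi * #|preim_flow xi B|%:R = #|B|%:R.
Proof.
move=> Pst Psym.
transitivity (\sum_u \sum_xi flow_weight P xi * (xi u \in B)%:R).
  rewrite exchange_big/=; apply: eq_bigr => xi _; rewrite -mulr_sumr; congr (_ * _).
  by rewrite -sum1_card natr_sum [LHS]big_mkcond/=; apply: eq_bigr => u _; rewrite inE; case: (_ \in _).
under eq_bigr do rewrite (flow_weight_marginal _ (fun a => (a \in B)%:R) Pst).
rewrite exchange_big/= -sum1_card natr_sum [RHS]big_mkcond/=; apply: eq_bigr => a _.
rewrite -mulr_suml; under eq_bigr do rewrite Psym.
by rewrite Pst.2 mul1r; case: (_ \in _).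
Qed.

(** The probabilities [p u] of entering [B] sum to [|B|]. Contraction of the indicator of [B], with
    [|B| <= n / 2], bounds the sum of their squares by [(1 - lam / 2) |B|], so the total variance is
    at least [lam / 2 * |B|]; [bernoulli_laplace] then applies vertex by vertex. *)
Lemma cluster_laplace (P : V -> V -> R) (B : {set V}) (theta lam : R) :
  stochastic P -> sym_kernel P -> contracting lam P -> 0 <= lam ->
  0 < theta <= 2^-1 -> 2 * #|B|%:R <= n ->
  ((1 - theta) * (1 + lam / 12 * theta ^+ 2)) ^+ #|B| <=
  \prod_u (1 - theta * \sum_(a in B) P u a).
Proof.
move=> [P0 P1] Psym Plam lam0 th Bn; have /andP[th0 th1] := th.
pose p := hitp P B.
have p0 u : 0 <= p u by exact: sumr_ge0.
have p1 u : p u <= 1.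
  by rewrite -[leRHS](P1 u) /p /hitp big_mkcond; apply: ler_sum => a _; case: ifP.
set z : R := #|B|%:R.
have sp : \sum_u p u = z.
  rewrite /p /hitp exchange_big/= /z -sum1_card natr_sum; apply: eq_bigr => a _.
  by under eq_bigr do rewrite Psym.
have sp2 : \sum_u p u ^+ 2 <= z - lam / 2 * z.
  have := Plam (fun a => (a \in B)%:R).
  have -> : \sum_x (\sum_y P x y * (y \in B)%:R) ^+ 2 = \sum_u p u ^+ 2.
    apply: eq_bigr => u _; congr (_ ^+ 2); rewrite /p /hitp [RHS]big_mkcond.
    by apply: eq_bigr => a _; case: (_ \in _); rewrite ?mulr1 ?mulr0.
  have -> : \sum_(x : V) ((x \in B)%:R : R) ^+ 2 = z.
    rewrite /z -sum1_card natr_sum [RHS]big_mkcond/=.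
    by apply: eq_bigr => u _; case: (_ \in _); rewrite ?expr1n ?expr0n.
  have -> : \sum_(x : V) ((x \in B)%:R : R) = z.
    by rewrite /z -sum1_card natr_sum [RHS]big_mkcond/=; apply: eq_bigr => u _; case: (_ \in _).
  move=> h; apply: le_trans h _.
  have z0 : 0 <= z by rewrite ler0n.
  have : z ^+ 2 / #|V|%:R <= z / 2.
    by rewrite -/n ler_pdivrMr// expr2 -mulrA ler_wpM2l// mulrC ler_pdivlMr// mulrC.
  move=> /(ler_wpM2l lam0); lra.
apply: (@le_trans _ _ (expR (\sum_u (p u * ln (1 - theta) + theta ^+ 2 / 6 * (p u * (1 - p u)))))).
  rewrite big_split/= -mulr_suml sp -mulr_sumr.
  have -> : \sum_i p i * (1 - p i) = z - \sum_i p i ^+ 2.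
    by rewrite -sp -sumrB; apply: eq_bigr => u _; ring.
  apply: (@le_trans _ _ (expR (z * ln (1 - theta) + z * (lam / 12 * theta ^+ 2)))).
    rewrite expRD exprMn; apply: ler_pM.
    - by rewrite exprn_ge0//; lra.
    - by rewrite exprn_ge0// addr_ge0// mulr_ge0 ?sqr_ge0//; lra.
    - by rewrite [z * _]mulrC /z expRM_natr lnK// posrE; lra.
    - rewrite [z * _]mulrC /z expRM_natr lerXn2r ?nnegrE ?expR_ge0 ?expR_ge1Dx//.
      by rewrite addr_ge0// mulr_ge0 ?sqr_ge0//; lra.
  rewrite ler_expR lerD2l.
  have t2 : 0 <= theta ^+ 2 / 6 by rewrite divr_ge0 ?sqr_ge0.
  have : theta ^+ 2 / 6 * (lam / 2 * z) <= theta ^+ 2 / 6 * (z - \sum_i p i ^+ 2).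
    by rewrite ler_wpM2l//; lra.
  lra.
rewrite expR_sum; apply: ler_prod => u _; rewrite expR_ge0/=.
by apply: bernoulli_laplace => //; rewrite p0 p1.
Qed.

Variables (P : nat -> V -> V -> R) (lam : R).
Hypothesis Pst : forall t, stochastic (P t).
Hypothesis Psym : forall t, sym_kernel (P t).
Hypothesis lam0 : 0 < lam.

(* Solves [1 - theta_{t+1} <= (1 - theta_t) (1 + lam/12 theta_t^2)], so that [theta_t] is of
   order [1 / t], as for the survival probability of a critical branching process. *)
Definition cluster_theta (t : nat) : R := 2 / (4 + lam / 12 * t%:R).

Let th_bounds t : 0 < cluster_theta t <= 2^-1.
Proof.
have h : 0 <= lam / 12 * t%:R by rewrite mulr_ge0 ?ler0n ?divr_ge0 ?(ltW lam0).
rewrite /cluster_theta; move: (_ * _) h => x x0.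
by rewrite divr_gt0 ?ler_pdivrMr//=; lra.
Qed.

Lemma cluster_theta_step t :
  1 - cluster_theta t.+1 <=
  (1 - cluster_theta t) * (1 + lam / 12 * cluster_theta t ^+ 2).
Proof.
rewrite /cluster_theta -[t.+1%:R]natr1; set c := lam / 12; set T : R := t%:R.
have c0 : 0 < c by rewrite divr_gt0.
have T0 : 0 <= c * T by rewrite mulr_ge0// ?ler0n// ltW.
rewrite -subr_ge0.
have -> : (1 - 2 / (4 + c * T)) * (1 + c * (2 / (4 + c * T)) ^+ 2) - (1 - 2 / (4 + c * (T + 1)))
  = 2 * c * ((2 * (2 + c * T)) * (4 + c * (T + 1)) - (4 + c * T) ^+ 2) /
    ((4 + c * T) ^+ 3 * (4 + c * (T + 1))).
  by field; apply/andP; split; apply/lt0r_neq0; lra.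
rewrite divr_ge0//.
  rewrite mulr_ge0//; nra.
by rewrite mulr_ge0// ?exprn_ge0//; lra.
Qed.

(* The linear term makes the potential [1] beyond [n / 2], where the variance bound is lost. *)
Definition cluster_potential (t z : nat) : R :=
  Num.min 1 (2 * (1 - (1 - cluster_theta t) ^+ z) + 2 * z%:R / n).

(** Up to size [n / 2], the linear term is a martingale and the exponential term moves by
    [cluster_laplace] and [cluster_theta_step]. *)
Lemma cluster_potential_step t s (B : {set V}) : contracting lam (P s) ->
  \sum_xi flow_weight (P s) xi * cluster_potential t #|preim_flow xi B| <=
  cluster_potential t.+1 #|B|.
Proof.
move=> Plam.
have w0 xi : 0 <= flow_weight (P s) xi by exact: flow_weight_ge0.
have le1 : \sum_xi flow_weight (P s) xi * cluster_potential t #|preim_flow xi B| <= 1.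
  rewrite -[leRHS](flow_weight_sum1 (Pst s)); apply: ler_sum => xi _.
  by rewrite ler_piMr// ge_min lexx.
rewrite {2}/cluster_potential le_min le1/=.
have /andP[th0 th1] := th_bounds t; have /andP[th0' th1'] := th_bounds t.+1.
have [Bn|Bn] := leP (2 * #|B|%:R) n; last first.
  apply: le_trans le1 _; apply: (@le_trans _ _ (2 * #|B|%:R / n)).
    by rewrite ler_pdivlMr// mul1r ltW.
  rewrite lerDr mulr_ge0// subr_ge0 exprn_ile1//; lra.
apply: (@le_trans _ _ (\sum_xi flow_weight (P s) xi *
   (2 * (1 - (1 - cluster_theta t) ^+ #|preim_flow xi B|) + 2 * #|preim_flow xi B|%:R / n))).
  by apply: ler_sum => xi _; rewrite ler_wpM2l// ge_min lexx orbT.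
have -> : \sum_xi flow_weight (P s) xi *
   (2 * (1 - (1 - cluster_theta t) ^+ #|preim_flow xi B|) + 2 * #|preim_flow xi B|%:R / n) =
   2 * (1 - \prod_u (1 - cluster_theta t * \sum_(a in B) P s u a)) + 2 * #|B|%:R / n.
  rewrite -flow_laplace// -(flow_mean_card B (Pst s) (Psym s)).
  rewrite -[X in 2 * (X - _)](flow_weight_sum1 (Pst s)) -sumrB !mulr_sumr mulr_suml -big_split.
  by apply: eq_bigr => xi _ /=; ring.
rewrite lerD2r ler_wpM2l// lerD2l lerN2.
apply: le_trans (cluster_laplace (Pst s) (Psym s) Plam (ltW lam0) (th_bounds t) Bn).
have q0 : 0 <= 1 + lam / 12 * cluster_theta t ^+ 2.
  by rewrite addr_ge0// mulr_ge0 ?sqr_ge0// divr_ge0// ltW.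
rewrite lerXn2r ?nnegrE ?cluster_theta_step//; first by lra.
by rewrite mulr_ge0//; lra.
Qed.

Section Walkers.
Variable m : nat.
Implicit Types x y : {ffun 'I_m -> V}.
Let K t := @coal_step R V m (P t).

Let K0 t x y : 0 <= K t x y.
Proof. exact: (coal_step_stochastic m (Pst t)).1. Qed.

Let K1 t x : \sum_y K t x y <= 1.
Proof. by rewrite /K (coal_step_stochastic m (Pst t)).2. Qed.

Definition occupied (B : {set V}) (x : {ffun 'I_m -> V}) : R := [exists i, x i \in B]%:R.

(** Duality: [B] is occupied after the last map iff its preimage was occupied before. The induction
    therefore removes the last step and lets [B] evolve backwards in time. *)
Lemma run_occupied_le t0 t (B : {set V}) x :
  (forall s, (t0 < s <= t0 + t)%N -> contracting lam (P s)) ->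
  run K t0 t (occupied B) x <= cluster_potential t #|B|.
Proof.
elim: t B => [|t IH] B Pc.
  rewrite /= /occupied /cluster_potential; case: existsP => [[i iB]|_] /=; last first.
    have /andP[th0 th1] := th_bounds 0.
    have q1 : (1 - cluster_theta 0) ^+ #|B| <= 1 by rewrite exprn_ile1//; lra.
    by rewrite le_min ler01/= addr_ge0 ?divr_ge0 ?mulr_ge0 ?subr_ge0 ?(ltW n0).
  rewrite le_min lexx/= -[X in X <= _]addr0 lerD ?divr_ge0 ?mulr_ge0 ?(ltW n0)//.
  (* The initial value 1/2 makes [2 (1 - 2^(-z))] at least 1 for every nonempty set. *)
  have -> : cluster_theta 0 = 2^-1 by rewrite /cluster_theta mulr0 addr0; lra.
  have -> : #|B| = #|B|.-1.+1 by rewrite prednK// card_gt0; apply/set0Pn; exists (x i).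
  rewrite exprS; have : (1 - 2^-1 : R) ^+ #|B|.-1 <= 1 by rewrite exprn_ile1//; lra.
  lra.
rewrite run_recr; under eq_run do rewrite coal_step_apply//.
rewrite run_sum; under eq_bigr do rewrite run_scale.
apply: le_trans (cluster_potential_step t B (Pc (t0 + t).+1 _)); last first.
  by rewrite -addnS leqnn andbT addnS ltnS leq_addr.
apply: ler_sum => xi _; rewrite ler_wpM2l ?flow_weight_ge0//.
rewrite (_ : run K t0 t _ x = run K t0 t (occupied (preim_flow xi B)) x).
  by apply: IH => s /andP[h1 h2]; apply: Pc; rewrite h1 addnS (leq_trans h2).
apply: eq_run => y; rewrite /occupied; congr (nat_of_bool _)%:R.
by apply: eq_existsb => i; rewrite inE /push ffunE.
Qed.

Definition occupancy (x : {ffun 'I_m -> V}) : R := #|x @: [set: 'I_m]%SET|%:R.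

Lemma run_occupancy_le t0 t x :
  (forall s, (t0 < s <= t0 + t)%N -> contracting lam (P s)) ->
  run K t0 t occupancy x <= n * (2 * cluster_theta t + 2 / n).
Proof.
move=> Pc.
rewrite (_ : run K t0 t _ x = run K t0 t (fun y => \sum_v occupied [set v]%SET y) x); last first.
  apply: eq_run => y; rewrite /occupancy -sum1_card natr_sum [LHS]big_mkcond/=.
  apply: eq_bigr => v _; rewrite /occupied; case: imsetP => [[i _ ->]|no].
    by case: existsP => // -[]; exists i; rewrite inE.
  by case: existsP => // -[i]; rewrite inE => /eqP yi; case: no; exists i; rewrite ?inE ?yi.
rewrite run_sum; apply: (@le_trans _ _ (\sum_(v : V) (2 * cluster_theta t + 2 / n))).
  apply: ler_sum => v _; apply: le_trans (run_occupied_le _ _ Pc) _.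
  by rewrite /cluster_potential cards1 ge_min expr1 mulr1 opprB addrCA subrr addr0 lexx orbT.
by rewrite sumr_const /n [leRHS]mulr_natl.
Qed.

Definition not_merged (x : {ffun 'I_m -> V}) : R := (~~ [forall i, forall j, x i == x j])%:R.

(** If the walkers are not all together, some occupied vertex differs from that of [i0]. The union
    bound runs over occupied vertices instead of walkers, so that walkers already merged are counted
    once. *)
Lemma run_not_merged_le t0 t x (i0 : 'I_m) (M : R) :
  (forall u, run (avoid_kernel P P) t0 t (fun=> 1) u <= M) ->
  run K t0 t not_merged x <= occupancy x * M.
Proof.
move=> hM.
pose h t0 t v w : R := (v != w)%:R * run (avoid_kernel P P) t0 t (fun=> 1) (v, w).
have A0 : forall s u v, 0 <= avoid_kernel P P s u v.
  by move=> s u v; exact: avoid_kernel_ge0.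
have h0 a b v w : 0 <= h a b v w by rewrite mulr_ge0// run_ge0.
apply: (@le_trans _ _ (\sum_(v in x @: [set: 'I_m]%SET) h t0 t v (x i0))); last first.
  rewrite /occupancy -sum1_card natr_sum mulr_suml; apply: ler_sum => v _; rewrite mul1r.
  by apply: le_trans (hM (v, x i0)); rewrite ler_piMl ?run_ge0//; case: (_ != _).
elim: t t0 x {hM} => [|t IH] t0 x.
  rewrite /= /not_merged; case: forallP => [_|] /=; first by apply: sumr_ge0.
  move=> /existsNP[i /negP]; rewrite negb_forall => /existsP[j xij].
  have [l xl] : exists l, x l != x i0.
    have [xi|] := eqVneq (x i) (x i0); last by exists i.
    by exists j; rewrite -xi eq_sym.
  rewrite (bigD1 (x l))/=; last by rewrite imset_f ?inE.
  by rewrite {1}/h xl mul1r lerDl sumr_ge0.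
rewrite /= coal_step_apply//.
apply: (@le_trans _ _ (\sum_xi flow_weight (P t0.+1) xi *
   \sum_(v in x @: [set: 'I_m]%SET) h t0.+1 t (xi v) (xi (x i0)))).
  apply: ler_sum => xi _; rewrite ler_wpM2l ?flow_weight_ge0//.
  apply: le_trans (IH _ _) _; rewrite {2}/push ffunE.
  have -> : push xi x @: [set: 'I_m]%SET = xi @: (x @: [set: 'I_m]%SET).
    by rewrite -imset_comp; apply: eq_imset => i; rewrite /push ffunE.
  set A := x @: _; set g := fun v => h t0.+1 t v (xi (x i0)).
  rewrite -[leLHS]/(\sum_(v in xi @: A) g v) -[leRHS]/(\sum_(v in A) g (xi v)).
  (* A vertex of the image has at least one antecedent among the occupied vertices, so merging only
     shrinks the sum. *)
  rewrite [leRHS](partition_big xi (mem (xi @: A)))/=; last by move=> v; exact: imset_f.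
  apply: ler_sum => _ /imsetP[v vA ->]; rewrite (bigD1 v)/=; last by rewrite vA eqxx.
  by rewrite lerDl sumr_ge0// => a _; exact: h0.
rewrite [leLHS](eq_bigr _ (fun xi _ => mulr_sumr _ _ _ _)).
rewrite exchange_big/=; apply: ler_sum => v _.
have [->|vx] := eqVneq v (x i0).
  by rewrite big1// => xi _; rewrite /h eqxx mul0r mulr0.
(* Two distinct vertices have independent images, so the pair moves as two independent walkers until
   it meets. *)
rewrite (flow_weight_marginal2 (h t0.+1 t) (Pst t0.+1) vx) {2}/h vx mul1r run_avoidS.
rewrite exchange_big/=; apply: ler_sum => b _; rewrite mulr_sumr; apply: ler_sum => a _.
by rewrite /h [leRHS]mulrCA !mulrA.
Qed.

End Walkers.

End Coalescence.

Arguments occupancy {R V m} x.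
Arguments not_merged {R V m} x.

(** * Cheeger's inequality *)

Section Cheeger.
Context {R : realType} {V : finType}.
Variables (P : V -> V -> R) (h : R).
Hypothesis Pst : stochastic P.
Hypothesis Psym : sym_kernel P.
Hypothesis h0 : 0 < h.
Hypothesis expansion : forall S : {set V}, (2 * #|S| <= #|V|)%N ->
  h * #|S|%:R <= \sum_(x in S) \sum_(y in ~: S) P x y.

Let P0 x y : 0 <= P x y. Proof. exact: Pst.1. Qed.

(** Twice the usual Dirichlet form, each pair being counted in both orders. *)
Definition dirichlet (f : V -> R) : R := \sum_x \sum_y P x y * (f x - f y) ^+ 2.

(** Cheeger's inequality in [l1], by induction on the size of the support: subtracting the least
    positive value [m] on the support [S] lowers the left side by [2 h m |S|] and the right side by
    [2 m] times the cut of [S]. *)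
Lemma coarea (g : V -> R) : (forall x, 0 <= g x) ->
  (2 * #|[set x | (0 < g x)%R]%SET| <= #|V|)%N ->
  2 * h * (\sum_x g x) <= \sum_x \sum_y P x y * `|g x - g y|.
Proof.
move: {2}#|_| (leqnn #|[set x | (0 < g x)%R]%SET|) => k.
elim: k g => [|k IH] g kg g0 gV.
  rewrite big1 ?mulr0 => [|x _].
    by apply: sumr_ge0 => x _; apply: sumr_ge0 => y _; rewrite mulr_ge0.
  apply/eqP; rewrite eq_le g0 andbT leNgt; apply/negP => gx.
  by move: kg; rewrite leqn0 cards_eq0 => /eqP/setP/(_ x); rewrite !inE gx.
set S := [set x | (0 < g x)%R]%SET in kg gV.
have [S0|/set0Pn[z zS]] := eqVneq S finset.set0.
  by apply: IH => //; rewrite -/S S0 cards0.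
pose x0 := [arg min_(x < z in S) g x]%O.
have [x0S xmin] : x0 \in S /\ forall y, y \in S -> g x0 <= g y.
  by rewrite /x0; case: arg_minP.
set m := g x0 in xmin.
have m0 : 0 < m by move: x0S; rewrite inE.
pose g' x := g x - m * (x \in S)%:R.
have gS x : x \notin S -> g x = 0.
  by rewrite inE -leNgt => gx; apply/eqP; rewrite eq_le gx g0.
have g'0 x : 0 <= g' x.
  rewrite /g'; have [xS|xS] := boolP (x \in S); first by rewrite mulr1 subr_ge0 xmin.
  by rewrite mulr0 subr0.
have sub : [set x | 0 < g' x]%SET \proper S.
  apply/properP; split.
    apply/fintype.subsetP => x; rewrite !inE /g' => h1; have : 0 <= m * (x \in S)%:R by rewrite mulr_ge0// ltW.
    lra.
  by exists x0 => //; rewrite inE /g' x0S mulr1 -/m subrr ltxx.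
have := IH g' _ g'0 _.
have c1 := proper_card sub.
rewrite -ltnS (leq_trans c1)// => /(_ isT); rewrite (leq_trans _ gV) => [/(_ isT) IH'|]; last first.
  by rewrite leq_mul2l ltnW.
have sg : \sum_x g x = \sum_x g' x + m * #|S|%:R.
  rewrite -sum1_card natr_sum mulr_sumr [X in _ + X]big_mkcond -big_split; apply: eq_bigr => x _ /=.
  by rewrite /g'; case: (x \in S) => /=; ring.
have dg x y : `|g x - g y| = `|g' x - g' y| + m * ((x \in S) && (y \notin S))%:R + m * ((y \in S) && (x \notin S))%:R.
  rewrite /g'; have [xS|xS] := boolP (x \in S); have [yS|yS] := boolP (y \in S) => /=.
  - by rewrite !mulr1 mulr0 !addr0; congr `|_|; ring.
  - rewrite mulr1 !mulr0 (gS _ yS) !subr0 addr0 !ger0_norm//; first by ring.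
    by rewrite subr_ge0 xmin.
  - rewrite mulr1 !mulr0 (gS _ xS) subr0 addr0 !sub0r !normrN !ger0_norm//; first by ring.
    by rewrite subr_ge0 xmin.
  - by rewrite !mulr0 !subr0 !addr0.
have cut : \sum_x \sum_y P x y * ((x \in S) && (y \notin S))%:R = \sum_(x in S) \sum_(y in ~: S) P x y.
  rewrite [RHS]big_mkcond; apply: eq_bigr => x _; case: (x \in S) => /=.
    by rewrite [RHS]big_mkcond; apply: eq_bigr => y _; rewrite !inE; case: (_ < _); rewrite ?mulr1 ?mulr0.
  by rewrite big1// => y _; rewrite mulr0.
have cut' : \sum_x \sum_y P x y * ((y \in S) && (x \notin S))%:R = \sum_(x in S) \sum_(y in ~: S) P x y.
  by rewrite exchange_big/= -cut; apply: eq_bigr => x _; apply: eq_bigr => y _; rewrite Psym.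
have -> : \sum_x \sum_y P x y * `|g x - g y| =
    \sum_x \sum_y P x y * `|g' x - g' y| + m * (\sum_(x in S) \sum_(y in ~: S) P x y) + m * (\sum_(x in S) \sum_(y in ~: S) P x y).
  rewrite -{1}cut -cut' !mulr_sumr -!big_split; apply: eq_bigr => x _.
  by rewrite !mulr_sumr -!big_split; apply: eq_bigr => y _ /=; rewrite dg; ring.
rewrite sg mulrDr -addrA lerD//.
have := ler_wpM2l (ltW m0) (expansion gV); lra.
Qed.

(** [coarea] for the square of [f]. The weighted inequality [a b <= a^2 / h + h b^2 / 4], with
    [a = |f x - f y|] and [b = f x + f y], stands in for Cauchy-Schwarz: the second term costs [h F]
    out of the [2 h F] at hand. *)
Lemma dirichlet_half (f : V -> R) : (forall x, 0 <= f x) ->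
  (2 * #|[set x | (0 < f x)%R]%SET| <= #|V|)%N ->
  h ^+ 2 * (\sum_x f x ^+ 2) <= dirichlet f.
Proof.
move=> f0 fV.
have := @coarea (fun x => f x ^+ 2) (fun x => sqr_ge0 _) _.
have -> : [set x | 0 < f x ^+ 2]%SET = [set x | (0 < f x)%R]%SET.
  apply/setP => x; rewrite !inE lt0r sqr_ge0 andbT expf_eq0/=.
  by rewrite lt0r f0 andbT.
move=> /(_ fV) co.
set F := \sum_x f x ^+ 2 in co *.
have hi : 0 < h^-1 by rewrite invr_gt0.
have : \sum_x \sum_y P x y * `|f x ^+ 2 - f y ^+ 2| <=
    \sum_x \sum_y P x y * ((f x - f y) ^+ 2 * h^-1 + (f x ^+ 2 + f y ^+ 2) * (h / 2)).
  apply: ler_sum => x _; apply: ler_sum => y _; rewrite ler_wpM2l//.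
  rewrite subr_sqr normrM [`|f x + f y|]ger0_norm ?addr_ge0//.
  set a := `|f x - f y|; set b := f x + f y.
  have -> : (f x - f y) ^+ 2 = a ^+ 2 by rewrite /a real_normK// num_real.
  have b2 : b ^+ 2 <= 2 * (f x ^+ 2 + f y ^+ 2).
    by have := sqr_ge0 (f x - f y); rewrite /b => ?; lra.
  have hh : h^-1 * h = 1 by rewrite mulVf ?gt_eqF.
  have : 0 <= (a - b * (h / 2)) ^+ 2 * h^-1 by rewrite mulr_ge0 ?sqr_ge0// ltW.
  have -> : (a - b * (h / 2)) ^+ 2 * h^-1 = a ^+ 2 * h^-1 - a * b * (h^-1 * h) + b ^+ 2 / 4 * h * (h^-1 * h) by field; rewrite gt_eqF.
  rewrite hh !mulr1.
  have := ler_wpM2r (ltW h0) b2; lra.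
have -> : \sum_x \sum_y P x y * ((f x - f y) ^+ 2 * h^-1 + (f x ^+ 2 + f y ^+ 2) * (h / 2)) =
    dirichlet f * h^-1 + h * F.
  transitivity (\sum_x \sum_y P x y * (f x - f y) ^+ 2 * h^-1 +
     (h / 2 * (\sum_x \sum_y P x y * f x ^+ 2) + h / 2 * (\sum_x \sum_y P x y * f y ^+ 2))).
    rewrite !mulr_sumr -!big_split; apply: eq_bigr => x _.
    by rewrite !mulr_sumr -!big_split; apply: eq_bigr => y _ /=; ring.
  rewrite /dirichlet mulr_suml; congr (_ + _).
    by apply: eq_bigr => x _; rewrite mulr_suml.
  have -> : \sum_x \sum_y P x y * f x ^+ 2 = F.
    by apply: eq_bigr => x _; rewrite -mulr_suml Pst.2 mul1r.
  have -> : \sum_x \sum_y P x y * f y ^+ 2 = F.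
    rewrite exchange_big/=; apply: eq_bigr => x _; rewrite -mulr_suml.
    by under eq_bigr do rewrite Psym; rewrite Pst.2 mul1r.
  by field.
move=> le2; have {}co := le_trans co le2.
have : h * F <= dirichlet f * h^-1 by lra.
by rewrite ler_pdivlMr// mulrAC -expr2.
Qed.

(** The least value [f x0] with at most half of the points strictly above it. The next lower value,
    if any, has more than half strictly above it, so less than half of the points lie below
    [f x0]. *)
Lemma median_exists (f : V -> R) : (0 < #|V|)%N -> exists c : R,
  (2 * #|[set x | (c < f x)%R]%SET| <= #|V|)%N /\ (2 * #|[set x | (f x < c)%R]%SET| <= #|V|)%N.
Proof.
move=> /card_gt0P[z _].
pose A := [set x | 2 * #|[set y | (f x < f y)%R]%SET| <= #|V|]%N%SET.
have [x1 _ x1max] := @arg_maxP _ _ _ z xpredT f isT.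
have x1A : x1 \in A.
  rewrite inE (_ : [set y | _]%SET = finset.set0) ?cards0 ?muln0//.
  by apply/setP => y; rewrite !inE; apply/negbTE; rewrite -leNgt; exact: x1max.
have [x0 x0A x0min] := @arg_minP _ _ _ x1 (fun x => x \in A) f x1A.
exists (f x0); split; first by move: x0A; rewrite /= inE.
have [->|/set0Pn[w wB]] := eqVneq [set x | (f x < f x0)%R]%SET finset.set0.
  by rewrite cards0 muln0.
have [x2 x2B x2max] := @arg_maxP _ _ _ w (fun x => x \in [set x | (f x < f x0)%R]%SET) f wB.
have x2A : x2 \notin A.
  apply/negP => /x0min; rewrite leNgt => /negP; apply.
  by move: x2B; rewrite /= inE.
rewrite inE -ltnNge in x2A.
have -> : [set x | (f x < f x0)%R]%SET = ~: [set y | (f x2 < f y)%R]%SET.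
  apply/setP => y; rewrite !inE -leNgt; apply/idP/idP => [yx0|].
    by apply: x2max; rewrite /= inE.
  by move=> /le_lt_trans; apply; move: x2B; rewrite /= inE.
rewrite cardsCs finset.setCK mulnBr leq_subLR.
by rewrite -[X in (X <= _)%N]/(2 * _)%N mul2n -addnn leq_add2r ltnW.
Qed.

(** The positive and negative parts of [f - c] around a median [c] each live on at most half of the
    vertices, and their energies add up to at most that of [f]. *)
Lemma dirichlet_variance (f : V -> R) : (0 < #|V|)%N ->
  h ^+ 2 * (\sum_x f x ^+ 2 - (\sum_x f x) ^+ 2 / #|V|%:R) <= dirichlet f.
Proof.
move=> V0; have [c [c1 c2]] := median_exists f V0.
pose fp x := Num.max (f x - c) 0; pose fm x := Num.max (c - f x) 0.
have fp0 x : 0 <= fp x by rewrite /fp le_max lexx orbT.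
have fm0 x : 0 <= fm x by rewrite /fm le_max lexx orbT.
have fpm x : (f x - c) ^+ 2 = fp x ^+ 2 + fm x ^+ 2.
  by rewrite /fp /fm; case: (leP (f x - c) 0); case: (leP (c - f x) 0) => ? ?; nra.
have Dle : dirichlet fp + dirichlet fm <= dirichlet f.
  rewrite /dirichlet -big_split; apply: ler_sum => x _; rewrite -big_split; apply: ler_sum => y _ /=.
  rewrite -mulrDr ler_wpM2l// /fp /fm.
  case: (leP (f x - c) 0); case: (leP (c - f x) 0); case: (leP (f y - c) 0); case: (leP (c - f y) 0) => *; nra.
have Hp : h ^+ 2 * (\sum_x fp x ^+ 2) <= dirichlet fp.
  apply: dirichlet_half => //; rewrite (_ : [set x | _]%SET = [set x | (c < f x)%R]%SET)//.
  by apply/setP => x; rewrite !inE /fp lt_max ltxx orbF subr_gt0.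
have Hm : h ^+ 2 * (\sum_x fm x ^+ 2) <= dirichlet fm.
  apply: dirichlet_half => //; rewrite (_ : [set x | _]%SET = [set x | (f x < c)%R]%SET)//.
  by apply/setP => x; rewrite !inE /fm lt_max ltxx orbF subr_gt0.
apply: le_trans Dle; apply: le_trans (lerD Hp Hm).
rewrite -mulrDr ler_wpM2l ?sqr_ge0// -big_split/=.
under [leRHS]eq_bigr do rewrite -fpm.
set n : R := #|V|%:R; have n0 : 0 < n by rewrite ltr0n.
have -> : \sum_x (f x - c) ^+ 2 = \sum_x f x ^+ 2 - (c + c) * (\sum_x f x) + n * c ^+ 2.
  rewrite (eq_bigr (fun x => f x ^+ 2 - (c + c) * f x + c ^+ 2)) => [|x _]; last by ring.
  by rewrite big_split/= sumrB -mulr_sumr sumr_const -[in LHS]mulr_natl.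
set s := \sum_x f x; rewrite -subr_ge0.
have -> : \sum_x f x ^+ 2 - (c + c) * s + n * c ^+ 2 - (\sum_x f x ^+ 2 - s ^+ 2 / n) = (s - n * c) ^+ 2 / n.
  by field; rewrite gt_eqF.
by rewrite divr_ge0 ?sqr_ge0// ltW.
Qed.

(** Laziness excludes negative eigenvalues: [2 P - 1] is again stochastic and symmetric, and its
    contraction of norms reads [|P f|^2 <= <f, P f>]. The right side is the squared norm of [f]
    minus half of [dirichlet f]. *)
Lemma cheeger_contracting : (forall x, 2^-1 <= P x x) -> contracting (h ^+ 2 / 2) P.
Proof.
move=> lazy f; have [V0|V0] := posnP #|V|.
  by rewrite !big_pred0 ?mulr0 ?expr0n ?mul0r ?mulr0 ?addr0// => x; apply: contraTF isT => _;
     move/eqP: V0; rewrite -leqn0 leqNgt => /negP; case; apply/card_gt0P; exists x.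
pose P' x y := 2 * P x y - (x == y)%:R.
have P'st : stochastic P'.
  split => [x y|x]; rewrite /P'.
    case: eqVneq => [->|_] /=; last by rewrite subr0 mulr_ge0.
    have := lazy y; lra.
  rewrite sumrB -mulr_sumr Pst.2 (bigD1 x)//= eqxx big1 ?addr0 => [|y yx]; first by rewrite /=; ring.
  by rewrite eq_sym (negbTE yx).
have P'sym : sym_kernel P' by move=> x y; rewrite /P' Psym eq_sym.
have := contracting0 P'st P'sym f.
rewrite subr0 mul1r mul0r addr0.
pose g x := \sum_y P x y * f y.
have P'f x : \sum_y P' x y * f y = 2 * g x - f x.
  rewrite /P' /g mulr_sumr.
  have -> : f x = \sum_y (x == y)%:R * f y.
    rewrite (bigD1 x)//= eqxx mul1r big1 ?addr0// => y yx.
    by rewrite eq_sym (negbTE yx) mul0r.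
  by rewrite -sumrB; apply: eq_bigr => y _; ring.
under eq_bigr do rewrite P'f.
have -> : \sum_x (2 * g x - f x) ^+ 2 = 4 * (\sum_x g x ^+ 2) - 4 * (\sum_x f x * g x) + \sum_x f x ^+ 2.
  by rewrite !mulr_sumr -sumrB -big_split; apply: eq_bigr => x _ /=; ring.
move=> psd.
have D : dirichlet f = 2 * (\sum_x f x ^+ 2) - 2 * (\sum_x f x * g x).
  transitivity (\sum_x \sum_y P x y * f x ^+ 2 + \sum_x \sum_y P x y * f y ^+ 2 - 2 * (\sum_x f x * g x)).
    rewrite mulr_sumr -big_split -sumrB; apply: eq_bigr => x _ /=.
    rewrite /g !mulr_sumr -big_split -sumrB; apply: eq_bigr => y _ /=; ring.
  congr (_ - _); rewrite mulrDl mul1r; congr (_ + _).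
    by apply: eq_bigr => x _; rewrite -mulr_suml Pst.2 mul1r.
  rewrite exchange_big/=; apply: eq_bigr => x _; rewrite -mulr_suml.
  by under eq_bigr do rewrite Psym; rewrite Pst.2 mul1r.
have dv := dirichlet_variance f V0; rewrite D in dv.
rewrite -[leLHS]/(\sum_x g x ^+ 2).
set a := \sum_x f x ^+ 2 in psd dv *; set b := (\sum_x f x) ^+ 2 / _ in dv *; set d := \sum_x g x ^+ 2 in psd *.
have {psd}psd : d <= \sum_x f x * g x by lra.
lra.
Qed.

End Cheeger.

(** * Random graphs are expanders *)

Section Cuts.
Context {V : finType}.
Implicit Types (G : sgraph V) (S : {set V}).

Lemma adjC G u v : adj G u v = adj G v u.
Proof. by apply: eq_existsb => e; rewrite finset.setUC. Qed.

Lemma adjxx G u : adj G u u = false.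
Proof.
apply/negbTE/existsPn => e; rewrite negb_and; apply/orP; right.
by apply/eqP => eu; have := valP e; rewrite eu finset.setUid cards1.
Qed.

Definition edge_cut S : {set vpair V} :=
  [set e | [exists x in S, exists y in ~: S, val e == [set x; y]%SET]]%SET.

(** A cut edge has exactly one orientation from [S] to its complement. *)
Lemma sum_edge_cut S (e : vpair V) :
  (\sum_(x in S) \sum_(y in ~: S) (val e == [set x; y]%SET))%N = (e \in edge_cut S).
Proof.
have [|no] := boolP (e \in edge_cut S); last first.
  rewrite big1// => x xS; rewrite big1// => y yS; apply/eqP; rewrite eqb0.
  apply: contra no => exy; rewrite inE; apply/existsP; exists x; rewrite xS/=.
  by apply/existsP; exists y; rewrite yS exy.
rewrite inE => /existsP[x /andP[xS /existsP[y /andP[yS /eqP exy]]]].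
have yS' : y \notin S by rewrite -finset.in_setC.
rewrite (bigD1 x)//= (bigD1 y)//= exy eqxx big1 ?addn0 => [|z /andP[zS zy]]; last first.
  apply/eqP; rewrite eqb0; apply: contra zy => /eqP/setP/(_ y); rewrite !inE eqxx orbT.
  by move=> /esym/orP[/eqP yx|/eqP ->//]; rewrite yx xS in yS'.
rewrite big1// => z /andP[zS zx]; rewrite big1// => w wS; apply/eqP; rewrite eqb0.
apply: contra zx => /eqP/setP/(_ z); rewrite !inE eqxx /= => /orP[//|/eqP zy].
by rewrite -zy zS in yS'.
Qed.

Lemma sum_pairs_adj G x y : x != y ->
  (\sum_(e in G) (val e == [set x; y]%SET))%N = adj G x y.
Proof.
move=> xy; have [/existsP[e /andP[eG /eqP exy]]|no] := boolP (adj G x y).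
  rewrite (bigD1 e)//= exy eqxx big1 ?addn0// => e' /andP[_ e'e]; apply/eqP; rewrite eqb0.
  by apply: contra e'e => /eqP e'xy; apply/eqP/val_inj; exact: (etrans e'xy (esym exy)).
rewrite big1// => e eG; apply/eqP; rewrite eqb0; apply: contra no => exy.
by apply/existsP; exists e; rewrite eG.
Qed.

Lemma card_cut_in G S : #|G :&: edge_cut S| = (\sum_(x in S) \sum_(y in ~: S) adj G x y)%N.
Proof.
transitivity (\sum_(e in G) \sum_(x in S) \sum_(y in ~: S) (val e == [set x; y]%SET))%N.
  rewrite -sum1_card (eq_bigl (fun e => (e \in G) && (e \in edge_cut S))) => [|e]; last by rewrite !inE.
  rewrite big_mkcondr/=; apply: eq_bigr => e _; rewrite sum_edge_cut.
  by case: (_ \in edge_cut S).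
rewrite exchange_big/=; apply: eq_bigr => x xS; rewrite exchange_big/=.
apply: eq_bigr => y; rewrite finset.in_setC => yS; apply: sum_pairs_adj.
by apply: contraNneq yS => <-.
Qed.

Lemma adj_setT x y : x != y -> adj [set: vpair V]%SET x y.
Proof.
move=> xy; have c2 : #|[set x; y]%SET| == 2 by rewrite cards2 xy.
by apply/existsP; exists (exist (fun A : {set V} => #|A| == 2) _ c2 : vpair V); rewrite inE/= eqxx.
Qed.

Lemma card_cut S : #|edge_cut S| = (#|S| * (#|V| - #|S|))%N.
Proof.
rewrite -(finset.setTI (edge_cut S)) card_cut_in -sum_nat_const; apply: eq_bigr => x xS.
rewrite -(cardsC S) addKn -sum1_card.
apply: eq_bigr => y; rewrite finset.in_setC => yS; rewrite adj_setT//.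
by apply: contraNneq yS => <-.
Qed.

(** Degrees are cuts of singletons, so that the bounds for edge cuts also control degrees. *)
Lemma deg_cut1 G v : deg G v = #|G :&: edge_cut [set v]%SET|.
Proof.
rewrite card_cut_in big_set1 /deg -sum1_card big_mkcond [RHS]big_mkcond.
apply: eq_bigr => y _; rewrite !inE; case: eqVneq => [->|_]/=; first by rewrite adjxx.
by case: (adj G v y).
Qed.

End Cuts.

Section LazyMetropolis.
Context {R : realType} {V : finType}.
Implicit Types (G : sgraph V).

Lemma PLM_sym G : sym_kernel (@PLM R V G).
Proof.
move=> x y; rewrite /PLM adjC maxnC [y == x]eq_sym; case: ifP => // _.
by case: eqVneq => [->|].
Qed.

Lemma PLM_lazy G x : 2^-1 <= @PLM R V G x x.
Proof.
rewrite /PLM adjxx eqxx.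
have [d0|d0] := posnP (deg G x).
  by rewrite (cards0_eq d0) big_set0 subr0; lra.
have : \sum_(w in nbhd G x) ((2 * maxn (deg G x) (deg G w))%:R^-1 : R) <=
   \sum_(w in nbhd G x) (2 * deg G x)%:R^-1.
  apply: ler_sum => w _; rewrite lef_pV2 ?posrE ?ltr0n ?ler_nat ?muln_gt0//=.
    by rewrite leq_mul2l leq_maxl orbT.
  by rewrite leq_max d0.
rewrite sumr_const -/(deg G x) -[X in _ <= X -> _]mulr_natr natrM invfM -mulrA mulVf ?pnatr_eq0 -?lt0n// mulr1.
lra.
Qed.

(** The scale [d] will be [n p / (p + q)]. Bounded degrees keep the Metropolis weights of order
    [1 / d]; the cut bound provides enough edges. *)
Definition expander (d : R) G : Prop :=
  (forall v, (deg G v)%:R <= 4 * d) /\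
  (forall S : {set V}, (2 * #|S| <= #|V|)%N -> d / 96 * #|S|%:R <= #|G :&: edge_cut S|%:R).

(* On an expander, edges have weight at least [1 / (8 d)], so the conductance is at least
   [1 / (8 * 96)]; [gap] is half its square. *)
Definition gap : R := 768^-1 ^+ 2 / 2.

Lemma expander_contracting (d : R) G : 0 < d -> expander d G -> contracting gap (@PLM R V G).
Proof.
move=> d0 [dmax dcut].
have Pst := PLM_stochastic G : stochastic (@PLM R V G).
have h0 : 0 < 768^-1 :> R by rewrite invr_gt0 ltr0n.
apply: (@cheeger_contracting R V _ 768^-1 Pst (PLM_sym G) h0 _ (PLM_lazy G)).
move=> S /dcut; rewrite card_cut_in; set h768 := 768^-1 => h.
have {h768}-> : h768 * #|S|%:R = (8 * d)^-1 * (d / 96 * #|S|%:R).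
  by rewrite /h768; field; rewrite gt_eqF.
apply: (@le_trans _ _ (\sum_(x in S) \sum_(y in ~: S) (8 * d)^-1 * (adj G x y)%:R)).
  under eq_bigr do rewrite -mulr_sumr; rewrite -mulr_sumr.
  move: h; rewrite natr_sum; under eq_bigr do rewrite natr_sum.
  have d8 : 0 <= (8 * d)^-1 by rewrite invr_ge0 mulr_ge0// ltW.
  exact: ler_wpM2l.
apply: ler_sum => x _; apply: ler_sum => y _.
have [xy|] := boolP (adj G x y); last by rewrite mulr0 Pst.1.
rewrite mulr1 /PLM xy lef_pV2 ?posrE; last 2 first.
- by rewrite mulr_gt0.
- rewrite ltr0n muln_gt0/= leq_max; apply/orP; left.
  by rewrite card_gt0; apply/set0Pn; exists y; rewrite inE.
rewrite natrM (_ : 8 * d = 2 * (4 * d)); last by ring.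
by rewrite ler_wpM2l//; case: (leqP (deg G x) (deg G y)).
Qed.

End LazyMetropolis.

(** * The edge-Markovian chain: law after several steps and Chernoff bounds *)

Section EdgeMarkov.
Context {R : realType} {V : finType}.
Implicit Types (p q : R) (G H : sgraph V).

Definition edge_prob p q G (e : vpair V) : R := if e \in G then 1 - q else p.

Lemma em_step_prod p q G (phi : vpair V -> bool -> R) :
  \sum_H em_step p q G H * \prod_e phi e (e \in H) =
  \prod_e (edge_prob p q G e * phi e true + (1 - edge_prob p q G e) * phi e false).
Proof.
rewrite bigA_distr; apply: eq_big => // H _; rewrite /em_step -big_split.
apply: eq_bigr => e _; rewrite /edge_prob /=.
by case: (e \in G); case: (e \in H); rewrite ?subKr.
Qed.

(* The edge flips compose to edge flips, so the law of [G t] is a single [em_step]. *)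
Lemma em_step_comp p q p' q' G H :
  \sum_G' em_step p q G G' * em_step p' q' G' H =
  em_step (p * (1 - q') + (1 - p) * p') (q * (1 - p') + (1 - q) * q') G H.
Proof.
have := em_step_prod p q G (fun e b => if b then (if e \in H then 1 - q' else q')
   else (if e \in H then p' else 1 - p')).
rewrite /em_step => ->; apply: eq_bigr => e _; rewrite /edge_prob.
by case: (e \in G); case: (e \in H); ring.
Qed.

(** Each edge is a two-state chain with stationary probability [p / (p + q)] and second eigenvalue
    [1 - p - q]. *)
Lemma run_em_step p q t0 t f G : 0 < p + q ->
  run (fun=> em_step p q) t0 t f G =
  \sum_H em_step (p / (p + q) * (1 - (1 - p - q) ^+ t)) (q / (p + q) * (1 - (1 - p - q) ^+ t)) G H * f H.
Proof.
move=> pq0; elim: t t0 G => [|t IH] t0 G.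
  rewrite /= expr0 subrr !mulr0 (bigD1 G)//= [X in X * _]big1 => [|e _]; last first.
    by case: (e \in G); rewrite subr0.
  rewrite mul1r big1 ?addr0// => H HG.
  have [e eGH] : exists e, (e \in G) != (e \in H).
    apply/existsP; apply: contraNT HG; rewrite negb_exists => /forallP h.
    by apply/eqP/setP => e; have := h e; rewrite negbK => /eqP.
  rewrite /em_step (bigD1 e)//=.
  by move: eGH; case: (e \in G); case: (e \in H) => //= _; rewrite mul0r mul0r.
rewrite /=; under eq_bigr do rewrite IH mulr_sumr.
rewrite exchange_big/=; apply: eq_bigr => H _.
under eq_bigr do rewrite mulrA; rewrite -mulr_suml em_step_comp; congr (_ * _).
set r := (1 - p - q) ^+ t.
by congr (em_step _ _ G H); rewrite exprS -/r; field; rewrite gt_eqF.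
Qed.

Lemma em_step_laplace p q G (A : {set vpair V}) (x : R) :
  \sum_H em_step p q G H * x ^+ #|H :&: A| =
  \prod_(e in A) (1 + edge_prob p q G e * (x - 1)).
Proof.
have := em_step_prod p q G (fun e b => if (e \in A) && b then x else 1).
rewrite [RHS in _ = RHS -> _](_ : _ = \prod_(e in A) (1 + edge_prob p q G e * (x - 1))).
  move=> <-; apply: eq_bigr => H _; congr (_ * _).
  rewrite -prodr_const big_mkcond; apply: eq_bigr => e _.
  by rewrite inE andbC.
rewrite [RHS]big_mkcond; apply: eq_bigr => e _; case: (e \in A) => /=; ring.
Qed.

Lemma em_step_ge0 p q G H : 0 <= p <= 1 -> 0 <= q <= 1 -> 0 <= em_step p q G H.
Proof. by move=> p01 q01; have [h _] := @em_step_stochastic R V p q p01 q01; exact: h. Qed.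

(** From [7/8 <= exp (- 1/8)], raised to the power 8, since [(7/8)^8 > 1/3]. *)
Lemma expR1_le3 : expR 1 <= 3 :> R.
Proof.
have h : 7 / 8 <= expR (- 8^-1) :> R by apply: le_trans (expR_ge1Dx _); lra.
have : (7 / 8) ^+ 8 <= expR (- 8^-1) ^+ 8 :> R by rewrite lerXn2r ?nnegrE ?expR_ge0//; lra.
rewrite -expRM_natr mulNr mulVf// expRN => h8.
have e0 : 0 < expR 1 :> R by exact: expR_gt0.
have : (7 / 8) ^+ 8 * expR 1 <= 1 :> R by rewrite -ler_pdivlMr// mul1r.
lra.
Qed.

(** Exponential Markov inequality with parameter 1; the factor 2 bounds [e - 1]. *)
Lemma chernoff_upper p q G (A : {set vpair V}) (a b : R) :
  0 <= p <= 1 -> 0 <= q <= 1 -> (forall e, edge_prob p q G e <= b) ->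
  \sum_H em_step p q G H * (a < #|H :&: A|%:R)%R%:R <= expR (- a + 2 * b * #|A|%:R).
Proof.
move=> p01 q01 hb.
have ge0 e : 0 <= edge_prob p q G e.
  by rewrite /edge_prob; case: ifP => _; lra.
apply: (@le_trans _ _ (\sum_H em_step p q G H * (expR (- a) * expR 1 ^+ #|H :&: A|))).
  apply: ler_sum => H _; rewrite ler_wpM2l ?em_step_ge0//.
  case: ltP => h; last by rewrite mulr_ge0 ?exprn_ge0 ?expR_ge0.
  by rewrite -expRM_natr mul1r -expRD -[X in X <= _]expR0 ler_expR; lra.
under eq_bigr do rewrite mulrCA.
rewrite -mulr_sumr em_step_laplace expRD ler_wpM2l ?expR_ge0//.
rewrite expRM_natr -prodr_const; apply: ler_prod => e _.
have e2 : 1 <= expR 1 :> R by apply: le_trans (expR_ge1Dx _); lra.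
have e3 : expR 1 <= 3 :> R by exact: expR1_le3.
have h := ge0 e; have hb' := hb e; apply/andP; split.
  by rewrite addr_ge0// mulr_ge0//; lra.
apply: le_trans (expR_ge1Dx _).
rewrite lerD2l [2 * b]mulrC; apply: ler_pM => //; lra.
Qed.

(** Exponential Markov inequality with parameter [-3]; the factor 7/8 comes from
    [exp (- 3) <= 1/8]. *)
Lemma chernoff_lower p q G (A : {set vpair V}) (a b : R) :
  0 <= p <= 1 -> 0 <= q <= 1 -> 0 <= b -> (forall e, b <= edge_prob p q G e) ->
  \sum_H em_step p q G H * (#|H :&: A|%:R < a)%R%:R <= expR (3 * a - 7 / 8 * b * #|A|%:R).
Proof.
move=> p01 q01 b0 hb.
have le1 e : edge_prob p q G e <= 1.
  by rewrite /edge_prob; case: ifP => _; lra.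
apply: (@le_trans _ _ (\sum_H em_step p q G H * (expR (3 * a) * expR (-3) ^+ #|H :&: A|))).
  apply: ler_sum => H _; rewrite ler_wpM2l ?em_step_ge0//.
  case: ltP => h; last by rewrite mulr_ge0 ?exprn_ge0 ?expR_ge0.
  by rewrite -expRM_natr -expRD -[X in X <= _]expR0 ler_expR; lra.
under eq_bigr do rewrite mulrCA.
rewrite -mulr_sumr em_step_laplace expRD ler_wpM2l ?expR_ge0//.
rewrite -mulNr expRM_natr -prodr_const; apply: ler_prod => e _.
have e8 : expR (-3) <= 8^-1 :> R.
  rewrite expRN lef_pV2 ?posrE ?expR_gt0// (_ : 3 = 1 * 3%:R); last by rewrite mul1r.
  rewrite expRM_natr (_ : 8 = 2 ^+ 3); last by ring.
  rewrite lerXn2r ?nnegrE ?expR_ge0//; apply: le_trans (expR_ge1Dx _); lra.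
have e0 := expR_ge0 (-3 : R).
have h := le1 e; have hb' := hb e; have he : 0 <= edge_prob p q G e := le_trans b0 hb'.
apply/andP; split.
  have := ler_wpM2l he e0; rewrite mulr0 mulrBr mulr1; lra.
apply: le_trans (expR_ge1Dx _).
rewrite lerD2l.
have := ler_wpM2l he e8; rewrite mulrBr mulr1; lra.
Qed.

End EdgeMarkov.

(** * Probability of a non-contracting graph and mean of the damping product *)

Section RareBadGraphs.
Context {R : realType} {V : finType}.
Implicit Types (p q : R) (G H : sgraph V).

Let n : R := #|V|%:R.

(** Stated through the contraction that the walks use, not through expansion; real-valued so that
    [run] can average it. *)
Definition bad_graph (G : sgraph V) : R := (~~ `[< contracting (gap : R) (@PLM R V G) >])%:R.

Lemma bad_graph01 G : 0 <= bad_graph G <= 1.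
Proof. by rewrite /bad_graph; case: (~~ _); rewrite ?lexx ler01. Qed.

Lemma sum_subsets (y : R) : \sum_(S : {set V}) y ^+ #|S| = (1 + y) ^+ #|V|.
Proof.
rewrite addrC; transitivity (\prod_(v : V) (y + 1)); last by rewrite prodr_const.
rewrite bigA_distr; apply: eq_big => // S _.
by rewrite -big_mkcond prodr_const.
Qed.

Lemma exprDn_le (y : R) k : 0 <= y -> 2 * k%:R * y <= 1 -> (1 + y) ^+ k <= 1 + 2 * k%:R * y.
Proof.
move=> y0; elim: k => [|k IH] ky; first by rewrite expr0 mulr0 mul0r addr0.
rewrite -natr1 in ky *.
have k0 : 0 <= k%:R * y by rewrite mulr_ge0.
have {}IH := IH _; rewrite exprSr.
apply: (@le_trans _ _ ((1 + 2 * k%:R * y) * (1 + y))).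
  by rewrite ler_wpM2r ?IH//; lra.
have : k%:R * y * y <= 2^-1 * y by rewrite ler_wpM2r//; lra.
lra.
Qed.

(** A union bound written with indicators. The empty set is left out, as its Chernoff bound would be
    1. *)
Lemma bad_graph_le (d : R) H : 0 < d ->
  bad_graph H <= \sum_(v : V) (4 * d < #|H :&: edge_cut [set v]%SET|%:R)%R%:R +
    \sum_(S : {set V} | (S != finset.set0) && (2 * #|S| <= #|V|)%N)
      (#|H :&: edge_cut S|%:R < d / 96 * #|S|%:R)%R%:R.
Proof.
move=> d0.
have s10 : 0 <= \sum_(v : V) ((4 * d < #|H :&: edge_cut [set v]%SET|%:R)%R%:R : R) by apply: sumr_ge0.
have s20 : 0 <= \sum_(S : {set V} | (S != finset.set0) && (2 * #|S| <= #|V|)%N)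
      ((#|H :&: edge_cut S|%:R < d / 96 * #|S|%:R)%R%:R : R) by apply: sumr_ge0.
rewrite /bad_graph; case: asboolP => [_|nc] /=; first by rewrite addr_ge0.
have [/existsP[v hv]|no1] := boolP [exists v, 4 * d < #|H :&: edge_cut [set v]%SET|%:R].
  by rewrite (bigD1 v)//= hv -addrA lerDl addr_ge0// sumr_ge0.
have [/existsP[S /andP[/andP[S0 Sn] hS]]|no2] := boolP [exists S : {set V}, ((S != finset.set0) && (2 * #|S| <= #|V|)%N) && (#|H :&: edge_cut S|%:R < d / 96 * #|S|%:R)].
  by rewrite [X in _ + X](bigD1 S) ?S0//= hS addrCA lerDl addr_ge0// sumr_ge0.
exfalso; apply: nc; apply: (expander_contracting d0); split => [v|S Sn].
  by rewrite deg_cut1 leNgt; apply: contra no1 => h; apply/existsP; exists v.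
have [->|S0] := eqVneq S finset.set0; first by rewrite cards0 mulr0.
by rewrite leNgt; apply: contra no2 => h; apply/existsP; exists S; rewrite S0 Sn.
Qed.

Lemma em_step_bad p q G (b : R) : (3 <= #|V|)%N -> 0 <= p <= 1 -> 0 <= q <= 1 ->
  64 * ln n <= n * b -> (forall e, b / 2 <= edge_prob p q G e <= 3 / 2 * b) ->
  \sum_H em_step p q G H * bad_graph H <= (n ^+ 10)^-1.
Proof.
move=> n3 p01 q01 hd hb; set d := n * b in hd.
have n3' : 3 <= n by rewrite /n ler_nat.
have n0 : 0 < n by lra.
have ln0 : 0 < ln n by rewrite ln_gt0//; lra.
have d0 : 0 < d by lra.
have b0 : 0 < b by move: d0; rewrite pmulr_rgt0.
(* The failure probability allowed per vertex of [S]: degrees and cuts contribute [n y] and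
   [(1 + y)^n - 1 <= 2 n y], together at most [3 / n^11], and [3 <= n]. *)
set y : R := (n ^+ 12)^-1.
have y0 : 0 < y by rewrite invr_gt0 exprn_gt0.
have expy j (x : R) : x <= - (12 * j%:R * ln n) -> expR x <= y ^+ j.
  move=> xj; apply: (@le_trans _ _ (expR (- (12%:R * ln n) * j%:R))).
    by rewrite ler_expR; lra.
  by rewrite expRM_natr expRN mulrC expRM_natr lnK.
have P1 v : \sum_H em_step p q G H * (4 * d < #|H :&: edge_cut [set v]%SET|%:R)%R%:R <= y.
  apply: le_trans (chernoff_upper (edge_cut [set v]%SET) (4 * d) p01 q01 (fun e => proj2 (andP (hb e)))) _.
  rewrite -[leRHS]expr1; apply: expy; rewrite card_cut cards1 mul1n.
  have : b * (#|V| - 1)%:R <= d by rewrite /d mulrC ler_wpM2r ?(ltW b0)// /n ler_nat leq_subr.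
  lra.
have P2 S : S != finset.set0 -> (2 * #|S| <= #|V|)%N ->
   \sum_H em_step p q G H * (#|H :&: edge_cut S|%:R < d / 96 * #|S|%:R)%R%:R <= y ^+ #|S|.
  move=> S0 Sn.
  (* At least [n / 2] vertices lie outside [S], so the exponent is at most
     [(3/96 - 7/32) d |S| = - 3/16 d |S|], and [64 ln n <= d] turns this into [- 12 |S| ln n]. *)
  apply: le_trans (chernoff_lower (edge_cut S) (d / 96 * #|S|%:R) p01 q01 _ (fun e => proj1 (andP (hb e)))) _; first lra.
  apply: expy; rewrite card_cut natrM natrB; last by apply: leq_trans Sn; rewrite leq_pmull.
  set s : R := #|S|%:R; rewrite -/n.
  have s0 : 0 <= s by rewrite ler0n.
  have sn : 2 * s <= n by rewrite /s /n -natrM ler_nat.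
  have : b * s * (n / 2) <= b * s * (n - s) by rewrite ler_wpM2l ?mulr_ge0//; lra.
  have : s * (64 * ln n) <= s * d by rewrite ler_wpM2l.
  rewrite /d; lra.
apply: (@le_trans _ _ (\sum_(v : V) y + \sum_(S : {set V} | S != finset.set0) y ^+ #|S|)).
  apply: (@le_trans _ _ (\sum_H em_step p q G H * (\sum_(v : V) (4 * d < #|H :&: edge_cut [set v]%SET|%:R)%R%:R +
    \sum_(S : {set V} | (S != finset.set0) && (2 * #|S| <= #|V|)%N)
      (#|H :&: edge_cut S|%:R < d / 96 * #|S|%:R)%R%:R))).
    by apply: ler_sum => H _; rewrite ler_wpM2l ?em_step_ge0// bad_graph_le.
  under eq_bigr do rewrite mulrDr !mulr_sumr.
  rewrite big_split/= exchange_big/= [X in _ + X]exchange_big/= lerD//.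
    by apply: ler_sum => v _; exact: P1.
  apply: (@le_trans _ _ (\sum_(S : {set V} | (S != finset.set0) && (2 * #|S| <= #|V|)%N) y ^+ #|S|)).
    by apply: ler_sum => S /andP[S0 Sn]; exact: P2.
  rewrite big_mkcondr/=; apply: ler_sum => S _; case: ifP => // _.
  by rewrite exprn_ge0// ltW.
rewrite sumr_const -[X in X + _]mulr_natl -/n.
have ny : n * y = (n ^+ 11)^-1 by rewrite /y; field; rewrite gt_eqF.
have n11 : (n ^+ 11)^-1 <= 3^-1 * (n ^+ 10)^-1.
  by rewrite exprS invfM ler_wpM2r ?invr_ge0 ?exprn_ge0 ?(ltW n0)// lef_pV2 ?posrE.
have n10 : (n ^+ 10)^-1 <= 1 by rewrite invf_le1 ?exprn_gt0// exprn_ege1//; lra.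
have := sum_subsets y; rewrite (bigD1 finset.set0)//= cards0 expr0.
have := @exprDn_le y #|V| (ltW y0); rewrite -/n -mulrA ny => /(_ _) h1 h2.
have := h1 _; rewrite -h2 => {}h1.
have : 2 * (n ^+ 11)^-1 <= 1 by lra.
move=> /h1; lra.
Qed.

Variables (p q : R) (T0 : nat).
Hypothesis n3 : (3 <= #|V|)%N.
Hypothesis p01 : 0 <= p <= 1.
Hypothesis q01 : 0 <= q <= 1.
Hypothesis pq01 : 0 < p + q <= 1.
Hypothesis dense : 64 * ln n <= n * (p / (p + q)).
Hypothesis T0large : 4 * (Num.max 1 (q / p) / (p + q)) <= T0%:R.

Let em : nat -> sgraph V -> sgraph V -> R := fun=> em_step p q.

Lemma run_em_bad t0 t G : (T0 <= t)%N -> run em t0 t bad_graph G <= (n ^+ 10)^-1.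
Proof.
move=> Tt; have /andP[s0 s1] := pq01; have /andP[p0 p1] := p01; have /andP[q0 q1] := q01.
have n3' : 3 <= n by rewrite /n ler_nat.
have ln0 : 0 < ln n by rewrite ln_gt0//; lra.
have hd := dense; have hT := T0large.
set s := p + q in s0 s1 hd hT *; set b := p / s in hd *.
have b0 : 0 < b.
  have : 0 < n * b by lra.
  by rewrite pmulr_rgt0//; lra.
have pp : 0 < p by move: b0; rewrite /b pmulr_lgt0// invr_gt0.
set r := 1 - p - q; set M := Num.max 1 (q / p) in hT.
have M1 : 1 <= M by rewrite le_max lexx.
have Mq : q / p <= M by rewrite le_max lexx orbT.
have r0 : 0 <= r by rewrite /r -addrA -opprD subr_ge0.
have rexp : r <= expR (- s) by apply: le_trans (expR_ge1Dx _); rewrite /r /s; lra.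
(* [r^t <= exp (- s t) <= exp (- 4 M) <= 1 / (4 M)], whereas [b = 1 / (1 + q / p)] and
   [2 (1 + q / p) <= 4 M]. *)
have rt : r ^+ t <= b / 2.
  apply: (@le_trans _ _ (expR (- s) ^+ t)); first by rewrite lerXn2r ?nnegrE ?expR_ge0.
  rewrite -expRM_natr mulNr expRN.
  apply: (@le_trans _ _ (4 * M)^-1).
    rewrite lef_pV2 ?posrE ?expR_gt0//; last lra.
    apply: le_trans (expR_ge1Dx _).
    have : s * (4 * (M / s)) <= s * t%:R.
      by rewrite ler_wpM2l ?(ltW s0)//; apply: le_trans hT _; rewrite ler_nat.
    have -> : s * (4 * (M / s)) = 4 * M by field; rewrite gt_eqF.
    lra.
  have -> : b / 2 = (2 * (1 + q / p))^-1.
    by rewrite /b /s; field; rewrite !gt_eqF//; lra.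
  have qp : 0 <= q / p by rewrite divr_ge0.
  by rewrite lef_pV2 ?posrE; lra.
have rt0 : 0 <= r ^+ t by rewrite exprn_ge0.
have b1 : b <= 1 by rewrite /b ler_pdivrMr// mul1r /s; lra.
have qb : q / s = 1 - b by rewrite /b /s; field; rewrite gt_eqF.
rewrite run_em_step//; apply: (em_step_bad n3 _ _ hd).
- by rewrite -/s -/b -/r; apply/andP; split; nra.
- by rewrite -/s -/r qb; apply/andP; split; nra.
- by move=> e; rewrite /edge_prob -/s -/r -/b qb; case: ifP => _; apply/andP; split; nra.
Qed.

(** Equal to [gap] on good graphs and 0 on bad ones: a contraction rate that is valid on every
    graph. *)
Definition graph_rate (G : sgraph V) : R := gap * (1 - bad_graph G).

Let rho G : R := 1 - graph_rate G / (2 * n).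

Definition damped (s : nat) (G H : sgraph V) : R := em_step p q G H * rho H.

Lemma gap_bounds : 0 < (gap : R) <= 2^-1.
Proof. by rewrite /gap; apply/andP; split; lra. Qed.

Lemma graph_rate01 G : 0 <= graph_rate G <= 1.
Proof.
have /andP[g0 g1] := gap_bounds; have /andP[h0 h1] := bad_graph01 G.
by rewrite /graph_rate; apply/andP; split; nra.
Qed.

Lemma graph_rate_contracting G : contracting (graph_rate G) (@PLM R V G).
Proof.
rewrite /graph_rate /bad_graph; case: asboolP => [h|_] /=; first by rewrite subr0 mulr1.
by rewrite subrr mulr0; apply: contracting0; [exact: PLM_stochastic | exact: PLM_sym].
Qed.

Let n1 : 1 <= n. Proof. by rewrite /n ler1n (leq_trans _ n3). Qed.

Let rho01 G : 0 <= rho G <= 1.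
Proof.
have /andP[g0 g1] := graph_rate01 G; have n1' := n1.
rewrite /rho lerBlDr lerDl subr_ge0; apply/andP; split; last by rewrite divr_ge0//; lra.
by rewrite ler_pdivrMr ?mul1r; lra.
Qed.

Let em0 G H : 0 <= em_step p q G H. Proof. exact: em_step_ge0. Qed.
Let em1 G : \sum_H em_step p q G H = 1. Proof. by have [_ h] := @em_step_stochastic R V p q p01 q01; exact: h. Qed.

Let damped_le s G H : 0 <= damped s G H <= em s G H.
Proof.
have /andP[r0 r1] := rho01 H.
by rewrite /damped mulr_ge0//= /em ler_piMr.
Qed.

Let damped0 s G H : 0 <= damped s G H. Proof. by case/andP: (damped_le s G H). Qed.

Let damped_le1 s G : \sum_H damped s G H <= 1.
Proof.
by rewrite -(em1 G); apply: ler_sum => H _; case/andP: (damped_le s G H).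
Qed.

Lemma run_homogeneous (S : finType) (K : S -> S -> R) t0 t0' t f :
  run (fun=> K) t0 t f =1 run (fun=> K) t0' t f.
Proof.
elim: t t0 t0' => [|t IH] t0 t0' x //=; apply: eq_bigr => y _; congr (_ * _); exact: IH.
Qed.

(** Either all [L] graphs are good and each contributes the small factor, or one is bad and the
    product is bounded by 1. *)
Lemma run_damped_window t0 L G :
  run damped t0 L (fun=> 1) G <=
  (1 - gap / (2 * n)) ^+ L + \sum_(0 <= s < L) run em 0 s.+1 bad_graph G.
Proof.
have n1' := n1; have /andP[g0 g1] := gap_bounds.
set r := 1 - gap / (2 * n).
have gn : gap / (2 * n) <= 1 by rewrite ler_pdivrMr ?mul1r; lra.
have gn0 : 0 <= gap / (2 * n) by rewrite divr_ge0//; lra.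
have r01 : 0 <= r <= 1 by rewrite /r; apply/andP; split; lra.
elim: L t0 G => [|L IH] t0 G; first by rewrite /= big_geq// addr0.
apply: (@le_trans _ _ (\sum_H em_step p q G H * (r ^+ L.+1 + \sum_(0 <= s < L) run em 0 s.+1 bad_graph H + bad_graph H))).
  rewrite [leLHS]/=; apply: ler_sum => H _; rewrite {1}/damped -mulrA ler_wpM2l//.
  set W := run _ _ _ _ _; set Sg := \sum_(_ <= _ < _) _.
  have W1 : W <= 1 by apply: run_le_cst.
  have W0 : 0 <= W by apply: run_ge0.
  have WI : W <= r ^+ L + Sg by exact: IH.
  have Sg0 : 0 <= Sg.
    apply: sumr_ge0 => s _; apply: run_ge0 => [*|K]; first exact: em0.
    by case/andP: (bad_graph01 K).
  have rL : 0 <= r ^+ L by case/andP: r01 => ? _; rewrite exprn_ge0.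
  rewrite exprS /rho /graph_rate /bad_graph; case: (~~ _) => /=.
    by rewrite subrr mulr0 mul0r subr0 mul1r; case/andP: r01 => ? ?; nra.
  by rewrite subr0 mulr1 -/r addr0; case/andP: r01 => ? ?; nra.
under eq_bigr do rewrite !mulrDr.
rewrite !big_split/= -mulr_suml em1 mul1r -addrA lerD2l big_nat_recl// addrC lerD//.
under eq_bigr do rewrite mulr_sumr.
rewrite exchange_big/=; apply: ler_sum => s _.
rewrite le_eqVlt; apply/orP; left; apply/eqP; apply: eq_bigr => H _.
by congr (_ * _); exact: (run_homogeneous (em_step p q) 0 1 s.+1 bad_graph H).
Qed.

(** Giving up the damping of the first [T0] steps lets the edges forget [G]; the bound is then
    uniform in the starting graph, so blocks can be chained. *)
Lemma run_damped_block t0 L G :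
  run damped t0 (T0 + L) (fun=> 1) G <= (1 - gap / (2 * n)) ^+ L + L%:R * (n ^+ 10)^-1.
Proof.
set c := (1 - gap / (2 * n)) ^+ L.
have n1' := n1; have /andP[g0 g1] := gap_bounds.
have gn : gap / (2 * n) <= 1 by rewrite ler_pdivrMr ?mul1r; lra.
have c0 : 0 <= c by rewrite exprn_ge0//; lra.
rewrite run_add.
apply: (@le_trans _ _ (run em t0 T0 (fun H => c + \sum_(0 <= s < L) run em (t0 + T0) s.+1 bad_graph H) G)).
  apply: run_le => // H; rewrite run_ge0//= (le_trans (run_damped_window _ _ _))//.
  rewrite lerD2l; apply: ler_sum => s _; rewrite le_eqVlt; apply/orP; left; apply/eqP.
  exact: run_homogeneous.
rewrite run_plus run_sum.
apply: lerD.
  by apply: run_le_cst => // s H; rewrite /em em1.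
apply: (@le_trans _ _ (\sum_(0 <= s < L) (n ^+ 10)^-1)).
  by apply: ler_sum => s _; rewrite -(run_add em t0 T0 s.+1 bad_graph G) run_em_bad// leq_addr.
by rewrite sumr_const_nat subn0 -[leLHS]mulr_natl.
Qed.

(** Let [T] be the sum and [B = T0 + L]. One block multiplies the mean by at most [phi], hence
    [T <= phi (B + T)], and [phi <= 1/2] gives [T <= 2 phi B]. *)
Lemma run_damped_tail L N G (phi : R) :
  (1 - gap / (2 * n)) ^+ L + L%:R * (n ^+ 10)^-1 <= phi -> phi <= 2^-1 ->
  \sum_(T0 + L <= t < T0 + L + N) run damped 0 t (fun=> 1) G <= 2 * phi * (T0 + L)%:R.
Proof.
move=> hphi phi2; set B := (T0 + L)%N.
have n1' := n1; have /andP[g0 g1] := gap_bounds.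
have gn : gap / (2 * n) <= 1 by rewrite ler_pdivrMr ?mul1r; lra.
have phi0 : 0 <= phi.
  apply: le_trans hphi; rewrite addr_ge0 ?exprn_ge0 ?mulr_ge0 ?invr_ge0 ?exprn_ge0//; lra.
pose W t := run damped 0 t (fun=> 1) G.
have W0 t : 0 <= W t by exact: run_ge0.
have W1 t : W t <= 1 by exact: run_le_cst.
have step t : W (t + B)%N <= phi * W t.
  rewrite /W run_add -run_scale; apply: run_le => [s H K|H]; first by rewrite damped0 lexx.
  by rewrite run_ge0// mulr1 (le_trans (run_damped_block _ _ _) hphi).
rewrite -[leLHS]/(\sum_(B <= t < B + N) W t).
rewrite -{1}[B]add0n big_addn addKn.
set T := \sum_(0 <= i < N) W (i + B)%N.
have h1 : T <= phi * \sum_(0 <= i < N) W i.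
  by rewrite mulr_sumr; apply: ler_sum => i _; exact: step.
have h2 : \sum_(0 <= i < N) W i <= B%:R + T.
  apply: (@le_trans _ _ (\sum_(0 <= i < B + N) W i)).
    by rewrite [leRHS](big_cat_nat (n := N))//= ?leq_addl// lerDl sumr_ge0.
  rewrite (big_cat_nat (n := B))//= ?leq_addr// -{2}[B]add0n big_addn addKn lerD2r.
  apply: (@le_trans _ _ (\sum_(0 <= i < B) 1)); first by apply: ler_sum.
  by rewrite sumr_const_nat subn0.
have B0 : 0 <= B%:R :> R by rewrite ler0n.
have T1 : T <= phi * B%:R + phi * T.
  by rewrite -mulrDr; apply: le_trans h1 _; rewrite ler_wpM2l.
have T0' : 0 <= T by apply: sumr_ge0.
have : phi * T <= 2^-1 * T by rewrite ler_wpM2r.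
lra.
Qed.

End RareBadGraphs.

(** * Expected times for a fixed sequence of kernels *)

Section ScalarBounds.
Context {R : realType}.

Lemma one_sub_exp_le (x : R) k : 0 <= x -> k%:R * x <= 1 -> (1 - x) ^+ k <= 1 - k%:R * x / 2.
Proof.
move=> x0; elim: k => [|k IH] kx; first by rewrite expr0 !mul0r subr0.
rewrite -natr1 in kx *.
have k0 : 0 <= k%:R * x by rewrite mulr_ge0.
have x1 : x <= 1 by lra.
have {}IH : (1 - x) ^+ k <= 1 - k%:R * x / 2 by apply: IH; lra.
rewrite exprS; apply: (@le_trans _ _ ((1 - x) * (1 - k%:R * x / 2))).
  by rewrite ler_wpM2l//; lra.
have : k%:R * x * x <= 1 * x by rewrite ler_wpM2r//; lra.
lra.
Qed.

Lemma geometric_sum_le (x : R) M : 0 <= x -> x < 1 -> \sum_(0 <= s < M) x ^+ s <= (1 - x)^-1.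
Proof.
move=> x0 x1; rewrite -[leRHS]mul1r ler_pdivlMr ?subr_gt0//.
have -> : (\sum_(0 <= s < M) x ^+ s) * (1 - x) = 1 - x ^+ M.
  elim: M => [|M IH]; first by rewrite big_geq// mul0r expr0 subrr.
  by rewrite big_nat_recr//= mulrDl IH exprS; ring.
by rewrite gerBl exprn_ge0.
Qed.

(** The trivial bound 1 before [a], [v] from [a] on, [w] from [b] on. The term [v] is not cut off at
    [b], so its sum does not involve the length of the window. *)
Definition piecewise (a b : nat) (v w : nat -> R) (t : nat) : R :=
  (t < a)%N%:R + (a <= t)%N%:R * v (t - a)%N + (b <= t)%N%:R * w t.

Lemma piecewise_sum_le (a b : nat) (v w : nat -> R) (A B : R) N :
  (forall s, 0 <= v s) -> (forall s, 0 <= w s) ->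
  (forall M, \sum_(0 <= s < M) v s <= A) ->
  (forall M, \sum_(b <= t < b + M) w t <= B) ->
  \sum_(0 <= t < N) piecewise a b v w t <= a%:R + A + B.
Proof.
move=> v0 w0 vA wB; rewrite /piecewise !big_split/=; apply: lerD; first apply: lerD.
- rewrite -natr_sum ler_nat; elim: N => [|N IH]; first by rewrite big_geq.
  rewrite big_nat_recr//=; case: (ltnP N a) => Na; last by rewrite addn0.
  rewrite addn1; apply: leq_ltn_trans Na; apply: (@leq_trans (\sum_(0 <= t < N) 1)%N).
    by apply: leq_sum => i _; case: (i < a)%N.
  by rewrite sum_nat_const_nat subn0 muln1.
- apply: (@le_trans _ _ (\sum_(0 <= t < a + N) (a <= t)%N%:R * v (t - a)%N)).
    rewrite [leRHS](big_cat_nat (n := N))//= ?leq_addl// lerDl.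
    by apply: sumr_ge0 => i _; rewrite mulr_ge0.
  rewrite (big_cat_nat (n := a))//= ?leq_addr// big_nat_cond big1 ?add0r => [|i /andP[/andP[_ ia] _]]; last first.
    by rewrite leqNgt ia mul0r.
  rewrite -{1}[a]add0n big_addn addKn; apply: le_trans (vA N).
  by apply: ler_sum => i _; rewrite leq_addl mul1r addnK.
- apply: (@le_trans _ _ (\sum_(0 <= t < b + N) (b <= t)%N%:R * w t)).
    rewrite [leRHS](big_cat_nat (n := N))//= ?leq_addl// lerDl.
    by apply: sumr_ge0 => i _; rewrite mulr_ge0.
  rewrite (big_cat_nat (n := b))//= ?leq_addr// big_nat_cond big1 ?add0r => [|i /andP[/andP[_ ia] _]]; last first.
    by rewrite leqNgt ia mul0r.
  apply: le_trans (wB N).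
  by apply: ler_sum => i _; rewrite ler_piMl//; case: (b <= i)%N.
Qed.

Lemma le_piecewise (a b : nat) (v w : nat -> R) (x : R) t :
  (forall s, 0 <= v s) -> (forall s, 0 <= w s) -> x <= 1 ->
  ((a <= t < b)%N -> x <= v (t - a)%N) -> ((b <= t)%N -> x <= w t) -> x <= piecewise a b v w t.
Proof.
move=> v0 w0 x1 hv hw; rewrite /piecewise.
have := v0 (t - a)%N; have := w0 t.
case: (ltnP t a) => ta; case: (leqP b t) => bt /=; rewrite ?mul0r ?mul1r ?addr0 ?add0r => w0' v0'.
- lra.
- lra.
- have := hw bt; lra.
- by apply: hv; rewrite ta bt.
Qed.

End ScalarBounds.

Section Quenched.
Context {R : realType} {V : finType}.
Variables (Ps : nat -> V -> V -> R) (l : nat -> R) (lam : R) (T0 L L1 : nat).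
Let n : R := #|V|%:R.
Hypothesis n1 : (1 < #|V|)%N.
Hypothesis Pst : forall t, stochastic (Ps t).
Hypothesis Psym : forall t, sym_kernel (Ps t).
Hypothesis l01 : forall t, 0 <= l t <= 1.
Hypothesis Pl : forall t, contracting (l t) (Ps t).
Hypothesis lam01 : 0 < lam <= 1.
Hypothesis window : forall s, (T0 < s <= T0 + L)%N -> l s = lam.
Hypothesis mixing : (1 - lam) ^+ L1 * n ^+ 3 <= 1.
Hypothesis tail : forall N,
  \sum_(T0 + L <= t < T0 + L + N) n ^+ 2 * rate V l 0 t <= T0%:R + 1.

Let V0 : (0 < #|V|)%N. Proof. exact: ltnW. Qed.
Let n2 : 2 <= n. Proof. by rewrite /n ler_nat. Qed.

Let rho : R := 1 - lam / (2 * n).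

Let rho01 : 0 <= rho <= 1.
Proof.
have /andP[g0 g1] := lam01; have n2' := n2.
rewrite /rho lerBlDr lerDl subr_ge0; apply/andP; split; last by rewrite divr_ge0//; lra.
by rewrite ler_pdivrMr ?mul1r; lra.
Qed.

Let rate0 t : 0 <= rate V l 0 t.
Proof. exact: rate_ge0. Qed.

Section Target.
Variable Q : nat -> V -> V -> R.
Hypothesis Qst : forall t, stochastic (Q t).

Let A0 s u v : 0 <= avoid_kernel Ps Q s u v.
Proof. exact: avoid_kernel_ge0. Qed.

Let A1 s u : \sum_v avoid_kernel Ps Q s u v <= 1.
Proof.
rewrite -((pair_kernel_stochastic Pst Qst s).2 u); apply: ler_sum => v _.
by case/andP: (avoid_le_pair Pst Qst s u v).
Qed.

Lemma avoid_le1 t0 t u : run (avoid_kernel Ps Q) t0 t (fun=> 1) u <= 1.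
Proof. by apply: run_le_cst. Qed.

(** The starting time [a] is free because hitting starts from [T0] and coalescence from [T0 + n]. *)
Lemma avoid_window a s u : (T0 <= a)%N -> (a + L1 + s <= T0 + L)%N ->
  run (avoid_kernel Ps Q) a (L1 + s) (fun=> 1) u <= (1 + n^-1) * rho ^+ s.
Proof.
move=> Ta aL; have /andP[g0 g1] := lam01.
have := @avoid_after_mixing _ _ Ps Q l V0 Pst Psym Qst l01 Pl a L1 s lam u _ _ mixing.
rewrite (ltW g0) g1 => /(_ isT) h.
apply: le_trans (h _) _.
  move=> j /andP[aj ja]; apply: window; rewrite (leq_ltn_trans Ta)//=.
  by rewrite (leq_trans ja)// (leq_trans _ aL)// leq_addr.
rewrite ler_wpM2l ?addr_ge0 ?invr_ge0 ?ler0n// /rate.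
rewrite (eq_big_nat _ _ (F2 := fun=> rho)) => [|j /andP[j1 j2]]; last first.
  rewrite window// (leq_trans _ (leq_trans j2 aL))// andbT ltnS.
  by rewrite (leq_trans Ta)// (leq_trans _ j1)// leq_addr.
by rewrite prodr_const_nat addKn.
Qed.

Lemma avoid_first_window s u : (T0 + L1 + s <= T0 + L)%N ->
  run (avoid_kernel Ps Q) 0 (T0 + L1 + s) (fun=> 1) u <= (1 + n^-1) * rho ^+ s.
Proof.
move=> sL; rewrite -addnA run_add add0n; apply: run_le_cst => //; last first.
  by move=> v; apply: avoid_window.
by rewrite mulr_ge0 ?addr_ge0 ?invr_ge0 ?ler0n// exprn_ge0//; case/andP: rho01.
Qed.

Lemma avoid_tail t u : run (avoid_kernel Ps Q) 0 t (fun=> 1) u <= n * rate V l 0 t.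
Proof. exact: avoid_le_rate. Qed.

End Target.

Section ManyWalkers.
Variable k : nat.
Hypothesis k0 : (0 < k)%N.
Let k' := minn k #|V|.

Let unvisited w t (x : {ffun 'I_k -> V}) : R :=
  run (fun s x y => @indep_step R V k (Ps s) x y * \prod_i (y i != w)%:R) 0 t (fun=> 1) x.

Let walk_window w t v : (T0 + L1 <= t < T0 + L)%N ->
  run (avoid_kernel Ps stay) 0 t (fun=> 1) (v, w) <= (1 + n^-1) * rho ^+ (t - (T0 + L1)).
Proof.
move=> /andP[t1 t2]; rewrite -{1}(subnKC t1); apply: avoid_first_window; first exact: stay_stochastic.
by rewrite subnKC// ltnW.
Qed.

Let walk_ge0 w t v : 0 <= run (avoid_kernel Ps stay) 0 t (fun=> 1) (v, w).
Proof. by apply: run_ge0 => // *; apply: avoid_kernel_ge0 => // s; exact: stay_stochastic. Qed.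

(** The constant 3 bounds [(1 + 1/n)^k' <= e], thanks to [k' <= n]. *)
Lemma unvisited_window w t x : (T0 + L1 <= t < T0 + L)%N ->
  unvisited w t x <= 3 * (rho ^+ k') ^+ (t - (T0 + L1)).
Proof.
move=> tw; rewrite /unvisited run_unvisited; set s := (t - _)%N.
have /andP[r0 r1] := rho01; have n2' := n2.
have ni : 0 <= n^-1 by rewrite invr_ge0; lra.
(* Truncation at 1 allows the exponent [k] to be lowered to [k']. *)
pose m := Num.min 1 ((1 + n^-1) * rho ^+ s).
have m0 : 0 <= m by rewrite le_min ler01/= mulr_ge0 ?exprn_ge0//; lra.
apply: (@le_trans _ _ (m ^+ k)).
  rewrite -[leRHS](_ : \prod_(i < k) m = _); last by rewrite prodr_const card_ord.
  apply: ler_prod => i _; rewrite walk_ge0/= le_min walk_window// andbT.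
  by apply: avoid_le1 => j; exact: stay_stochastic.
apply: (@le_trans _ _ (m ^+ k')).
  by apply: ler_wiXn2l => //; [rewrite ge_min lexx | exact: geq_minl].
apply: (@le_trans _ _ (((1 + n^-1) * rho ^+ s) ^+ k')).
  by rewrite lerXn2r ?nnegrE ?mulr_ge0 ?exprn_ge0//; [lra | rewrite ge_min lexx orbT].
rewrite exprMn -!exprM [(s * _)%N]mulnC ler_wpM2r ?exprn_ge0//.
apply: (@le_trans _ _ (expR n^-1 ^+ k')).
  by rewrite lerXn2r ?nnegrE ?expR_ge0 ?expR_ge1Dx//; lra.
rewrite -expRM_natr; apply: le_trans expR1_le3; rewrite ler_expR mulrC ler_pdivrMr; last lra.
by rewrite mul1r /n ler_nat geq_minr.
Qed.

Lemma unvisited_tail w t x : unvisited w t x <= n * rate V l 0 t.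
Proof.
rewrite /unvisited run_unvisited.
rewrite (bigD1 (Ordinal k0))//= -[leRHS]mulr1; apply: ler_pM => //; first exact: prodr_ge0.
  by apply: avoid_tail => s; exact: stay_stochastic.
apply: prodr_ile1 => i _; rewrite walk_ge0/=; apply: avoid_le1 => s; exact: stay_stochastic.
Qed.

Let k'0 : (0 < k')%N. Proof. by rewrite leq_min k0. Qed.

Lemma rho_pow_gap : lam * k'%:R / (4 * n) <= 1 - rho ^+ k'.
Proof.
have /andP[g0 g1] := lam01; have n2' := n2.
have kn : k'%:R <= n :> R by rewrite /n ler_nat geq_minr.
have x0 : 0 <= lam / (2 * n) by rewrite divr_ge0//; lra.
have kx : k'%:R * (lam / (2 * n)) <= 1.
  rewrite mulrA ler_pdivrMr ?mul1r; last lra.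
  apply: (@le_trans _ _ (n * 1)); last lra.
  by rewrite ler_pM// ltW.
have := one_sub_exp_le x0 kx; rewrite -/rho.
have -> : lam * k'%:R / (4 * n) = k'%:R * (lam / (2 * n)) / 2 by field; lra.
lra.
Qed.

Lemma rho_pow_lt1 : rho ^+ k' < 1.
Proof.
have /andP[g0 g1] := lam01; have n2' := n2.
have : 0 < lam * k'%:R / (4 * n) by rewrite divr_gt0 ?mulr_gt0 ?ltr0n//; lra.
have := rho_pow_gap; lra.
Qed.

Lemma window_sum_le M : \sum_(0 <= s < M) 3 * (rho ^+ k') ^+ s <= 12 / lam * (n / k'%:R).
Proof.
have /andP[g0 g1] := lam01; have n2' := n2; have /andP[r0 r1] := rho01.
have kk : 0 < k'%:R :> R by rewrite ltr0n.
rewrite -mulr_sumr; apply: (@le_trans _ _ (3 * (1 - rho ^+ k')^-1)).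
  by rewrite ler_wpM2l// geometric_sum_le ?exprn_ge0// rho_pow_lt1.
apply: (@le_trans _ _ (3 * (lam * k'%:R / (4 * n))^-1)).
  rewrite ler_wpM2l// lef_pV2 ?rho_pow_gap// posrE ?subr_gt0 ?rho_pow_lt1//.
  by rewrite divr_gt0 ?mulr_gt0//; lra.
rewrite le_eqVlt; apply/orP; left; apply/eqP; field.
by rewrite !gt_eqF//; lra.
Qed.

Let K t := @indep_step R V k (Ps t).
Let Kst t : stochastic (K t). Proof. exact: indep_step_stochastic. Qed.

Let miss w t : set (nat -> {ffun 'I_k -> V}) :=
  [set X | forall s, (s <= t)%N -> ~ exists i j, (j <= s)%N /\ X j i = w].

Let depends_miss w t : depends_upto t (miss w t).
Proof.
move=> X Y XY; rewrite /miss /=; apply/propext; split => h s st [i [j [js Xw]]];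
  apply: (h s st); exists i, j; split => //; rewrite -Xw ?XY//; exact: leq_trans st.
Qed.

Let miss_prod w t X : miss w t X ->
  \prod_(1 <= s < t.+1) (\prod_i (X s i != w)%:R : R) = 1.
Proof.
move=> h; rewrite big_nat_cond big1// => s /andP[/andP[_ st] _].
rewrite big1// => i _; case: eqP => // Xw; exfalso; apply: (h t (leqnn _)).
by exists i, s.
Qed.

Let tail_w t : 0 <= n ^+ 2 * rate V l 0 t.
Proof. by rewrite mulr_ge0 ?exprn_ge0// ler0n. Qed.

Let window_ge0 s : 0 <= 3 * (rho ^+ k') ^+ s.
Proof. by have /andP[r0 r1] := rho01; rewrite mulr_ge0// !exprn_ge0. Qed.

Let n_le_n2 : n <= n ^+ 2.
Proof. by have n2' := n2; rewrite expr2 ler_peMl//; lra. Qed.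

Lemma t_hit_quenched :
  (t_hit k Ps <= ((T0 + L1)%:R + 12 / lam * (n / k'%:R) + (T0%:R + 1))%:E)%E.
Proof.
apply: bigmax_le => [|x _]; first exact: leNye.
apply: bigmax_le => [|w _]; first exact: leNye.
pose u := piecewise (T0 + L1) (T0 + L) (fun s => 3 * (rho ^+ k') ^+ s) (fun t => n ^+ 2 * rate V l 0 t).
apply: (@le_integral_first_time _ _ _ _ _ u).
- by move=> t; apply: (@depends_upto_measurable _ _ t); exact: depends_miss.
- move=> t; apply: (@le_trans _ _ (unvisited w t x)%:E).
    (* Only the times 1 to [t] carry weights: a walker that starts on [w] is not killed at time 0,
       which can only enlarge the bound. *)
    apply: (le_trans (@law_le_weighted_run R _ x K Kst 'I_1 (miss w t) t
       (fun _ _ y => \prod_i (y i != w)%:R) (@depends_miss w t) _ _)).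
    - by move=> _ s y; apply: prodr_ge0.
    - by move=> X h; rewrite big_ord1 miss_prod.
    - by rewrite big_ord1.
  rewrite lee_fin; apply: le_piecewise => //.
  + rewrite /unvisited run_unvisited; apply: prodr_ile1 => i _; rewrite walk_ge0/=.
    by apply: avoid_le1 => s; exact: stay_stochastic.
  + by move=> tw; exact: unvisited_window.
  + move=> _; apply: le_trans (unvisited_tail _ _ _) _.
    by rewrite ler_wpM2r.
- by move=> N; apply: piecewise_sum_le => // M; exact: window_sum_le.
Qed.

(** The [S0] extra steps pay for the union bound over the [n] targets. *)
Lemma t_cov_quenched (S0 : nat) : n * (rho ^+ k') ^+ S0 <= 1 ->
  (t_cov k Ps <= ((T0 + L1 + S0)%:R + 12 / lam * (n / k'%:R) + (T0%:R + 1))%:E)%E.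
Proof.
move=> hS0.
apply: bigmax_le => [|x _]; first exact: leNye.
pose u := piecewise (T0 + L1 + S0) (T0 + L) (fun s => 3 * (rho ^+ k') ^+ s) (fun t => n ^+ 2 * rate V l 0 t).
pose B t : set (nat -> {ffun 'I_k -> V}) :=
  [set X | forall s, (s <= t)%N -> ~ forall v, exists i j, (j <= s)%N /\ X j i = v].
have dB t : depends_upto t (B t).
  move=> X Y XY; rewrite /B /=; apply/propext; split => h s st g; apply: (h s st) => v;
  have [i [j [js Xv]]] := g v; exists i, j; split => //; rewrite -Xv ?XY//; exact: leq_trans st.
apply: (@le_integral_first_time _ _ _ _ _ u).
- by move=> t; apply: (@depends_upto_measurable _ _ t); exact: dB.
- move=> t.
  have st1 : (chain_law K x (B t) <= 1)%E by exact: probability_le1 (depends_upto_measurable (dB t)).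
  have st2 : (chain_law K x (B t) <= (\sum_w unvisited w t x)%:E)%E.
    apply: (@law_le_weighted_run R _ x K Kst V (B t) t (fun w _ y => \prod_i (y i != w)%:R) (dB t)).
      by move=> w s y; apply: prodr_ge0.
    move=> X /(_ t (leqnn _)) /existsNP[w hw].
    have mw : miss w t X.
      by move=> s st [i [j [js Xw]]]; apply: hw; exists i, j; split => //; exact: leq_trans st.
    by rewrite (bigD1 w)//= miss_prod// lerDl sumr_ge0// => v _; do 2 apply: prodr_ge0 => *.
  set x0 := chain_law _ _ _ in st1 st2.
  have x0E : x0 = (fine x0)%:E.
    by rewrite fineK// ge0_fin_numE ?measure_ge0// (le_lt_trans st1)// ltry.
  rewrite -[X in (X <= _)%E]/x0 x0E lee_fin; rewrite x0E !lee_fin in st1 st2.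
  apply: le_piecewise => //.
  + move=> /andP[t1 t2]; apply: (le_trans st2).
    apply: (@le_trans _ _ (\sum_(w : V) 3 * (rho ^+ k') ^+ (t - (T0 + L1)))).
      apply: ler_sum => w _; apply: unvisited_window; rewrite t2 (leq_trans _ t1)//; exact: leq_addr.
    rewrite sumr_const -[leLHS]mulr_natl -/n.
    have -> : (t - (T0 + L1) = S0 + (t - (T0 + L1 + S0)))%N.
      by rewrite [in RHS]subnDA subnKC// leq_subRL ?(leq_trans _ t1)// leq_addr.
    move: (_ - _)%N => s; rewrite exprD.
    have -> : n * (3 * ((rho ^+ k') ^+ S0 * (rho ^+ k') ^+ s)) =
        n * (rho ^+ k') ^+ S0 * (3 * (rho ^+ k') ^+ s) by ring.
    by rewrite ler_piMl.
  + move=> _; apply: (le_trans st2).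
    (* The factor [n^2] of the tail hypothesis: one [n] from the norm bound, one from the union over
       targets. *)
    apply: (@le_trans _ _ (\sum_(w : V) n * rate V l 0 t)).
      by apply: ler_sum => w _; exact: unvisited_tail.
    by rewrite sumr_const -[leLHS]mulr_natl -/n expr2 mulrA.
- by move=> N; apply: piecewise_sum_le => // M; exact: window_sum_le.
Qed.

End ManyWalkers.

Section Coalescing.
Let m := #|V|.
Let K t := @coal_step R V m (Ps t).
Let Kst t : stochastic (K t). Proof. exact: coal_step_stochastic. Qed.
Let i0 : 'I_m := Ordinal V0.

Let occ_n (x : {ffun 'I_m -> V}) : occupancy x <= n.
Proof. by rewrite /occupancy /n ler_nat max_card. Qed.

Let not_merged01 (x : {ffun 'I_m -> V}) : 0 <= (not_merged x : R) <= 1.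
Proof. by rewrite /not_merged; case: (~~ _); rewrite ?lexx ler01. Qed.

Let K0 t x y : 0 <= K t x y. Proof. exact: (Kst t).1. Qed.
Let K1 t x : \sum_y K t x y <= 1. Proof. by rewrite (Kst t).2. Qed.

Let C1 : R := 48 / lam + 2.

Let n_le_n2 : n <= n ^+ 2.
Proof. by have n2' := n2; rewrite expr2 ler_peMl//; lra. Qed.

(** After time [T0], [n] steps leave at most [C1] occupied vertices on average: [2 n] times
    [cluster_theta] at time [n] is at most [48 / lam], and the linear term adds 2. Then come [L1]
    steps of mixing, and the pairs avoid each other for the remaining [s]. *)
Lemma not_merged_window t x : (T0 + m + L1 <= t < T0 + L)%N ->
  run K 0 t not_merged x <= 2 * C1 * rho ^+ (t - (T0 + m + L1)).
Proof.
move=> /andP[t1 t2]; set s := (t - _)%N.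
have /andP[g0 g1] := lam01; have n2' := n2; have /andP[r0 r1] := rho01.
have tE : t = (T0 + (m + (L1 + s)))%N by rewrite /s !addnA subnKC.
have M0 : 0 <= (1 + n^-1) * rho ^+ s.
  by rewrite mulr_ge0 ?exprn_ge0// addr_ge0// invr_ge0; lra.
rewrite tE run_add add0n; apply: run_le_cst => //.
  by rewrite mulr_ge0 ?exprn_ge0// mulr_ge0// /C1 addr_ge0// divr_ge0// ltW.
move=> y; rewrite run_add.
apply: (@le_trans _ _ (run K T0 m (fun z => ((1 + n^-1) * rho ^+ s) * occupancy z) y)).
  apply: run_le => [*|z]; first by rewrite K0 lexx.
  rewrite run_ge0//=.
  rewrite mulrC; apply: run_not_merged_le => // u.
  by apply: avoid_window => //; rewrite ?leq_addr// -!addnA -tE ltnW.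
rewrite run_scale.
have h := @run_occupancy_le _ _ V0 Ps lam Pst Psym g0 m T0 m y.
have {}h : run K T0 m occupancy y <= C1.
  apply: le_trans (h _) _.
    move=> j /andP[j1 j2]; rewrite -(window (s := j)); first exact: Pl.
    rewrite j1 (leq_trans j2)// (leq_trans _ (ltnW t2))// tE addnA leq_addr//.
  rewrite /cluster_theta /C1 -/m -/n mulrDr.
  have -> : n * (2 / n) = 2 by field; lra.
  rewrite lerD2r mulrCA mulrA.
  have lm : 0 < lam * n by rewrite mulr_gt0//; lra.
  rewrite mulrA ler_pdivrMr; last by rewrite -/n; lra.
  have -> : 48 / lam * (4 + lam / 12 * n) = 192 / lam + 4 * n by field; lra.
  have : 0 <= 192 / lam by rewrite divr_ge0// ltW.
  lra.
have n12 : 1 + n^-1 <= 2.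
  have : n^-1 <= 1 by rewrite invf_le1; lra.
  lra.
apply: (@le_trans _ _ ((1 + n^-1) * rho ^+ s * C1)); first by rewrite ler_wpM2l.
rewrite mulrAC ler_wpM2r ?exprn_ge0// ler_wpM2r// /C1 addr_ge0// divr_ge0// ltW//.
Qed.

Lemma not_merged_tail t x : run K 0 t not_merged x <= n ^+ 2 * rate V l 0 t.
Proof.
have h := @run_not_merged_le _ _ Ps Pst m 0 t x i0 (n * rate V l 0 t).
apply: le_trans (h _) _; first by move=> u; exact: avoid_tail.
rewrite expr2 -mulrA ler_wpM2r// mulr_ge0// ler0n.
Qed.

Lemma t_coal_quenched :
  (t_coal Ps <= ((T0 + m + L1)%:R + 4 * C1 / lam * n + (T0%:R + 1))%:E)%E.
Proof.
apply: bigmax_le => [|x _]; first exact: leNye.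
have /andP[g0 g1] := lam01; have n2' := n2; have /andP[r0 r1] := rho01.
have C10 : 0 <= C1 by rewrite /C1 addr_ge0// divr_ge0// ltW.
pose u := piecewise (T0 + m + L1) (T0 + L) (fun s => 2 * C1 * rho ^+ s) (fun t => n ^+ 2 * rate V l 0 t).
pose B t : set (nat -> {ffun 'I_m -> V}) :=
  [set X | forall s, (s <= t)%N -> ~ forall i j, X s i = X s j].
have dB t : depends_upto t (B t).
  by move=> X Y XY; rewrite /B /=; apply/propext; split => h s st g; apply: (h s st) => i j;
    have := g i j; rewrite XY.
have w0 t : 0 <= n ^+ 2 * rate V l 0 t by rewrite mulr_ge0 ?exprn_ge0// ler0n.
have v0 s : 0 <= 2 * C1 * rho ^+ s by rewrite mulr_ge0 ?exprn_ge0// mulr_ge0.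
apply: (@le_integral_first_time _ _ _ _ _ u).
- by move=> t; apply: (@depends_upto_measurable _ _ t); exact: dB.
- move=> t; apply: (@le_trans _ _ (run K 0 t not_merged x)%:E).
    apply: (@law_le_run R _ x K Kst (B t) t not_merged (dB t)).
      by move=> y; case/andP: (not_merged01 y).
    move=> X /(_ t (leqnn _)) nm; rewrite /not_merged; case: forallP => //= h.
    by exfalso; apply: nm => i j; have /forallP/(_ j)/eqP := h i.
  rewrite lee_fin; apply: le_piecewise => //.
  + by apply: run_le_cst => // y; case/andP: (not_merged01 y).
  + by move=> tw; exact: not_merged_window.
  + by move=> _; exact: not_merged_tail.
- move=> N; apply: piecewise_sum_le => // M.
  have rho1 : rho < 1 by rewrite /rho ltrBlDr ltrDl divr_gt0//; lra.
  rewrite -mulr_sumr; apply: (@le_trans _ _ (2 * C1 * (1 - rho)^-1)).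
    by rewrite ler_wpM2l ?mulr_ge0// geometric_sum_le.
  rewrite /rho opprB addrCA subrr addr0.
  by rewrite le_eqVlt; apply/orP; left; apply/eqP; field; rewrite !gt_eqF//; lra.
Qed.

End Coalescing.

End Quenched.

(** * Probability of a good graph sequence *)

Section SeriesMarkov.
Context {R : realType} {d : measure_display} {T : measurableType d}.
Variable mu : {measure set T -> \bar R}.

(** Markov's inequality for a series of nonnegative functions; for indicators it is the union
    bound. *)
Lemma series_ge1_le (z : nat -> T -> R) (e : nat -> R) (c : R) :
  (forall t, measurable_fun setT (z t)) -> (forall t X, 0 <= z t X) ->
  (forall t, \int[mu]_X (z t X)%:E <= (e t)%:E)%E ->
  (forall N, \sum_(0 <= t < N) e t <= c) ->
  (measurable [set X | 1 <= \sum_(0 <= t <oo) (z t X)%:E]%E /\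
   mu [set X | 1 <= \sum_(0 <= t <oo) (z t X)%:E]%E <= c%:E)%E.
Proof.
move=> mz z0 ze ec.
pose Z X : \bar R := (\sum_(0 <= t <oo) (z t X)%:E)%E.
have mze t : measurable_fun setT (fun X => (z t X)%:E) by exact/measurable_EFinP.
have Z0 X : (0 <= Z X)%E by apply: nneseries_ge0 => t _ _; rewrite lee_fin.
have mZ : measurable_fun setT Z.
  by apply: (ge0_emeasurable_sum (P := xpredT)) => // t X _ _; rewrite lee_fin.
have mA : measurable [set X | 1%:E <= Z X]%E.
  rewrite -(setTI [set X | _]); apply: measurable_lee => //; exact: measurable_cst.
split; first exact: mA.
have := @le_integral_comp_abse _ _ _ mu setT measurableT Z 1 id.
move=> /(_ (@measurable_id _ _ _)) h.
have {}h := h (fun r r0 => r0) (fun x y _ _ xy => xy) mZ ltr01.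
rewrite /= mul1e setTI in h.
rewrite (_ : [set X | _] = [set x | (1%:E <= `|Z x|)%E]); last first.
  by apply/seteqP; split => X /=; rewrite gee0_abs.
apply: (le_trans h); under eq_integral do rewrite gee0_abs//.
rewrite integral_nneseries//; last by move=> t X _; rewrite lee_fin.
apply: lime_le; first by apply: is_cvg_nneseries => t _ _; apply: integral_ge0 => X _; rewrite lee_fin.
apply: nearW => N; apply: (@le_trans _ _ (\sum_(0 <= t < N) e t)%:E); last by rewrite lee_fin.
by rewrite -sumEFin; apply: lee_sum => t _; exact: ze.
Qed.

End SeriesMarkov.

Section MeasurableTimes.
Context {R : realType} {V : finType} {G0 : sgraph V}.

Let PG (G : nat -> sgraph V) (t : nat) : V -> V -> R := PLM (G t).

Let depends_PG (S : finType) (F : (V -> V -> R) -> S -> S -> R) t :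
  depends_upto t (fun G => F (PG G t)).
Proof. by move=> G H GH; rewrite /PG GH. Qed.

Lemma measurable_t_hit k :
  measurable_fun setT (fun G : traj_space G0 => t_hit k (fun t => @PLM R V (G t))).
Proof.
apply: measurable_bigmaxe => x; apply: measurable_bigmaxe => w.
apply: (@measurable_integral_first_time R _ _ x G0 (fun G t => @indep_step R V k (PG G t))
   (fun X t => exists i s, (s <= t)%N /\ X s i = w)).
- by move=> G t; apply: indep_step_stochastic; exact: PLM_stochastic.
- by move=> t; exact: (depends_PG (@indep_step R V k)).
- move=> t X Y XY; apply/propext; split => -[i [s [st <-]]]; exists i, s; split => //; by rewrite XY.
Qed.

Lemma measurable_t_cov k :
  measurable_fun setT (fun G : traj_space G0 => t_cov k (fun t => @PLM R V (G t))).
Proof.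
apply: measurable_bigmaxe => x.
apply: (@measurable_integral_first_time R _ _ x G0 (fun G t => @indep_step R V k (PG G t))
   (fun X t => forall v, exists i s, (s <= t)%N /\ X s i = v)).
- by move=> G t; apply: indep_step_stochastic; exact: PLM_stochastic.
- by move=> t; exact: (depends_PG (@indep_step R V k)).
- move=> t X Y XY; apply/propext; split => h v; have [i [s [st <-]]] := h v;
    by exists i, s; split => //; rewrite XY.
Qed.

Lemma measurable_t_coal :
  measurable_fun setT (fun G : traj_space G0 => t_coal (fun t => @PLM R V (G t))).
Proof.
apply: measurable_bigmaxe => x.
apply: (@measurable_integral_first_time R _ _ x G0 (fun G t => @coal_step R V #|V| (PG G t))
   (fun X t => forall i j, X t i = X t j)).
- by move=> G t; apply: coal_step_stochastic; exact: PLM_stochastic.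
- by move=> t; exact: (depends_PG (@coal_step R V #|V|)).
- by move=> t X Y XY; rewrite XY.
Qed.

End MeasurableTimes.

Section GoodEvent.
Context {R : realType} {V : finType}.
Variables (p q : R) (T0 : nat) (G0 : sgraph V).
Let n : R := #|V|%:R.
Hypothesis n5 : (5 <= #|V|)%N.
Hypothesis p01 : 0 <= p <= 1.
Hypothesis q01 : 0 <= q <= 1.
Hypothesis pq01 : 0 < p + q <= 1.
Hypothesis dense : 64 * ln n <= n * (p / (p + q)).
Hypothesis T0large : 4 * (Num.max 1 (q / p) / (p + q)) <= T0%:R.
Let L := (#|V| ^ 2)%N.
Hypothesis small : (1 - gap / (2 * n)) ^+ L <= (n ^+ 8)^-1.

Let n3 : (3 <= #|V|)%N. Proof. exact: leq_trans n5. Qed.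
Let n5' : 5 <= n. Proof. by rewrite /n ler_nat. Qed.
Let B := (T0 + L)%N.
Let mu := edge_markovian p q G0.

Let Kst : forall t : nat, stochastic (em_step p q : sgraph V -> sgraph V -> R).
Proof. by move=> _; exact: em_step_stochastic. Qed.

Let zbad (t : nat) (G : traj_space G0) : R :=
  if (T0 < t <= B)%N then bad_graph (G t) else 0.

(** Normalised so that a series below 1 means a tail of at most [T0 + 1]. *)
Let ztail (t : nat) (G : traj_space G0) : R :=
  if (B <= t)%N then n ^+ 2 / (T0%:R + 1) * rate V (fun s => graph_rate (G s)) 0 t else 0.

Let n0 : 0 < n. Proof. by rewrite /n ltr0n (leq_trans _ n5). Qed.

Let Ln10 : L%:R * (n ^+ 10)^-1 = (n ^+ 8)^-1 :> R.
Proof. by rewrite /L natrX -/n; field; rewrite gt_eqF. Qed.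

Let bad0 (G : sgraph V) : 0 <= bad_graph G :> R.
Proof. by case/andP: (bad_graph01 (R := R) G). Qed.

Lemma window_bad_le :
  (measurable [set G | 1 <= \sum_(0 <= t <oo) (zbad t G)%:E]%E /\
   mu [set G | 1 <= \sum_(0 <= t <oo) (zbad t G)%:E]%E <= ((n ^+ 8)^-1)%:E)%E.
Proof.
apply: (@series_ge1_le _ _ _ _ _ (fun t => if (T0 < t <= B)%N then (n ^+ 10)^-1 else 0)).
- move=> t; apply: (depends_upto_measurable_fun (t := t)) => G H GH.
  by rewrite /zbad GH.
- by move=> t G; rewrite /zbad; case: ifP.
- move=> t; rewrite /zbad; case: ifP => [/andP[Tt _]|_]; last by rewrite integral0.
  rewrite (expectation_run_unweighted Kst)// lee_fin.
  exact: (run_em_bad n3 p01 q01 pq01 dense T0large 0 G0 (ltnW Tt)).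
- move=> N; apply: (@le_trans _ _ (\sum_(0 <= t < B.+1 + N) (if (T0 < t <= B)%N then (n ^+ 10)^-1 else 0))).
    rewrite [leRHS](big_cat_nat (n := N))//= ?leq_addl// lerDl.
    by apply: sumr_ge0 => i _; case: ifP => // _; rewrite invr_ge0 exprn_ge0// ltW.
  rewrite (big_cat_nat (n := T0.+1))//=; last by rewrite addSn ltnS /B -addnA leq_addr.
  rewrite big_nat_cond big1 ?add0r => [|i /andP[/andP[_ ia] _]]; last first.
    by rewrite ltnNge -ltnS ia.
  rewrite (big_cat_nat (n := B.+1))//= ?leq_addr//.
  rewrite [X in _ + X]big_nat_cond [X in _ + X]big1 ?addr0 => [|i /andP[/andP[ia _] _]]; last first.
    by rewrite andbC leqNgt ia.
  apply: (@le_trans _ _ (\sum_(T0.+1 <= i < B.+1) (n ^+ 10)^-1)).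
    by apply: ler_sum => i _; case: ifP => // _; rewrite invr_ge0 exprn_ge0// ltW.
  by rewrite sumr_const_nat subSS /B addKn -[leLHS]mulr_natl Ln10.
Qed.

Let Tp : 0 < T0%:R + 1 :> R.
Proof. by rewrite ltr_wpDl. Qed.

Lemma tail_le :
  (measurable [set G | 1 <= \sum_(0 <= t <oo) (ztail t G)%:E]%E /\
   mu [set G | 1 <= \sum_(0 <= t <oo) (ztail t G)%:E]%E <= (4 * (n ^+ 4)^-1)%:E)%E.
Proof.
pose W t := run (damped p q) 0 t (fun=> 1) G0.
have D0 : forall (s : nat) (G H : sgraph V), 0 <= damped p q s G H.
  move=> s G H; apply: mulr_ge0; first exact: em_step_ge0.
  exact: (rate_factor_ge0 (V := V) (l := fun=> graph_rate H) (ltnW (ltnW (ltnW (ltnW n5)))) (fun=> graph_rate01 H) 0).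
have W0 t : 0 <= W t by apply: run_ge0.
have c0 : 0 <= n ^+ 2 / (T0%:R + 1) by rewrite divr_ge0 ?exprn_ge0 ?(ltW n0)// ltW.
have rl0 G t : 0 <= rate V (fun s => graph_rate (G s)) 0 t.
  by apply: rate_ge0 => [|s]; [exact: ltnW (ltnW (ltnW (ltnW n5))) | exact: graph_rate01].
apply: (@series_ge1_le _ _ _ _ _ (fun t => if (B <= t)%N then n ^+ 2 / (T0%:R + 1) * W t else 0)).
- move=> t; apply: (depends_upto_measurable_fun (t := t)) => G H GH.
  rewrite /ztail; case: (B <= t)%N; [congr (_ * _) | by []].
  by rewrite /rate; apply: eq_big_nat => s /andP[_ st] /=; rewrite GH.
- by move=> t G; rewrite /ztail; case: ifP => // _; rewrite mulr_ge0// rl0.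
- move=> t; rewrite /ztail; case: ifP => _; last by rewrite integral0.
  under eq_integral do rewrite EFinM.
  rewrite ge0_integralZl//; last 2 first.
  + apply/measurable_EFinP; apply: (depends_upto_measurable_fun (t := t)) => G H GH.
    by rewrite /rate; apply: eq_big_nat => s /andP[_ st] /=; rewrite GH.
  + by move=> G _; rewrite lee_fin rl0.
  rewrite [leRHS]EFinM; apply: lee_wpmul2l; first by rewrite lee_fin.
  have := @expectation_run _ _ G0 _ Kst (fun _ G => 1 - graph_rate G / (2 * n)) (fun=> 1) t.
  rewrite -[X in _ -> _ -> _ = X]/((W t)%:E) => <- //.
    by under [in leRHS]eq_integral do rewrite mulr1 big_add1.
  move=> s G; exact: (rate_factor_ge0 (V := V) (l := fun=> graph_rate G) (ltnW (ltnW (ltnW (ltnW n5)))) (fun=> graph_rate01 G) 0).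
- move=> N; apply: (@le_trans _ _ (\sum_(0 <= t < B + N) (if (B <= t)%N then n ^+ 2 / (T0%:R + 1) * W t else 0))).
    rewrite [leRHS](big_cat_nat (n := N))//= ?leq_addl// lerDl.
    by apply: sumr_ge0 => i _; case: ifP => // _; rewrite mulr_ge0.
  rewrite (big_cat_nat (n := B))//= ?leq_addr// big_nat_cond big1 ?add0r => [|i /andP[/andP[_ ia] _]]; last first.
    by rewrite leqNgt ia.
  apply: (@le_trans _ _ (\sum_(B <= i < B + N) n ^+ 2 / (T0%:R + 1) * W i)).
    by apply: ler_sum => i _; case: ifP => // _; rewrite mulr_ge0.
  rewrite -mulr_sumr.
  have n5'' := n5'.
  (* Here [phi = 2 / n^8], half from [small] and half from [L / n^10]. With [B <= n^2 (T0 + 1)] the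
     tail is at most [n^2 * 2 phi * n^2 = 4 / n^4]. *)
  have phi2 : 2 * (n ^+ 8)^-1 <= 2^-1.
    have : (n ^+ 8)^-1 <= (5 ^+ 1)^-1.
      rewrite lef_pV2 ?posrE ?exprn_gt0//; apply: (@le_trans _ _ (n ^+ 1)); first by rewrite !expr1.
      by rewrite ler_weXn2l//; lra.
    lra.
  have h := @run_damped_tail _ _ p q T0 n3 p01 q01 pq01 dense T0large L N G0 (2 * (n ^+ 8)^-1) _ phi2.
  apply: (@le_trans _ _ (n ^+ 2 / (T0%:R + 1) * (2 * (2 * (n ^+ 8)^-1) * B%:R))).
    rewrite ler_wpM2l//; apply: h.
    by have s8 := small; rewrite -/n Ln10 [leRHS]mulr_natl mulr2n lerD2r.
  have BT : B%:R <= n ^+ 2 * (T0%:R + 1).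
    rewrite /B natrD /L natrX -/n mulrDr mulr1 lerD2r.
    rewrite ler_peMl// expr_ge1//; lra.
  apply: (@le_trans _ _ (n ^+ 2 / (T0%:R + 1) * (2 * (2 * (n ^+ 8)^-1) * (n ^+ 2 * (T0%:R + 1))))).
    by rewrite ler_wpM2l// ler_wpM2l// !mulr_ge0// invr_ge0 exprn_ge0// ltW.
  rewrite le_eqVlt; apply/orP; left; apply/eqP; field.
  by rewrite !gt_eqF.
Qed.

Lemma good_graphs_le (A : set (traj_space G0)) : measurable A ->
  (forall G : traj_space G0,
     (forall s, (T0 < s <= T0 + L)%N -> graph_rate (G s) = gap :> R) ->
     (forall N, \sum_(T0 + L <= t < T0 + L + N) n ^+ 2 * rate V (fun s => graph_rate (G s)) 0 t <= T0%:R + 1) ->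
     A G) ->
  ((1 - n^-1)%:E <= mu A)%E.
Proof.
move=> mA hA; have [mb Pb] := window_bad_le; have [mt Pt] := tail_le.
set Ab := [set G | _] in mb Pb; set At := [set G | _] in mt Pt.
have rl0 (G : nat -> sgraph V) t : 0 <= rate V (fun s => graph_rate (G s)) 0 t.
  by apply: rate_ge0 => [|s]; [exact: ltnW (ltnW (ltnW (ltnW n5))) | exact: graph_rate01].
have c0 : 0 <= n ^+ 2 / (T0%:R + 1) by rewrite divr_ge0 ?exprn_ge0 ?(ltW n0)// ltW.
have sub : setT `<=` A `|` (Ab `|` At).
  move=> G _; have [|nb] := pselect (Ab G); first by right; left.
  have [|nt] := pselect (At G); first by right; right.
  left; apply: hA.
    move=> s sw; apply/eqP; rewrite /graph_rate; move: nb; rewrite /Ab /=.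
    rewrite /bad_graph; case: asboolP => [_|nc] nb /=; first by rewrite subr0 mulr1.
    exfalso; apply: nb.
    apply: (@le_trans _ _ (\sum_(0 <= t < s.+1) (zbad t G)%:E)%E); last first.
      by apply: (@nneseries_lim_ge _ _ xpredT) => i _ _; rewrite lee_fin /zbad; case: ifP.
    rewrite sumEFin lee_fin big_nat_recr//= {2}/zbad -/B sw /bad_graph asboolF//=.
    by rewrite lerDr sumr_ge0// => i _; rewrite /zbad; case: ifP.
  move=> N; rewrite leNgt; apply/negP => hN; apply: nt.
  apply: (@le_trans _ _ (\sum_(0 <= t < B + N) (ztail t G)%:E)%E); last first.
    by apply: (@nneseries_lim_ge _ _ xpredT) => i _ _; rewrite lee_fin /ztail; case: ifP => // _; rewrite mulr_ge0// rl0.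
  rewrite sumEFin lee_fin (big_cat_nat (n := B))//= ?leq_addr//.
  apply: (@le_trans _ _ (\sum_(B <= i < B + N) ztail i G)); last first.
    by rewrite lerDr sumr_ge0// => i _; rewrite /ztail; case: ifP => // _; rewrite mulr_ge0// rl0.
  rewrite (eq_big_nat _ _ (F2 := fun t => (T0%:R + 1)^-1 * (n ^+ 2 * rate V (fun s => graph_rate (G s)) 0 t))) => [|i /andP[Bi _]]; last first.
    by rewrite /ztail Bi mulrCA mulrA.
  rewrite -mulr_sumr -ler_pdivrMl ?invr_gt0// invrK mulr1; exact: ltW.
have mAA : measurable (Ab `|` At) by exact: measurableU.
have T1 : (1 <= mu A + mu (Ab `|` At))%E.
  rewrite -(@probability_setT _ _ _ mu); apply: (@le_trans _ _ (mu (A `|` (Ab `|` At)))).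
    by apply: le_measure => //; rewrite inE//; exact: measurableU.
  exact: measureU2.
have T2 : (mu (Ab `|` At) <= ((n ^+ 8)^-1 + 4 * (n ^+ 4)^-1)%:E)%E.
  by apply: (le_trans (measureU2 _ mb mt)); rewrite EFinD; apply: leeD.
(* Both terms together are at most [5 / n^4]; this is where [5 <= n] enters. *)
have num : (n ^+ 8)^-1 + 4 * (n ^+ 4)^-1 <= n^-1.
  have n5'' := n5'.
  have n48 : (n ^+ 8)^-1 <= (n ^+ 4)^-1 by rewrite lef_pV2 ?posrE ?exprn_gt0// ler_weXn2l//; lra.
  have n41 : (n ^+ 4)^-1 <= 5^-1 * n^-1.
    rewrite -invfM lef_pV2 ?posrE ?mulr_gt0 ?exprn_gt0//.
    rewrite (exprSr n 3) ler_wpM2r ?(ltW n0)//.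
    by apply: (@le_trans _ _ (n ^+ 1)); [rewrite expr1 | rewrite ler_weXn2l//; lra].
  lra.
rewrite EFinB leeBlDr//; apply: (le_trans T1); rewrite leeD2l//.
by apply: (le_trans T2); rewrite lee_fin.
Qed.

End GoodEvent.

(** * Choice of the times and of the constant *)

Section Assembly.
Context {R : realType}.

Lemma nat_above (x : R) : 0 <= x -> exists m : nat, x <= m%:R <= x + 1.
Proof.
move=> x0; exists (Num.truncn x).+1.
have /andP[h1 h2] := truncn_itv x0.
by rewrite (ltW h2) -natr1 lerD2r.
Qed.

(* From the ninth Taylor term of [expR (lam m / 2)]. *)
Lemma power_decay (lam : R) : 0 < lam <= 2^-1 -> exists n0 : nat, forall m : nat, (n0 <= m)%N ->
  (1 - lam / (2 * m%:R)) ^+ (m ^ 2) <= (m%:R ^+ 8)^-1.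
Proof.
move=> /andP[l0 l1].
set f : R := 9`!%:R; have f0 : 0 < f by rewrite ltr0n fact_gt0.
have x0 : 0 <= f * (2 / lam) ^+ 9.
  by rewrite mulr_ge0// ?(ltW f0)// exprn_ge0// divr_ge0// ltW.
have [N /andP[hN _]] := nat_above x0.
exists N.+1 => m Nm.
have m1 : 1 <= m%:R :> R by rewrite ler1n (leq_trans _ Nm).
have m0 : 0 < m%:R :> R by lra.
have lm : lam / (2 * m%:R) <= 1 by rewrite ler_pdivrMr; lra.
apply: (@le_trans _ _ (expR (- (lam / (2 * m%:R))) ^+ (m ^ 2))).
  by rewrite lerXn2r ?nnegrE ?expR_ge0 ?expR_ge1Dx//; lra.
rewrite -expRM_natr natrX.
have -> : - (lam / (2 * m%:R)) * m%:R ^+ 2 = - (lam / 2 * m%:R) by field; rewrite gt_eqF.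
rewrite expRN lef_pV2 ?posrE ?expR_gt0 ?exprn_gt0//.
have y0 : 0 <= lam / 2 * m%:R by rewrite mulr_ge0 ?divr_ge0 ?(ltW l0)// ltW.
apply: le_trans (@expR_ge1Dxn R _ 8 y0).
rewrite -/f; move: (f) f0 hN => {f x0} f f0 hN.
apply: (@le_trans _ _ ((lam / 2 * m%:R) ^+ 9 / f)); last by rewrite lerDr.
rewrite ler_pdivlMr// -subr_ge0.
have -> : (lam / 2 * m%:R) ^+ 9 - m%:R ^+ 8 * f =
   m%:R ^+ 8 * ((lam / 2) ^+ 9 * m%:R - f) by ring.
rewrite mulr_ge0 ?exprn_ge0 ?(ltW m0)// subr_ge0.
have -> : f = (lam / 2) ^+ 9 * (f * (2 / lam) ^+ 9).
  rewrite mulrCA -exprMn (_ : lam / 2 * (2 / lam) = 1) ?expr1n ?mulr1//.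
  by field; rewrite gt_eqF.
rewrite ler_wpM2l ?exprn_ge0 ?divr_ge0 ?(ltW l0)//.
by apply: (le_trans hN); rewrite ler_nat ltnW.
Qed.

Lemma ln_ge1 (x : R) : 3 <= x -> 1 <= ln x.
Proof.
move=> x3; rewrite -[leLHS](expRK (1 : R)) ler_ln ?posrE ?expR_gt0//; last lra.
exact: le_trans (expR1_le3) x3.
Qed.

Lemma mixing_time_ok (lam n : R) (L1 : nat) : 0 < lam <= 1 -> 1 <= n ->
  3 * ln n / lam <= L1%:R -> (1 - lam) ^+ L1 * n ^+ 3 <= 1.
Proof.
move=> /andP[l0 l1] n1 hL.
have n0 : 0 < n by lra.
apply: (@le_trans _ _ (expR (- lam) ^+ L1 * expR (ln n) ^+ 3)).
  rewrite lnK ?posrE// ler_wpM2r ?exprn_ge0 ?(ltW n0)//.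
  by rewrite lerXn2r ?nnegrE ?expR_ge0 ?expR_ge1Dx//; lra.
rewrite -!expRM_natr -expRD -[leRHS]expR0 ler_expR.
move: hL; rewrite ler_pdivrMr//; lra.
Qed.

Lemma cover_time_ok (lam n : R) (k S0 : nat) : 0 < lam <= 1 -> 1 <= n -> (0 < k)%N ->
  2 * ln n / lam * (n / k%:R) <= S0%:R ->
  n * ((1 - lam / (2 * n)) ^+ k) ^+ S0 <= 1.
Proof.
move=> /andP[l0 l1] n1 k0 hS.
have n0 : 0 < n by lra.
have kk : 0 < k%:R :> R by rewrite ltr0n.
have ln2 : lam / (2 * n) <= 1 by rewrite ler_pdivrMr; lra.
apply: (@le_trans _ _ (expR (ln n) * (expR (- (lam / (2 * n))) ^+ k) ^+ S0)).
  rewrite lnK ?posrE// ler_wpM2l ?(ltW n0)//.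
  rewrite lerXn2r ?nnegrE ?exprn_ge0 ?expR_ge0//; first lra.
  by rewrite lerXn2r ?nnegrE ?expR_ge0 ?expR_ge1Dx//; lra.
rewrite -!expRM_natr -expRD -[leRHS]expR0 ler_expR.
have c0 : 0 <= lam / (2 * n) * k%:R by rewrite mulr_ge0 ?divr_ge0// ltW//; lra.
have := ler_wpM2l c0 hS.
have -> : lam / (2 * n) * k%:R * (2 * ln n / lam * (n / k%:R)) = ln n.
  by field; rewrite !gt_eqF.
lra.
Qed.

(** Roundings are absorbed by [mix >= 1] and [lg >= 1], absolute constants by [1 / lam >= 2]. The
    term [192 / lam ^+ 2] is [4 * 48 / lam ^+ 2], from coalescence. *)
Lemma time_constants (lam mix lg n k k' T0 L1 S0 : R) (C := 30 / lam + 192 / lam ^+ 2) :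
  0 < lam <= 2^-1 -> 1 <= mix -> 1 <= lg -> lg <= n -> 0 < k -> n / k' <= n / k + 1 ->
  T0 <= 4 * mix + 1 -> L1 <= 3 * lg / lam + 1 -> S0 <= 2 * lg / lam * (n / k') + 1 ->
  [/\ T0 + L1 + 12 / lam * (n / k') + (T0 + 1) <= C * (mix + lg + n / k),
      T0 + L1 + S0 + 12 / lam * (n / k') + (T0 + 1) <= C * (mix + lg + n * lg / k) &
      T0 + n + L1 + 4 * (48 / lam + 2) / lam * n + (T0 + 1) <= C * (mix + n)].
Proof.
move=> /andP[l0 l1] mix1 ln1 lgn k0 hk hT hL hS.
have v2 : 2 <= lam^-1 by rewrite -[2]invrK lef_pV2 ?posrE.
rewrite /C; have -> : 192 / lam ^+ 2 = 192 * (lam^-1 * lam^-1) by field; rewrite gt_eqF.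
set v := lam^-1 in v2 hL hS *; set w := n / k' in hk hS *.
rewrite [n * lg / k]mulrAC; set y := n / k in hk *.
have n0 : 0 <= n by lra.
have y0 : 0 <= y by rewrite divr_ge0// ltW.
have lny : y <= y * lg by rewrite ler_peMr.
have wl : lg * v * w <= lg * v * (y + 1) by rewrite ler_wpM2l// mulr_ge0//; lra.
have wv : v * w <= v * (y + 1) by rewrite ler_wpM2l//; lra.
have vm : 2 * mix <= v * mix by rewrite ler_wpM2r//; lra.
have vmv : v <= v * mix by rewrite ler_peMr//; lra.
have vl : 2 * lg <= v * lg by rewrite ler_wpM2r//; lra.
have vy : 2 * y <= v * y by rewrite ler_wpM2r.
have vn : 2 * n <= v * n by rewrite ler_wpM2r.
have vvn : 0 <= v * v * n by rewrite !mulr_ge0//; lra.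
have vln : v * lg <= v * n by rewrite ler_wpM2l//; lra.
have vyl : v * y <= v * (y * lg) by rewrite ler_wpM2l//; lra.
have vv0 : 0 <= v * v by rewrite mulr_ge0//; lra.
have q1 : 0 <= v * v * mix by rewrite mulr_ge0//; lra.
have q2 : 0 <= v * v * lg by rewrite mulr_ge0//; lra.
have q3 : 0 <= v * v * y by rewrite mulr_ge0.
have q4 : 0 <= v * v * (y * lg) by rewrite mulr_ge0// mulr_ge0//; lra.
split; lra.
Qed.

End Assembly.

Theorem theorem1p7 (R : realType) :
  exists (C a : R) (n0 : nat), [/\ 0 < C, 0 < a, (2 <= n0)%N &
  forall (c : R) (n : nat) (V : finType) (p q : R) (G0 : sgraph V) (k : nat),
    1 <= c -> (n0 <= n)%N -> #|V| = n ->
    0 <= p <= 1 -> 0 <= q <= 1 -> 0 < p + q <= 1 ->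
    32 * (c + 1) * (ln n%:R / n%:R) <= p / (p + q) ->
    (1 <= k)%N ->
    let mix : R := Num.max 1 (q / p) / (p + q) in
    let good : set (traj_space G0) :=
      [set G | let P t := @PLM R V (G t) in
        [/\ (t_hit k P <= (C * (mix + ln n%:R + n%:R / k%:R))%:E)%E,
            (t_cov k P <= (C * (mix + ln n%:R + n%:R * ln n%:R / k%:R))%:E)%E &
            (t_coal P <= (C * (mix + n%:R))%:E)%E]] in
    measurable good /\
    ((1 - n%:R `^ (- a))%:E <= edge_markovian p q G0 good)%E].
Proof.
(* Hiding [gap] behind an equation keeps its numerals out of the arithmetic. *)
have [lam lamE] : exists lam : R, lam = gap by exists gap.
have lam01 : 0 < lam <= 2^-1 by rewrite lamE; exact: gap_bounds.
have [N decay] := power_decay lam01.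
have lam1 : 0 < lam <= 1 by case/andP: lam01 => -> h /=; lra.
have lam0 : 0 < lam by case/andP: lam1.
(* [N] ensures the decay over the window of [n^2] steps, and 5 the final sum of failure
   probabilities. *)
exists (30 / lam + 192 / lam ^+ 2), 1, (maxn N 5); split => //.
- by rewrite addr_gt0 ?divr_gt0 ?exprn_gt0 ?ltr0n.
- by rewrite leq_max orbT.
move=> c n V p q G0 k c1 Nn Vn p01 q01 pq01 hdense k1 mix good.
subst n.
have n5 : (5 <= #|V|)%N by apply: leq_trans Nn; rewrite leq_max leqnn orbT.
have n5' : 5 <= #|V|%:R :> R by rewrite ler_nat.
have ln1 : 1 <= ln #|V|%:R :> R by apply: ln_ge1; lra.
have lnn : ln #|V|%:R <= #|V|%:R :> R by apply/ltW/ln_sublinear; lra.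
have /andP[s0 s1] := pq01.
have mix1 : 1 <= mix.
  rewrite /mix ler_pdivlMr// mul1r; apply: (le_trans s1); by rewrite le_max lexx.
have dense : 64 * ln #|V|%:R <= #|V|%:R * (p / (p + q)).
  have x0 : 0 <= ln #|V|%:R / #|V|%:R :> R by rewrite divr_ge0//; lra.
  have : 64 * (ln #|V|%:R / #|V|%:R) <= p / (p + q).
    by apply: le_trans hdense; rewrite ler_wpM2r//; lra.
  move=> /(ler_wpM2l (ltW (lt_le_trans _ n5'))) => /(_ (ltr0n _ 5)).
  by have -> : #|V|%:R * (64 * (ln #|V|%:R / #|V|%:R)) = 64 * ln #|V|%:R :> R by field; rewrite gt_eqF//; lra.
have mix4 : 0 <= 4 * mix by lra.
have [T0 /andP[T0l T0u]] := nat_above mix4.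
have L1x : 0 <= 3 * ln #|V|%:R / lam by rewrite divr_ge0//; lra.
have [L1 /andP[L1l L1u]] := nat_above L1x.
have k'0 : (0 < minn k #|V|)%N by rewrite leq_min k1 (leq_trans _ n5).
have k'0' : 0 < (minn k #|V|)%:R :> R by rewrite ltr0n.
have S0x : 0 <= 2 * ln #|V|%:R / lam * (#|V|%:R / (minn k #|V|)%:R).
  by rewrite mulr_ge0// ?divr_ge0//; lra.
have [S0 /andP[S0l S0u]] := nat_above S0x.
have kk : 0 < k%:R :> R by rewrite ltr0n.
have hk : #|V|%:R / (minn k #|V|)%:R <= #|V|%:R / k%:R + 1 :> R.
  have y0 : 0 <= #|V|%:R / k%:R :> R by rewrite divr_ge0.
  case: leqP => _; first by lra.
  by rewrite divff ?gt_eqF//; lra.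
have [Chit Ccov Ccoal] := time_constants lam01 mix1 ln1 lnn kk hk T0u L1u S0u.
have mle (F : traj_space G0 -> \bar R) (b : \bar R) : measurable_fun setT F ->
    measurable [set G | (F G <= b)%E].
  move=> mF; rewrite -[X in measurable X]setTI.
  by apply: measurable_lee => //; exact: measurable_cst.
have mgood : measurable good.
  pose A1 := mle _ ((30 / lam + 192 / lam ^+ 2) * (mix + ln #|V|%:R + #|V|%:R / k%:R))%:E
    (measurable_t_hit k).
  pose A2 := mle _ ((30 / lam + 192 / lam ^+ 2) * (mix + ln #|V|%:R + #|V|%:R * ln #|V|%:R / k%:R))%:E
    (measurable_t_cov k).
  pose A3 := mle _ ((30 / lam + 192 / lam ^+ 2) * (mix + #|V|%:R))%:E measurable_t_coal.
  apply: eq_ind (measurableI _ _ A1 (measurableI _ _ A2 A3)) _ _.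
  by apply/seteqP; split => G /=; [case=> ? [? ?] | case].
split => //.
rewrite powR_inv1; last lra.
apply: (@good_graphs_le R V p q T0 G0 n5 p01 q01 pq01 dense T0l) => //.
  by rewrite -lamE; apply: decay; apply: leq_trans Nn; rewrite leq_max leqnn.
rewrite -lamE => G window tail.
have n1 : (1 < #|V|)%N by exact: leq_trans n5.
have n1' : 1 <= #|V|%:R :> R by lra.
have Pst t := PLM_stochastic (R := R) (G t).
have Psym t := PLM_sym (R := R) (G t).
have l01 t := graph_rate01 (R := R) (G t).
have Pl t := graph_rate_contracting (R := R) (G t).
have mixing := mixing_time_ok lam1 n1' L1l.
have cover := cover_time_ok lam1 n1' k'0 S0l.
split.
- apply: (le_trans (t_hit_quenched n1 Pst Psym l01 Pl lam1 window mixing tail k1)).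
  by rewrite lee_fin natrD.
- apply: (le_trans (t_cov_quenched n1 Pst Psym l01 Pl lam1 window mixing tail k1 cover)).
  by rewrite lee_fin !natrD.
- apply: (le_trans (t_coal_quenched n1 Pst Psym l01 Pl lam1 window mixing tail)).
  by rewrite lee_fin !natrD.
Qed.
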